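(* Let $X$ be a Hausdorff topological space and $Y\subseteq X$ be a closed subset. Then the following holds: (a) If $X$ is paracompact and $Y$ is locally compact and metrizable in the induced topology, then the restriction map $\Gamma_{C^0}(E)\to\Gamma_{C^0}(E|_Y)$ has a continuous linear right inverse, for each topological vector bundle $E\to X$ over $X$ whose fibres are locally convex spaces. (b) If $X$ is metrizable and there exists a metric $d$ on $X$ defining its topology for which each $x\in Y$ has a neighbourhood $Z$ in $Y$ such that $(Z,d|_{Z\times Z})$ is complete, then the restriction map $\Gamma_{C^0}(E)\to\Gamma_{C^0}(E|_Y)$ has a continuous linear right inverse, for each topological vector bundle $E\to X$ over $X$ whose fibres are locally convex spaces. (c) If $X$ is paracompact and locally compact and $Y$ is metrizable, then the restriction map $\Gamma_{C^0_c}(E)\to\Gamma_{C^0_c}(E|_Y)$ has a continuous linear right inverse, for each topological vector bundle $E\to X$ over $X$ whose fibres are locally convex spaces. (d) If $X$ is paracompact and locally compact and $Y$ is metrizable, then the restriction map $C(X,N)\to C(Y,N)$ is a smooth submersion between manifolds of mappings, for each smooth manifold $N$ modelled on locally convex spaces such that $N$ has a local addition.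
   Context: ''Locally convex space'' (lcs) means a real, Hausdorff locally convex topological vector space. Smooth maps between open subsets of lcs are $C^\infty$ in the sense of Bastiani (Keller's $C^\infty_c$): continuous with continuous iterated directional derivatives $U\times E^j\to F$ of all orders; smooth manifolds modelled on lcs are defined accordingly. A topological vector bundle over a Hausdorff space $X$ with lcs as fibres is a Hausdorff space $E$ with a continuous map $\pi\colon E\to X$ and a vector space structure on each $E_x=\pi^{-1}(\{x\})$, such that each $x\in X$ has an open neighbourhood $U$ for which there are an lcs $F$ and a homeomorphism $\theta\colon\pi^{-1}(U)\to U\times F$ with first component $\pi$ and such that $\mathrm{pr}_2\circ\theta$ restricts to a vector space isomorphism $E_y\to F$ for all $y\in U$. $E|_Y$ is the restriction of the bundle to $Y$. $\Gamma_{C^0}(E)$ is the space of continuous sections with the compact-open topology; for $K$ closed in $X$, $\Gamma_{C^0_K}(E)$ is the subspace of sections supported in $K$ with the induced topology; if $X$ is locally compact, $\Gamma_{C^0_c}(E)=\bigcup_{K}\Gamma_{C^0_K}(E)$, $K$ ranging over compact subsets of $X$, carries the locally convex direct limit topology. A local addition on $N$ is a smooth map $\Sigma\colon U\to N$ on an open neighbourhood $U\subseteq TN$ of the zero section with $\Sigma(0_p)=p$ for all $p\in N$ such that $(\pi_{TN},\Sigma)\colon U\to N\times N$ is a $C^\infty$-diffeomorphism onto an open subset ($\pi_{TN}\colon TN\to N$ the projection). For $X$ paracompact and locally compact, the smooth manifold structure on $C(X,N)$ is as follows. For $f\in C(X,N)$ let $\Gamma_f$ be the space of continuous $\tau\colon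 X\to TN$ with $\pi_{TN}\circ\tau=f$ which vanish (i.e. equal $0_{f(x)}$) off some compact set, identified with $\Gamma_{C^0_c}(f^*(TN))$ and given its topology, and let $\mathcal{O}_f=\{\tau\in\Gamma_f:\tau(X)\subseteq U\}$, which is open. $C(X,N)$ is given the final topology with respect to the maps $\mathcal{O}_f\to C(X,N)$, $\tau\mapsto\Sigma\circ\tau$; these are homeomorphisms onto open subsets whose inverses form a smooth atlas. The structure does not depend on $\Sigma$. Likewise for $C(Y,N)$. A smooth map $f\colon P\to Q$ between smooth manifolds modelled on lcs is a submersion if for each $x\in P$ there are charts $\phi\colon U_\phi\to V_\phi\subseteq E_\phi$ of $P$ with $x\in U_\phi$ and $\psi\colon U_\psi\to V_\psi\subseteq E_\psi$ of $Q$ with $f(U_\phi)\subseteq U_\psi$, and a continuous linear map $p\colon E_\phi\to E_\psi$ admitting a continuous linear right inverse, such that $p(V_\phi)\subseteq V_\psi$ and $\psi\circ f|_{U_\phi}=p\circ\phi$. *)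

(* Defs.v *)
From HB Require Import structures.
From mathcomp Require Import all_boot all_order all_algebra.
From mathcomp Require Import all_classical all_reals all_analysis.

Set Implicit Arguments.
Unset Strict Implicit.
Unset Printing Implicit Defensive.

Import Order.TTheory GRing.Theory Num.Theory.
Import numFieldNormedType.Exports.

Local Open Scope classical_set_scope.
Local Open Scope ring_scope.

(* Conventions: a locally convex space is a [tvsType R] (whose axioms include
   local convexity) that is moreover [hausdorff_space]; a subset [Y : set X],
   used as a type, carries the induced topology. *)

Definition paracompact (T : topologicalType) : Prop :=
  forall C : set (set T), C `<=` open -> \bigcup_(U in C) U = setT ->
  exists D : set (set T),
    [/\ D `<=` open,
        \bigcup_(V in D) V = setT,
        forall V, D V -> exists2 U, C U & V `<=` U &
        forall x : T, exists2 W : set T, nbhs x W &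
          finite_set [set V | D V /\ V `&` W !=set0]].

Definition is_metric (R : realType) (T : Type) (d : T -> T -> R) : Prop :=
  [/\ forall x y, 0 <= d x y,
      forall x y, d x y = 0 <-> x = y,
      forall x y, d x y = d y x &
      forall x y z, d x z <= d x y + d y z].

Definition defines_topology (R : realType) (T : topologicalType)
    (d : T -> T -> R) : Prop :=
  is_metric d /\
  forall (x : T) (A : set T),
    nbhs x A <-> exists2 e : R, 0 < e & [set y | d x y < e] `<=` A.

Definition metrizable (R : realType) (T : topologicalType) : Prop :=
  exists d : T -> T -> R, defines_topology d.

Definition complete_on (R : realType) (T : Type) (d : T -> T -> R)
    (Z : set T) : Prop :=
  forall u : nat -> T, (forall n, Z (u n)) ->
  (forall e : R, 0 < e -> exists N, forall m n,
    (N <= m)%N -> (N <= n)%N -> d (u m) (u n) < e) ->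
  exists2 x, Z x &
    forall e : R, 0 < e -> exists N, forall n, (N <= n)%N -> d (u n) x < e.

Definition final_topology (T : choiceType) (I : Type)
  (Z : I -> topologicalType) (g : forall i, Z i -> T) : Type := T.

Section FinalTopology.
Context (T : choiceType) (I : Type) (Z : I -> topologicalType)
  (g : forall i, Z i -> T).

Definition final_open : set (set (final_topology g)) :=
  [set O | forall i, open (@g i @^-1` O)].

Lemma final_openT : final_open setT.
Proof. by move=> i; rewrite preimage_setT; exact: openT. Qed.

Lemma final_openI : setI_closed final_open.
Proof. by move=> A B oA oB i; rewrite preimage_setI; exact: openI. Qed.

Lemma final_open_bigU (J : Type) (f : J -> set (final_topology g)) :
  (forall j, final_open (f j)) -> final_open (\bigcup_j f j).
Proof.
by move=> of_ i; rewrite preimage_bigcup; apply: bigcup_open => j _; exact: of_.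
Qed.

HB.instance Definition _ := Choice.on (final_topology g).
HB.instance Definition _ := isOpenTopological.Build (final_topology g)
  final_openT final_openI final_open_bigU.
End FinalTopology.

(* A family of vector spaces over X with a topology on its total space, which
   is the disjoint union of the fibres. *)
Record vfamily (R : realType) (X : Type) := VFamily {
  fib : X -> lmodType R;
  total_top : Topological {x : X & fib x}
}.

Definition total (R : realType) (X : Type) (E : vfamily R X) : topologicalType :=
  Topological.Pack (total_top E).

Definition tot (R : realType) (X : Type) (E : vfamily R X) (x : X)
  (v : fib E x) : total E := existT (fun y => fib E y : Type) x v.

Definition proj (R : realType) (X : Type) (E : vfamily R X) (e : total E) : X :=
  tag e.

(* The homeomorphism is [e |-> (proj e, h e)], with inverse [tot (g _ _)]. *)
Definition trivialization (R : realType) (X : topologicalType) (E : vfamily R X)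
    (U : set X) (F : tvsType R)
    (h : forall x, fib E x -> F) (g : forall x, F -> fib E x) : Prop :=
  [/\ forall x, U x -> [/\ linear (h x), cancel (h x) (g x) & cancel (g x) (h x)],
      {within @proj R X E @^-1` U, continuous (fun e : total E => h _ (tagged e))} &
      {within U `*` setT, continuous (fun p : X * F => tot (g p.1 p.2))}].

Definition is_vector_bundle (R : realType) (X : topologicalType)
    (E : vfamily R X) : Prop :=
  [/\ hausdorff_space (total E),
      continuous (@proj R X E) &
      forall x : X, exists U : set X, [/\ open U, U x &
        exists F : tvsType R, hausdorff_space F /\
        exists h g, @trivialization R X E U F h g]].

Definition pullback_map (R : realType) (X' X : topologicalType) (g : X' -> X)
    (E : vfamily R X) (e : {x : X' & fib E (g x)}) : X' * total E :=
  (tag e, tot (tagged e)).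

Definition pullback (R : realType) (X' X : topologicalType) (g : X' -> X)
    (E : vfamily R X) : vfamily R X' :=
  @VFamily R X' (fun x => fib E (g x))
    (Topological.class (initial_topology (@pullback_map R X' X g E))).

Definition restrict_bundle (R : realType) (X : topologicalType) (Y : set X)
  (E : vfamily R X) : vfamily R Y := pullback (set_val : Y -> X) E.

Record section (R : realType) (X : topologicalType) (E : vfamily R X) := MkSection {
  sec :> forall x, fib E x;
  sec_continuous : continuous (fun x => tot (sec x))
}.

Section SectionTopology.
Context (R : realType) (X : topologicalType) (E : vfamily R X).

HB.instance Definition _ := gen_eqMixin (section E).
HB.instance Definition _ := gen_choiceMixin (section E).

Definition section_map (s : section E) : {compact-open, X -> total E} :=
  fun x => tot (s x).

HB.instance Definition _ :=
  Topological.copy (section E) (initial_topology section_map).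
End SectionTopology.

Definition supported (R : realType) (X : topologicalType) (E : vfamily R X)
    (K : set X) (s : forall x, fib E x) : Prop :=
  forall x, ~ K x -> s x = 0.

Record csection (R : realType) (X : topologicalType) (E : vfamily R X) := MkCSection {
  csec :> section E;
  csec_supported : exists2 K : set X, compact K & supported K csec
}.

(* The locally convex direct limit topology: a basis of neighbourhoods of 0 is
   given by the absolutely convex sets W which meet each space of sections
   supported in a compact set K in a neighbourhood of 0 for the compact-open
   topology. *)
Section CSectionTopology.
Context (R : realType) (X : topologicalType) (E : vfamily R X).
Implicit Types (s t u w : csection E) (W O : set (csection E)).

HB.instance Definition _ := gen_eqMixin (csection E).
HB.instance Definition _ := gen_choiceMixin (csection E).

Definition absolutely_convex W : Prop :=
  forall (a b : R) s t u, W s -> W t -> `|a| + `|b| <= 1 ->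
    (forall x, u x = a *: s x + b *: t x) -> W u.

Definition lc_zero_nbhs W : Prop :=
  absolutely_convex W /\
  forall K : set X, compact K ->
    exists2 G : set (section E),
      open G /\ (forall z : section E, (forall x, z x = 0) -> G z) &
      forall t, supported K t -> G t -> W t.

Definition csection_open : set (set (csection E)) :=
  [set O | forall s, O s -> exists2 W, lc_zero_nbhs W &
    forall w t, W w -> (forall x, t x = s x + w x) -> O t].

Lemma csection_openT : csection_open setT.
Proof.
move=> s _; exists setT => //; split=> // K _.
by exists setT => //; split=> //; exact: openT.
Qed.

Lemma lc_zero_nbhsI W W' :
  lc_zero_nbhs W -> lc_zero_nbhs W' -> lc_zero_nbhs (W `&` W').
Proof.
move=> [cW nW] [cW' nW']; split.
  move=> a b s t u [Ws W's] [Wt W't] ab uE.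
  by split; [exact: cW uE | exact: cW' uE].
move=> K cK; have [G [oG G0] GW] := nW _ cK; have [G' [oG' G'0] GW'] := nW' _ cK.
exists (G `&` G'); first by split; [exact: openI | move=> z z0; split; auto].
by move=> t Kt [Gt G't]; split; auto.
Qed.

Lemma csection_openI : setI_closed csection_open.
Proof.
move=> A B oA oB s [/oA[W nW WA] /oB[W' nW' W'B]].
exists (W `&` W'); first exact: lc_zero_nbhsI.
by move=> w t [Ww W'w] tE; split; [exact: WA tE | exact: W'B tE].
Qed.

Lemma csection_open_bigU (J : Type) (f : J -> set (csection E)) :
  (forall j, csection_open (f j)) -> csection_open (\bigcup_j f j).
Proof.
move=> of_ s [j _ /of_[W nW Wf]]; exists W => // w t Ww tE.
by exists j => //; exact: Wf tE.
Qed.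

HB.instance Definition _ := isOpenTopological.Build (csection E)
  csection_openT csection_openI csection_open_bigU.
End CSectionTopology.

(* The restriction maps of sections to Y have a continuous linear right
   inverse; vector space operations on sections are pointwise. *)
Definition section_extension (R : realType) (X : topologicalType) (Y : set X)
    (E : vfamily R X) : Prop :=
  exists ext : section (restrict_bundle Y E) -> section E,
    [/\ continuous ext,
        forall (a : R) (s t u : section (restrict_bundle Y E)),
          (forall y, u y = a *: s y + t y) ->
          forall x, ext u x = a *: ext s x + ext t x &
        forall (s : section (restrict_bundle Y E)) (y : Y),
          ext s (set_val y) = s y].

Definition csection_extension (R : realType) (X : topologicalType) (Y : set X)
    (E : vfamily R X) : Prop :=
  exists ext : csection (restrict_bundle Y E) -> csection E,
    [/\ continuous ext,
        forall (a : R) (s t u : csection (restrict_bundle Y E)),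
          (forall y, u y = a *: s y + t y) ->
          forall x, ext u x = a *: ext s x + ext t x &
        forall (s : csection (restrict_bundle Y E)) (y : Y),
          ext s (set_val y) = s y].

Section Bastiani.
Context (R : realType) (E F : tvsType R).
Implicit Types (f : E -> F) (x v : E) (U : set E).

Definition is_dirderiv f x v (l : F) : Prop :=
  (fun t : R => t^-1 *: (f (x + t *: v) - f x)) @ (0 : R)^' --> l.

Definition dirderiv f x v : F := xget 0 [set l | is_dirderiv f x v l].

(* [iter_dirderiv f [:: v1; ..; vk] x] is (D_v1 .. D_vk f)(x). *)
Definition iter_dirderiv f (vs : seq E) : E -> F :=
  foldr (fun v (h : E -> F) x => dirderiv h x v) f vs.

Definition smooth_on U f : Prop :=
  (forall (vs : seq E) x v, U x -> exists l, is_dirderiv (iter_dirderiv f vs) x v l) /\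
  forall k : nat, {within U `*` setT, continuous
    (fun p : E * {ptws 'I_k -> E} =>
       iter_dirderiv f [seq p.2 i | i <- enum 'I_k] p.1)}.
End Bastiani.

(* [cfwd] and [cbwd] are only meaningful on [cdom] and [crange]. *)
Record chart (R : realType) (M : topologicalType) := Chart {
  model : tvsType R;
  cdom : set M;
  cfwd : M -> model;
  cbwd : model -> M
}.
Arguments cfwd {R M} c _.
Arguments cbwd {R M} c _.

Definition crange (R : realType) (M : topologicalType) (c : chart R M) :
  set (model c) := cfwd c @` cdom c.

Arguments crange {R M} c _.

Definition is_chart (R : realType) (M : topologicalType) (c : chart R M) : Prop :=
  [/\ hausdorff_space (model c), open (cdom c) & open (crange c)] /\
  [/\ forall x, cdom c x -> cbwd c (cfwd c x) = x,
      {within cdom c, continuous (cfwd c)} &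
      {within crange c, continuous (cbwd c)}].

Definition smooth_transition (R : realType) (M : topologicalType)
    (c d : chart R M) : Prop :=
  smooth_on (cfwd c @` (cdom c `&` cdom d)) (cfwd d \o cbwd c).

(* Sets of charts, as predicates: [set] does not apply to types as large as
   [chart R M]. *)
Definition atlas_on (R : realType) (M : topologicalType) := chart R M -> Prop.

Definition smooth_atlas (R : realType) (M : topologicalType)
    (A : atlas_on R M) : Prop :=
  [/\ hausdorff_space M,
      forall c, A c -> is_chart c,
      forall x, exists2 c, A c & cdom c x &
      forall c d, A c -> A d -> smooth_transition c d].

Definition maximal_atlas (R : realType) (M : topologicalType)
    (A : atlas_on R M) : atlas_on R M :=
  fun c => is_chart c /\
    forall d, A d -> smooth_transition c d /\ smooth_transition d c.

Definition smooth_map_on (R : realType) (M N : topologicalType)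
    (A : atlas_on R M) (B : atlas_on R N) (W : set M) (f : M -> N) : Prop :=
  {within W, continuous f} /\
  forall c d, A c -> B d ->
    smooth_on (cfwd c @` (cdom c `&` W `&` f @^-1` cdom d))
              (cfwd d \o f \o cbwd c).

Definition is_submersion (R : realType) (P Q : topologicalType)
    (A : atlas_on R P) (B : atlas_on R Q) (f : P -> Q) : Prop :=
  [/\ smooth_atlas A, smooth_atlas B, smooth_map_on A B setT f &
      forall x : P, exists c d,
        [/\ maximal_atlas A c, maximal_atlas B d, cdom c x,
            f @` cdom c `<=` cdom d &
            exists (p : {linear model c -> model d})
                   (r : {linear model d -> model c}),
              [/\ continuous p, continuous r, cancel r p,
                  p @` crange c `<=` crange d &
                  forall y, cdom c y -> cfwd d (f y) = p (cfwd c y)]]].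

Record manifold (R : realType) := Manifold {
  mspace :> topologicalType;
  atlas : atlas_on R mspace;
  atlas_smooth : smooth_atlas atlas
}.

Definition prod_chart (R : realType) (M N : topologicalType)
    (c : chart R M) (d : chart R N) : chart R (M * N)%type :=
  @Chart R (M * N)%type (model c * model d)%type (cdom c `*` cdom d)
    (fun x => (cfwd c x.1, cfwd d x.2)) (fun v => (cbwd c v.1, cbwd d v.2)).

Definition prod_atlas (R : realType) (M N : topologicalType)
    (A : atlas_on R M) (B : atlas_on R N) : atlas_on R (M * N)%type :=
  fun e => exists c d, [/\ A c, B d & e = prod_chart c d].

(* The class [c, v] of a chart c around p and of a vector v of its model space
   is represented by its component in a chosen chart around p, so that T_p N is
   the model space of that chart. *)
Section Tangent.
Context (R : realType) (N : manifold R).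

Lemma chart_around_ex (p : N) : exists c, @atlas R N c /\ cdom c p.
Proof. by have [_ _ /(_ p)[c Ac cp] _] := @atlas_smooth R N; exists c. Qed.

Definition chart_around (p : N) : chart R N := sval (cid (chart_around_ex p)).

Definition tangent_space (p : N) : lmodType R := model (chart_around p).

Definition tangent_fwd (c : chart R N) (e : {p : N & tangent_space p}) :
    model c * model c :=
  let: existT p v := e in
  (cfwd c p, dirderiv (cfwd c \o cbwd (chart_around p)) (cfwd (chart_around p) p) v).

Definition tangent_bwd (c : chart R N) (xv : model c * model c) :
    {p : N & tangent_space p} :=
  let p := cbwd c xv.1 in
  existT (fun q => tangent_space q : Type) p
    (dirderiv (cfwd (chart_around p) \o cbwd c) xv.1 xv.2).

Definition tangent_param (c : {c : chart R N | @atlas R N c})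
    (xv : crange (sval c) `*` [set: model (sval c)]) : {p : N & tangent_space p} :=
  tangent_bwd (set_val xv).

Definition tangent_bundle : vfamily R N :=
  @VFamily R N tangent_space (Topological.class (final_topology tangent_param)).

Definition tangent_chart (c : chart R N) : chart R (total tangent_bundle) :=
  @Chart R (total tangent_bundle) (model c * model c)%type
    (@proj R N tangent_bundle @^-1` cdom c) (@tangent_fwd c) (@tangent_bwd c).

Definition tangent_atlas : atlas_on R (total tangent_bundle) :=
  fun d => exists2 c, @atlas R N c & d = tangent_chart c.
End Tangent.

(* [la_map] is only meaningful on [la_dom]. *)
Record local_addition (R : realType) (N : manifold R) := LocalAddition {
  la_dom : set (total (tangent_bundle N));
  la_map : total (tangent_bundle N) -> N;
  la_pair := fun e : total (tangent_bundle N) => (proj e, la_map e);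
  la_dom_open : open la_dom;
  la_dom0 : forall p : N, la_dom (tot (0 : fib (tangent_bundle N) p));
  la_map0 : forall p : N, la_map (tot (0 : fib (tangent_bundle N) p)) = p;
  la_smooth : smooth_map_on (@tangent_atlas R N) (@atlas R N) la_dom la_map;
  la_image_open : open (la_pair @` la_dom);
  la_diffeo :
    smooth_map_on (@tangent_atlas R N) (prod_atlas (@atlas R N) (@atlas R N))
      la_dom la_pair /\
    exists2 inv : N * N -> total (tangent_bundle N),
      (forall e, la_dom e -> inv (la_pair e) = e) &
      smooth_map_on (prod_atlas (@atlas R N) (@atlas R N)) (@tangent_atlas R N)
        (la_pair @` la_dom) inv
}.

Section MappingSpace.
Context (R : realType) (N : manifold R) (S : local_addition N)
  (X : topologicalType).
Implicit Types f : continuousType X N.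

Definition lifts f := csection (pullback f (tangent_bundle N)).

Definition lift_map f (s : lifts f) : X -> total (tangent_bundle N) :=
  fun x => @tot R N (tangent_bundle N) (f x) (s x).

Definition small_lifts f : set (lifts f) :=
  [set s | forall x, la_dom S (lift_map s x)].

Lemma lift_map_continuous f (s : lifts f) : continuous (lift_map s).
Proof.
move=> x; have -> : lift_map s = snd \o (@pullback_map R X N f (tangent_bundle N)
  : initial_topology (@pullback_map R X N f (tangent_bundle N)) -> _)
  \o (fun x => tot (s x)) by [].
apply: continuous_comp; first exact: (@sec_continuous _ _ _ s).
apply: continuous_comp; last exact: cvg_snd.
exact: initial_continuous.
Qed.

Lemma la_lift_continuous f (s : @small_lifts f) :
  continuous (la_map S \o lift_map (set_val s)).
Proof.
move=> x; apply: continuous_comp; first exact: lift_map_continuous.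
have [+ _] := la_smooth S.
rewrite continuous_open_subspace; last exact: la_dom_open.
by apply; rewrite inE; have := set_valP s; exact.
Qed.

Definition mapping_param f (s : @small_lifts f) : continuousType X N :=
  mkcts (@la_lift_continuous f s).

Definition mapping_space : topologicalType := final_topology mapping_param.

(* The charts tau |-> (la_map S \o tau)^-1, where the space of lifts of f is
   identified with a locally convex space by means of [i]. *)
Definition mapping_atlas : atlas_on R mapping_space :=
  fun c => exists f (i : lifts f -> model c),
    [/\ bijective i, continuous i, forall O, open O -> open (i @` O) &
        forall (a : R) (s t u : lifts f),
          (forall x, u x = a *: s x + t x) -> i u = a *: i s + i t] /\
    [/\ cdom c = range (@mapping_param f) &
        forall s : @small_lifts f,
          cfwd c (mapping_param s) = i (set_val s) /\
          cbwd c (i (set_val s)) = mapping_param s].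
End MappingSpace.
Arguments mapping_atlas {R N} S X _.

Section RestrictMapping.
Context (R : realType) (N : manifold R) (S : local_addition N)
  (X : topologicalType) (Y : set X).

Lemma restrict_continuous (h : continuousType X N) :
  continuous (h \o (set_val : Y -> X)).
Proof.
move=> y; apply: continuous_comp; last exact: cts_fun.
exact: initial_continuous.
Qed.

Definition restrict_mapping (h : mapping_space S X) : mapping_space S Y :=
  mkcts (@restrict_continuous h).
End RestrictMapping.
Arguments restrict_mapping {R N} S {X} Y h.

(* Main.v *)
(* For (a)-(c), a partition of unity reduces the extension of sections to that of
   vector-valued functions, for which Dugundji's theorem provides a linear
   operator once X carries a continuous pseudometric inducing the topology of Y;
   such a pseudometric is assembled from a metric of Y by means of partitions of
   unity. The operator is continuous for the compact-open topology because the
   extension on a compact set K only involves values on a compact subset of Y.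

   For (d), in the charts given by the local addition at f and f|Y the
   restriction map C(X,N) -> C(Y,N) is the restriction of a continuous linear
   map, tau |-> tau|Y, which has a continuous linear right inverse by (c). Both
   the changes of charts and the smoothness of the restriction map reduce to the
   following: a fibrewise smooth map phi between vector bundles induces a smooth
   map tau |-> phi o tau between spaces of compactly supported sections, whose
   derivatives are again of this form. *)

Require Import Defs.
From HB Require Import structures.
From mathcomp Require Import all_boot all_order all_algebra.
From mathcomp Require Import all_classical all_reals all_analysis.
From mathcomp Require Import wochoice lra ring.

Set Implicit Arguments.
Unset Strict Implicit.
Unset Printing Implicit Defensive.

Import Order.TTheory GRing.Theory Num.Theory.
Import numFieldNormedType.Exports.

Local Open Scope classical_set_scope.
Local Open Scope ring_scope.

(** * Continuous seminorms *)

(** Two obstacles shape the proof. The model spaces need not be complete, so integrals are avoided: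
    every passage from derivatives to increments is a mean value inequality for one continuous
    seminorm at a time ([seminorm_mvt]); linearity of derivatives, chain rule and continuity of
    push-forwards all rest on it. And a neighbourhood of zero in the direct limit topology on
    compactly supported sections is a [box], whose bounds over the members of a locally finite
    family must sum to at most 1. Smallness on each member is therefore not enough: the push-forward
    needs errors dominated linearly by the increments of its arguments, uniformly on compact sets
    ([psmooth_estimate]), so that a summable bound on the data gives one on the result. Difference
    quotients are easier, since they are supported where the direction is. Continuity is tested
    along arbitrary filters, so that a point of a compact set, a step size or the parameter of a
    segment can be adjoined by a product filter; [section_cvg] and [section_eval] handle the
    compact-open topology in the same way. *)

Lemma filter_imp (Z : Type) (F : set_system Z) (FF : Filter F) (P Q : set Z) :
  F P -> (forall z, P z -> Q z) -> F Q.
Proof. by move=> FP PQ; exact: filterS FP. Qed.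

Lemma filter_imp2 (Z : Type) (F : set_system Z) (FF : Filter F) (P P' Q : set Z) :
  F P -> F P' -> (forall z, P z -> P' z -> Q z) -> F Q.
Proof. by move=> FP FP' PQ; apply: filterS (filterI FP FP') => z [? ?]; exact: PQ. Qed.

Section Seminorms.
Context {R : realType}.

Definition seminorm (E : tvsType R) (q : E -> R) : Prop :=
  [/\ forall x y, q (x + y) <= q x + q y,
      forall a x, q (a *: x) = `|a| * q x &
      forall e, 0 < e -> \forall x \near (0 : E), q x < e].

Context {E : tvsType R}.
Implicit Types q p : E -> R.

Lemma tcvgD (Z : Type) (F : set_system Z) {FF : Filter F} (f g : Z -> E) (a b : E) :
  f @ F --> a -> g @ F --> b -> (fun z => f z + g z) @ F --> a + b.
Proof.
move=> fa gb; apply: (@cvg_comp _ _ _ (fun z => (f z, g z)) (fun x : E * E => x.1 + x.2) _ (nbhs (a, b))).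
  exact: cvg_pair.
exact: (@add_continuous E (a, b)).
Qed.

Lemma tcvgZ (Z : Type) (F : set_system Z) {FF : Filter F} (r : Z -> R) (f : Z -> E)
    (a : R) (b : E) :
  r @ F --> a -> f @ F --> b -> (fun z => r z *: f z) @ F --> a *: b.
Proof.
move=> fa gb; apply: (@cvg_comp _ _ _ (fun z => (r z : R^o, f z)) (fun x : R^o * E => x.1 *: x.2) _ (nbhs (a : R^o, b))).
  exact: (@cvg_pair Z R^o E F (nbhs (a : R^o)) (nbhs b) _ _ _ r f fa gb).
exact: (@scale_continuous R E (a, b)).
Qed.

Lemma tcvgN (Z : Type) (F : set_system Z) {FF : Filter F} (f : Z -> E) (a : E) :
  f @ F --> a -> (fun z => - f z) @ F --> - a.
Proof.
move=> fa; rewrite -scaleN1r.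
have -> : (fun z => - f z) = (fun z => (fun=> -1) z *: f z).
  by apply/funext => z; rewrite scaleN1r.
by apply: tcvgZ => //; exact: cvg_cst.
Qed.

Lemma tcvgB (Z : Type) (F : set_system Z) {FF : Filter F} (f g : Z -> E) (a b : E) :
  f @ F --> a -> g @ F --> b -> (fun z => f z - g z) @ F --> a - b.
Proof. by move=> fa gb; apply: tcvgD => //; exact: tcvgN. Qed.

Lemma tcvg_sum (Z : Type) (F : set_system Z) {FF : Filter F} (I : eqType) (s : seq I)
    (f : I -> Z -> E) (l : I -> E) :
  (forall i, i \in s -> f i @ F --> l i) ->
  (fun z => \sum_(i <- s) f i z) @ F --> \sum_(i <- s) l i.
Proof.
elim: s => [|i s IH] H.
  rewrite big_nil; have -> : (fun z => \sum_(i <- [::]) f i z) = fun=> 0.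
    by apply/funext => z; rewrite big_nil.
  exact: cvg_cst.
rewrite big_cons; have -> : (fun z => \sum_(i <- i :: s) f i z) =
    (fun z => f i z + \sum_(i <- s) f i z).
  by apply/funext => z; rewrite big_cons.
apply: tcvgD; first by apply: H; rewrite mem_head.
by apply: IH => j js; apply: H; rewrite inE js orbT.
Qed.

Lemma seminorm0 q : seminorm q -> q 0 = 0.
Proof. by move=> [_ qZ _]; rewrite -(scale0r 0) qZ normr0 mul0r. Qed.

Lemma seminormN q x : seminorm q -> q (- x) = q x.
Proof. by move=> [_ qZ _]; rewrite -scaleN1r qZ normrN1 mul1r. Qed.

Lemma seminorm_ge0 q x : seminorm q -> 0 <= q x.
Proof.
move=> sq; have [qD _ _] := sq.
by have := qD x (- x); rewrite subrr seminorm0// seminormN// -mulr2n pmulrn_lge0.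
Qed.

Lemma seminorm_sum q (I : Type) (s : seq I) (f : I -> E) : seminorm q ->
  q (\sum_(i <- s) f i) <= \sum_(i <- s) q (f i).
Proof.
move=> sq; have [qD _ _] := sq.
elim: s => [|i s IH]; first by rewrite !big_nil seminorm0.
by rewrite !big_cons; apply: (le_trans (qD _ _)); rewrite lerD2l.
Qed.

Lemma seminormZ_scale q (c : R) : 0 <= c -> seminorm q -> seminorm (fun x => c * q x).
Proof.
move=> c0 sq; have [qD qZ qc] := sq; split.
- by move=> x y; rewrite -mulrDr ler_wpM2l.
- by move=> a x; rewrite qZ mulrCA.
- move=> e e0; have : 0 < e / (c + 1) by rewrite divr_gt0// ltr_wpDl.
  move=> /qc; apply: filterS => x; rewrite ltr_pdivlMr ?ltr_wpDl// => xe.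
  apply: le_lt_trans xe; rewrite mulrC ler_wpM2l ?seminorm_ge0// lerDl//.
Qed.

Lemma seminormD q p : seminorm q -> seminorm p -> seminorm (fun x => q x + p x).
Proof.
move=> sq sp; have [qD qZ qc] := sq; have [pD pZ pc] := sp; split.
- by move=> x y; rewrite addrACA lerD.
- by move=> a x; rewrite qZ pZ mulrDr.
- move=> e e0; have e20 : 0 < e / 2 by rewrite divr_gt0.
  apply: (filter_imp2 _ (qc _ e20) (pc _ e20)) => x qx px.
  by rewrite [e]splitr; exact: ltrD.
Qed.

Lemma seminorm_zero : seminorm (fun=> 0 : R) (E := E).
Proof.
split=> [x y|a x|e e0]; [by rewrite addr0|by rewrite mulr0|].
by apply: filterE => x.
Qed.

Lemma cvg_scale_inv (x : E) (V : set E) : nbhs (0 : E) V ->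
  exists2 e : R, 0 < e & forall t, `|t| < e -> V (t *: x).
Proof.
move=> V0; have H : (fun t : R => t *: x) @ (0 : R) --> (0 : E).
  by rewrite -(scale0r x); apply: tcvgZ; [exact: cvg_id|exact: cvg_cst].
have /nbhs_ballP[e /= e0 He] := H _ V0.
by exists e => // t te; apply: He; rewrite /ball/= sub0r normrN.
Qed.

Lemma convex_setP (A : set E) (x y : E) (l : R) : convex_set A ->
  A x -> A y -> 0 <= l <= 1 -> A (l *: x + (1 - l) *: y).
Proof.
move=> cA Ax Ay /andP[l0 l1].
by have := cA x y (Itv01 l0 l1); rewrite !inE => /(_ Ax Ay).
Qed.

(* [q] is the Minkowski gauge of a symmetric convex neighbourhood of 0. *)
Lemma seminorm_nbhs (V : set E) : nbhs (0 : E) V ->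
  exists2 q, seminorm q & forall x, q x < 1 -> V x.
Proof.
move=> V0; have [B Bc [Bo Bb]] := @locally_convex R E.
have [C0 [BC0 C00] C0V] := Bb 0 _ V0.
pose C := C0 `&` (-%R @` C0).
have nC0 : nbhs (0 : E) C0 by apply: open_nbhs_nbhs; split => //; exact: Bo.
have nC : nbhs (0 : E) C by apply: filterI => //; exact: nbhs0N.
have cC0 : convex_set C0 by apply: Bc; rewrite inE.
have cC x y l : C x -> C y -> 0 <= l <= 1 -> C (l *: x + (1 - l) *: y).
  move=> [Cx [x' Cx' xE]] [Cy [y' Cy' yE]] l01; split; first exact: convex_setP.
  exists (l *: x' + (1 - l) *: y'); first exact: convex_setP.
  by rewrite opprD -!scalerN xE yE.
have CN x : C x -> C (- x).
  by move=> [Cx [x' Cx' xE]]; split; [rewrite -xE opprK|exists x].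
have C0' : C 0 by exact: nbhs_singleton.
have CZ x (a : R) : C x -> `|a| <= 1 -> C (a *: x).
  move=> Cx a1; have Ca (b : R) y : C y -> 0 <= b <= 1 -> C (b *: y).
    by move=> Cy b01; have := cC y 0 b Cy C0' b01; rewrite scaler0 addr0.
  have [a0|a0] := leP 0 a; first by apply: Ca => //; rewrite a0/= -(ger0_norm a0).
  rewrite -[a *: x]opprK -scaleNr; apply/CN/Ca => //.
  by rewrite oppr_ge0 ltW//= -(ltr0_norm a0).
pose G x := [set t : R | 0 < t /\ C (t^-1 *: x)].
have G0 x : G x !=set0.
  have [e e0 He] := cvg_scale_inv x nC; exists (2 / e); split; first by rewrite divr_gt0.
  by rewrite invf_div; apply: He; rewrite ger0_norm ?divr_ge0 ?ltW// ltr_pdivrMr// ltr_pMr// ltr1n.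
have Glb x : has_inf (G x).
  by split; [exact: G0|exists 0 => t [/ltW]].
have Gup x t t' : G x t -> t <= t' -> G x t'.
  move=> [t0 Ct] tt'; have t'0 := lt_le_trans t0 tt'; split => //.
  have -> : t'^-1 *: x = (t / t') *: (t^-1 *: x).
    by rewrite scalerA mulrAC divff ?gt_eqF// mul1r.
  apply: CZ => //; rewrite ger0_norm; last by rewrite divr_ge0 ?ltW.
  by rewrite ler_pdivrMr// mul1r.
have ltG x t : inf (G x) < t -> G x t.
  rewrite -subr_gt0 => /(inf_adherent)/(_ (Glb x))[t' Gt']; rewrite addrC subrK => /ltW; exact: Gup.
have Gle x t : G x t -> inf (G x) <= t by move=> Gt; apply: ge_inf => //; have [] := Glb x.
exists (fun x => inf (G x)); last first.
  move=> x /ltG[_]; rewrite invr1 scale1r => -[/C0V].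
  by [].
split.
- move=> x y; apply/ler_addgt0Pr => e e0.
  have [s0 Cs] : G x (inf (G x) + e / 2) by apply: ltG; rewrite ltrDl divr_gt0.
  have [t0 Ct] : G y (inf (G y) + e / 2) by apply: ltG; rewrite ltrDl divr_gt0.
  move: s0 Cs t0 Ct; set s := _ + e / 2; set t := _ + e / 2 => s0 Cs t0 Ct.
  have -> : inf (G x) + inf (G y) + e = s + t by rewrite /s /t addrACA -splitr.
  apply: Gle; split; first exact: addr_gt0.
  have st0 : 0 < s + t by exact: addr_gt0.
  have l01 : 0 <= s / (s + t) <= 1.
    apply/andP; split; first by rewrite divr_ge0 ?ltW.
    by rewrite ler_pdivrMr// mul1r lerDl ltW.
  have -> : (s + t)^-1 *: (x + y) =
      (s / (s + t)) *: (s^-1 *: x) + (1 - s / (s + t)) *: (t^-1 *: y).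
    rewrite !scalerA scalerDr; congr (_ *: _ + _ *: _).
      by rewrite mulrAC divff ?gt_eqF// mul1r.
    by field; rewrite !gt_eqF.
  exact: cC.
- move=> a x; have [->|a0] := eqVneq a 0.
    rewrite scale0r normr0 mul0r; apply/eqP; rewrite eq_le; apply/andP; split.
      apply/ler_addgt0Pr => e e0; rewrite add0r; apply: Gle; split => //.
      by rewrite scaler0.
    by apply: lb_le_inf; [exact: G0|move=> t [/ltW]].
  have GZ b y t : b != 0 -> G y t -> G (b *: y) (`|b| * t).
    move=> b0 [t0 Ct]; split; first by rewrite mulr_gt0// normr_gt0.
    rewrite scalerA invfM mulrAC -scalerA; apply: CZ => //.
    by rewrite normrM normfV normr_id mulVf// normr_eq0.
  have Zle b y : b != 0 -> inf (G (b *: y)) <= `|b| * inf (G y).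
    move=> b0; rewrite mulrC -ler_pdivrMr ?normr_gt0//.
    apply: lb_le_inf; first exact: G0.
    by move=> t Gt; rewrite ler_pdivrMr ?normr_gt0// mulrC; apply/Gle/GZ.
  apply/eqP; rewrite eq_le Zle//=.
  (* The reverse inequality is the first one for the inverse scalar. *)
  have := Zle a^-1 (a *: x); rewrite scalerA mulVf// scale1r invr_eq0 => /(_ a0).
  by rewrite normfV mulrC ler_pdivlMr ?normr_gt0// mulrC.
- move=> e e0; have e20 : 0 < e / 2 by rewrite divr_gt0.
  have := @nbhs0Z _ E _ (e / 2) (lt0r_neq0 e20) nC; apply: filterS => _ [x Cx <-].
  apply: (@le_lt_trans _ _ (e / 2)); last by rewrite ltr_pdivrMr// ltr_pMr// ltr1n.
  by apply: Gle; split => //; rewrite scalerA mulVf ?scale1r// gt_eqF.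
Qed.

Lemma seminorm_nbhs_le (V : set E) : nbhs (0 : E) V ->
  exists2 q, seminorm q & forall x, q x <= 1 -> V x.
Proof.
move=> /seminorm_nbhs[q sq qV]; exists (fun x => 2 * q x); first exact: seminormZ_scale.
move=> x qx; apply: qV; have := seminorm_ge0 x sq; lra.
Qed.

Lemma nbhs_sub_cvg (x : E) (V : set E) : nbhs x V -> nbhs (0 : E) [set v | V (x + v)].
Proof.
move=> Vx; have H : (fun v : E => x + v) @ (0 : E) --> x.
  by rewrite -[x in _ --> x]addr0; apply: tcvgD; [exact: cvg_cst|exact: cvg_id].
exact: (H _ Vx).
Qed.

Lemma nbhs_seminorm (x : E) (V : set E) : nbhs x V ->
  exists2 q, seminorm q & forall y, q (y - x) <= 1 -> V y.
Proof.
move=> /nbhs_sub_cvg/seminorm_nbhs_le[q sq qV]; exists q => // y /qV.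
by rewrite /= addrC subrK.
Qed.

Lemma near_seminorm q (x : E) (e : R) : seminorm q -> 0 < e ->
  \forall y \near x, q (y - x) < e.
Proof.
move=> [_ _ qc] /qc q0; have H : (fun y : E => y - x) @ x --> (0 : E).
  by rewrite -(subrr x); apply: tcvgB; [exact: cvg_id|exact: cvg_cst].
exact: (H _ q0).
Qed.

(** Local convexity reduces convergence to scalar estimates; the inequality is non-strict because
    that is what mean value estimates deliver. *)
Lemma cvg_seminorm (Z : Type) (F : set_system Z) {FF : Filter F} (f : Z -> E) (l : E) :
  f @ F --> l <->
  forall q, seminorm q -> forall e, 0 < e -> \forall z \near F, q (f z - l) <= e.
Proof.
split=> [fl q sq e e0|H V /nbhs_seminorm[q sq qV]].
  by apply: (filter_imp FF (fl _ (near_seminorm l sq e0))) => z /ltW.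
by have := H _ sq _ ltr01; apply: filterS => z; exact: qV.
Qed.

Lemma seminorm_cvg (Z : Type) (F : set_system Z) {FF : Filter F} (f : Z -> E) (l : E) q (C : R) :
  seminorm q -> f @ F --> l -> q l < C -> \forall z \near F, q (f z) <= C.
Proof.
move=> sq /cvg_seminorm fl qC; have : 0 < C - q l by rewrite subr_gt0.
move=> /(fl _ sq); apply: filterS => z /= h; have [qD _ _] := sq.
by have := qD (f z - l) l; rewrite subrK; move: h; lra.
Qed.

Lemma hausdorff_seminorm (x : E) : hausdorff_space E ->
  (forall q, seminorm q -> q x <= 1) -> x = 0.
Proof.
move=> hE H; apply: hE => A B Ax B0; exists x; split; first exact: nbhs_singleton.
have [q sq qB] := nbhs_seminorm B0; apply: qB; rewrite subr0; exact: H.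
Qed.

Lemma tcvg_unique (Z : Type) (F : set_system Z) {FF : ProperFilter F} (f : Z -> E) (l l' : E) :
  hausdorff_space E -> f @ F --> l -> f @ F --> l' -> l = l'.
Proof. by move=> hE fl fl'; apply: (@cvg_unique _ hE (f @ F)). Qed.

End Seminorms.

(** * Bastiani calculus *)

Lemma cvg_congr (Z : Type) (T : nbhsType) (F : set_system Z) {FF : Filter F}
    (f g : Z -> T) (l : set_system T) :
  f @ F --> l -> F [set z | f z = g z] -> g @ F --> l.
Proof. by move=> fl fg; apply: (cvg_trans _ fl); exact: near_eq_cvg. Qed.

Lemma subr_sub_cancel (V : zmodType) (a b d e : V) : a - (b + d) - (e - b) = a - e - d.
Proof.
by rewrite opprD opprB (addrC b) addrACA; congr (_ + _); rewrite addrAC addNr add0r.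
Qed.

Section DirectionalDerivatives.
Context {R : realType}.
Implicit Types E F G : tvsType R.

Lemma dirderiv_unique E F (f : E -> F) x v l : hausdorff_space F ->
  is_dirderiv f x v l -> dirderiv f x v = l.
Proof.
move=> hF fl; apply: xget_unique => // l' fl'.
exact: tcvg_unique hF fl' fl.
Qed.

Lemma dirderivP E F (f : E -> F) x v :
  (exists l, is_dirderiv f x v l) -> is_dirderiv f x v (dirderiv f x v).
Proof. by move=> [l fl]; apply: (@xgetPex _ 0 [set l | is_dirderiv f x v l]); exists l. Qed.

Lemma cvg_dnbhs0 : (fun t : R => t) @ (0 : R)^' --> (0 : R).
Proof. exact: cvg_within. Qed.

Lemma dnbhs0_neq0 : \forall t \near (0 : R)^', t != 0.
Proof. exact: nbhs_dnbhs_neq. Qed.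

Lemma cvg_line E (x v : E) : (fun t : R => x + t *: v) @ (0 : R)^' --> x.
Proof.
have : x + 0 *: v = x by rewrite scale0r addr0.
by move=> {2}<-; apply: tcvgD; [exact: cvg_cst|apply: tcvgZ; [exact: cvg_dnbhs0|exact: cvg_cst]].
Qed.

Lemma iter_dirderiv_cons E F (f : E -> F) v vs x :
  iter_dirderiv f (v :: vs) x = dirderiv (iter_dirderiv f vs) x v.
Proof. by []. Qed.

Lemma is_dirderiv_near E F (f g : E -> F) x v l :
  is_dirderiv f x v l -> (\forall y \near x, f y = g y) -> is_dirderiv g x v l.
Proof.
move=> fl fg; have fgx := nbhs_singleton fg.
apply: (cvg_congr fl).
have H : \forall t \near (0 : R)^', f (x + t *: v) = g (x + t *: v).
  exact: (@cvg_line _ x v _ fg).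
by apply: filterS H => t /= <-; rewrite fgx.
Qed.

Lemma dirderiv_near E F (f g : E -> F) x v :
  (\forall y \near x, f y = g y) -> dirderiv f x v = dirderiv g x v.
Proof.
move=> fg; rewrite /dirderiv; congr (xget _ _); apply/seteqP; split=> l /=.
  by move=> /is_dirderiv_near; apply.
by move=> /is_dirderiv_near; apply; apply: filterS fg => y.
Qed.

Lemma iter_dirderiv_open E F (f g : E -> F) (V : set E) : open V ->
  (forall y, V y -> f y = g y) ->
  forall vs y, V y -> iter_dirderiv f vs y = iter_dirderiv g vs y.
Proof.
move=> oV fg; elim=> [|v vs IH] y Vy /=; first exact: fg.
apply: dirderiv_near; have : nbhs y V by apply: open_nbhs_nbhs.
by apply: filterS => z; exact: IH.
Qed.

Lemma is_dirderivD E F (f g : E -> F) x v l m :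
  is_dirderiv f x v l -> is_dirderiv g x v m ->
  is_dirderiv (fun y => f y + g y) x v (l + m).
Proof.
move=> fl gm; apply: (cvg_congr (tcvgD fl gm)).
by apply: filterE => t /=; rewrite -scalerDr opprD addrACA.
Qed.

Lemma is_dirderivZ E F (f : E -> F) x v l (a : R) :
  is_dirderiv f x v l -> is_dirderiv (fun y => a *: f y) x v (a *: l).
Proof.
move=> fl; have : (fun t : R => (fun=> a) t *: (t^-1 *: (f (x + t *: v) - f x))) @ (0 : R)^'
    --> a *: l by apply: tcvgZ => //; exact: cvg_cst.
apply: cvg_trans; apply: near_eq_cvg.
by apply: filterE => t /=; rewrite -scalerBr !scalerA mulrC.
Qed.

Lemma is_dirderiv_cst E F (c : F) (x v : E) : is_dirderiv (fun=> c) x v 0.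
Proof.
rewrite /is_dirderiv; under eq_fun do rewrite subrr scaler0.
exact: cvg_cst.
Qed.

Lemma is_dirderiv_sum E F (I : Type) (s : seq I) (f : I -> E -> F) x v (l : I -> F) :
  (forall i, is_dirderiv (f i) x v (l i)) ->
  is_dirderiv (fun y => \sum_(i <- s) f i y) x v (\sum_(i <- s) l i).
Proof.
move=> fl; elim: s => [|i s IH].
  rewrite big_nil (_ : (fun y => _) = fun=> 0); first exact: is_dirderiv_cst.
  by apply/funext => y; rewrite big_nil.
rewrite big_cons (_ : (fun y => _) = fun y => f i y + \sum_(i <- s) f i y).
  exact: is_dirderivD.
by apply/funext => y; rewrite big_cons.
Qed.

Lemma is_dirderiv_dir0 E F (f : E -> F) x : is_dirderiv f x 0 0.
Proof.
rewrite /is_dirderiv; under eq_fun do rewrite scaler0 addr0 subrr scaler0.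
exact: cvg_cst.
Qed.

Lemma is_dirderiv_dirZ E F (f : E -> F) x v l (a : R) :
  is_dirderiv f x v l -> is_dirderiv f x (a *: v) (a *: l).
Proof.
move=> fl; have [->|a0] := eqVneq a 0.
  by rewrite !scale0r; exact: is_dirderiv_dir0.
have ta : (fun t : R => t * a) @ (0 : R)^' --> (0 : R)^'.
  move=> A [e /= e0 He]; exists (e / `|a|); first by rewrite /= divr_gt0 ?normr_gt0.
  move=> t /=; rewrite sub0r normrN => te t0; apply: He; last by rewrite mulf_neq0.
  by rewrite /= sub0r normrN normrM -ltr_pdivlMr ?normr_gt0.
have fl' := cvg_comp _ _ ta fl.
have : (fun t : R => (fun=> a) t *: ((t * a)^-1 *: (f (x + (t * a) *: v) - f x))) @ (0 : R)^'
    --> a *: l by apply: tcvgZ => //; exact: cvg_cst.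
apply: cvg_trans; apply: near_eq_cvg; apply: filterE => t /=.
by rewrite !scalerA invfM mulrCA divff// mulr1.
Qed.

Lemma is_dirderiv_linear E F G (L : F -> G) (f : E -> F) x v l :
  linear L -> continuous L -> is_dirderiv f x v l ->
  is_dirderiv (L \o f) x v (L l).
Proof.
move=> lL cL fl; have := cvg_comp _ _ fl (cL l).
apply: cvg_trans; apply: near_eq_cvg; apply: filterE => t /=.
pose L' : {linear F -> G} := HB.pack L (GRing.isLinear.Build _ _ _ _ _ lL).
by rewrite -[L]/(L' : _ -> _) linearZ linearB.
Qed.

Lemma is_dirderiv_comp_affine E F G (L : E -> F) (c : F) (f : F -> G) x v l :
  linear L -> is_dirderiv f (c + L x) (L v) l ->
  is_dirderiv (fun y => f (c + L y)) x v l.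
Proof.
move=> lL; apply: cvg_trans; apply: near_eq_cvg; apply: filterE => t /=.
pose L' : {linear E -> F} := HB.pack L (GRing.isLinear.Build _ _ _ _ _ lL).
rewrite -addrA.
by have -> : L (x + t *: v) = L x + t *: L v by rewrite -[L]/(L' : _ -> _) linearD linearZ.
Qed.

(* A supremum argument on the set of [b] up to which the increments of [g] are
   controlled; no integral is needed, hence no completeness of [F]. *)
Lemma seminorm_mvt F (g : R -> F) (q : F -> R) (C : R) : seminorm q ->
  (forall t, 0 <= t <= 1 -> exists2 l : F,
    (fun s : R => s^-1 *: (g (t + s) - g t)) @ (0 : R)^' --> l & q l <= C) ->
  q (g 1 - g 0) <= C.
Proof.
(* The slack [e] makes the bound at the limit strict, hence valid for difference quotients with
   small steps of either sign. *)
move=> sq H; apply/ler_addgt0Pr => e e0; set D := C + e.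
have [qD qZ _] := sq.
have C0 : 0 <= C.
  have [|l _ qC] := H 0; first by rewrite lexx ler01.
  by apply: le_trans qC; exact: seminorm_ge0.
have D0 : 0 <= D by rewrite addr_ge0// ltW.
have loc t : 0 <= t <= 1 -> exists2 d, 0 < d &
    forall s, `|s| < d -> q (g (t + s) - g t) <= D * `|s|.
  move=> /H[l gl qC]; have lD : q l < D by rewrite (le_lt_trans qC)// ltrDl.
  have [d /= d0 Hd] := seminorm_cvg sq gl lD.
  exists d => // s sd; have [->|s0] := eqVneq s 0.
    by rewrite addr0 subrr seminorm0// normr0 mulr0.
  have := Hd s; rewrite /= sub0r normrN => /(_ sd s0).
  by rewrite qZ normfV mulrC ler_pdivrMr ?normr_gt0.
pose S := [set b : R | 0 <= b <= 1 /\ forall c, 0 <= c <= b -> q (g c - g 0) <= D * c].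
have S0 : S 0.
  split; first by rewrite lexx ler01.
  move=> c; rewrite -eq_le => /eqP <-.
  by rewrite subrr seminorm0// mulr0.
have supS : has_sup S by split; [exists 0|exists 1 => b [/andP[]]].
set m := sup S.
have m0 : 0 <= m by apply: ub_le_sup => //; exact: (proj2 supS).
have m1 : m <= 1 by apply: ge_sup; [exists 0|move=> b [/andP[]]].
have [|d d0 Hd] := loc m; first by rewrite m0.
have lem : q (g m - g 0) <= D * m.
  have [b [/andP[b0 b1] Sb] mb] := sup_adherent d0 supS.
  have bm : b <= m by apply: ub_le_sup; [exact: (proj2 supS)|split=> //; rewrite b0].
  have bmd : `|b - m| < d.
    by rewrite distrC ger0_norm ?subr_ge0//; move: mb; rewrite -/m; lra.
  have := Hd _ bmd; rewrite (addrC m) subrK distrC ger0_norm ?subr_ge0// => h1.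
  have h2 := Sb b; rewrite b0 lexx in h2; have {}h2 := h2 isT.
  have -> : g m - g 0 = - (g b - g m) + (g b - g 0) by rewrite opprB addrA subrK.
  apply: le_trans (qD _ _) _; rewrite seminormN//.
  have -> : D * m = D * (m - b) + D * b by ring.
  exact: lerD.
have lem2 c : m <= c -> c < m + d -> q (g c - g 0) <= D * c.
  move=> mc cd; have cmd : `|c - m| < d by rewrite ger0_norm ?subr_ge0//; lra.
  have := Hd _ cmd; rewrite (addrC m) subrK ger0_norm ?subr_ge0// => h1.
  have -> : g c - g 0 = (g c - g m) + (g m - g 0) by rewrite addrA subrK.
  apply: le_trans (qD _ _) _.
  have -> : D * c = D * (c - m) + D * m by ring.
  exact: lerD.
have lem3 c : 0 <= c -> c < m -> q (g c - g 0) <= D * c.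
  move=> c0 cm; have mc0 : 0 < m - c by rewrite subr_gt0.
  have [b [_ Sb]] := sup_adherent mc0 supS; rewrite -/m => mb.
  by apply: Sb; rewrite c0/=; lra.
have [m1'|m1'] := ltP m 1; last first.
  have -> : D = D * 1 by rewrite mulr1.
  by apply: lem2 => //; have : m = 1 by [lra]; lra.
(* If the supremum [m] were below 1, the local estimate at [m] would carry the bound beyond it. *)
pose b := Num.min 1 (m + d / 2).
have Sb : S b.
  split; first by rewrite /b ge_min lexx/= le_min ler01/= addr_ge0// divr_ge0// ltW.
  move=> c /andP[c0 cb]; have [cm|mc] := ltP c m; first exact: lem3.
  apply: lem2 => //; move: cb; rewrite le_min => /andP[_ cb]; lra.
have : b <= m by apply: ub_le_sup => //; exact: (proj2 supS).
by rewrite ge_min => /orP[|]; lra.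
Qed.

(** Subtracting the linear function with slope [c] before applying the mean value estimate compares
    the increment with a prescribed derivative, as difference quotients require. *)
Lemma segment_mvt E F (f : E -> F) (y r : E) (c : F) (q : F -> R) (C : R) : seminorm q ->
  (forall t, 0 <= t <= 1 -> exists2 l, is_dirderiv f (y + t *: r) r l & q (l - c) <= C) ->
  q (f (y + r) - f y - c) <= C.
Proof.
move=> sq H; pose g t := f (y + t *: r) - t *: c.
have -> : f (y + r) - f y - c = g 1 - g 0.
  by rewrite /g !scale1r !scale0r addr0 subr0 addrAC.
apply: seminorm_mvt => // t /H[l fl qC]; exists (l - c) => //.
have H1 : (fun s : R => s^-1 *: (f (y + t *: r + s *: r) - f (y + t *: r)) - c) @ (0 : R)^'
    --> l - c by apply: tcvgB; [exact: fl|exact: cvg_cst].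
apply: (cvg_congr H1); apply: filterS dnbhs0_neq0 => s s0 /=.
rewrite /g !scalerDl addrA subr_sub_cancel.
by rewrite [in RHS]scalerBr scalerA mulVf// scale1r.
Qed.

End DirectionalDerivatives.
Arguments cvg_line {R E} x v.
Arguments is_dirderivZ {R E F f x v l} a _.
Arguments is_dirderiv_dirZ {R E F f x v l} a _.

(** Defined by recursion rather than by membership, so that it applies to lists over types without
    decidable equality. *)
Fixpoint Fall (A : Type) (P : A -> Prop) (s : seq A) : Prop :=
  if s is x :: s' then P x /\ Fall P s' else True.

Lemma Fall_cat (A : Type) (P : A -> Prop) (s t : seq A) :
  Fall P s -> Fall P t -> Fall P (s ++ t).
Proof. by elim: s => //= x s IH [Px Ps] Pt; split=> //; exact: IH. Qed.

Lemma Fall_map (A B : Type) (P : B -> Prop) (f : A -> B) (s : seq A) :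
  Fall (P \o f) s -> Fall P [seq f x | x <- s].
Proof. by elim: s => //= x s IH [Px Ps]; split=> //; exact: IH. Qed.

Lemma Fall_imp (A : Type) (P Q : A -> Prop) (s : seq A) :
  (forall x, P x -> Q x) -> Fall P s -> Fall Q s.
Proof. by move=> PQ; elim: s => //= x s IH [Px Ps]; split; [exact: PQ|exact: IH]. Qed.

Lemma Fall_all (A : Type) (P : A -> Prop) (s : seq A) :
  (forall x, P x) -> Fall P s.
Proof. by move=> H; elim: s => //= x s IH; split. Qed.

(** * Smoothness depending on a continuous parameter *)

Section ParametrizedSmoothness.
Context {R : realType}.

Definition tcvgs (E : tvsType R) (Z : Type) (F : set_system Z) (ps : seq ((Z -> E) * E)) :=
  Fall (fun p => p.1 @ F --> p.2) ps.

Lemma tcvg_Fall (E : tvsType R) (Z : Type) (F : set_system Z) {FF : Filter F} (I : Type)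
    (s : seq I) (f : I -> Z -> E) (l : I -> E) :
  Fall (fun i => f i @ F --> l i) s ->
  (fun z => \sum_(i <- s) f i z) @ F --> \sum_(i <- s) l i.
Proof.
elim: s => [_|i s IH [fi fs]].
  rewrite big_nil; have -> : (fun z => \sum_(i <- [::]) f i z) = fun=> 0.
    by apply/funext => z; rewrite big_nil.
  exact: cvg_cst.
rewrite big_cons; have -> : (fun z => \sum_(i <- i :: s) f i z) =
    (fun z => f i z + \sum_(i <- s) f i z).
  by apply/funext => z; rewrite big_cons.
by apply: tcvgD => //; exact: IH.
Qed.

(* [smooth_on] with a parameter [x] that is only continuous, and with continuity
   tested along arbitrary filters rather than on finite powers of [E]. *)
Definition psmooth (X : topologicalType) (E F : tvsType R) (U : set (X * E))
    (phi : X -> E -> F) : Prop :=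
  (forall vs x u v, U (x, u) ->
     exists l, is_dirderiv (iter_dirderiv (phi x) vs) u v l) /\
  (forall (Z : Type) (D : set_system Z) (x : Z -> X) (u : Z -> E) x0 u0
      (ps : seq ((Z -> E) * E)),
     Filter D -> U (x0, u0) -> x @ D --> x0 -> u @ D --> u0 -> tcvgs D ps ->
     (fun z => iter_dirderiv (phi (x z)) [seq p.1 z | p <- ps] (u z)) @ D -->
       iter_dirderiv (phi x0) [seq p.2 | p <- ps] u0).

Section Theory.
Context (X : topologicalType) (E F : tvsType R) (U : set (X * E)) (phi : X -> E -> F).
Hypotheses (hF : hausdorff_space F) (oU : open U) (sphi : psmooth U phi).

Lemma psmooth_slice x u : U (x, u) -> \forall v \near u, U (x, v).
Proof.
move=> Uxu; have nU : nbhs (x, u) U by exact: open_nbhs_nbhs.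
have H : (fun v => (x, v)) @ u --> (x, u) by apply: cvg_pair; [exact: cvg_cst|exact: cvg_id].
exact: (H _ nU).
Qed.

Lemma open_slice x : open [set u | U (x, u)].
Proof. by rewrite openE => u /= /psmooth_slice. Qed.

Lemma psmooth_deriv vs x u v : U (x, u) ->
  is_dirderiv (iter_dirderiv (phi x) vs) u v (iter_dirderiv (phi x) (v :: vs) u).
Proof. by move=> Uxu; apply: dirderivP; exact: sphi.1. Qed.
Arguments psmooth_deriv vs {x u} v _.

Lemma psmooth_near (Z : Type) (D : set_system Z) (x : Z -> X) (u : Z -> E) x0 u0 :
  Filter D -> U (x0, u0) -> x @ D --> x0 -> u @ D --> u0 ->
  \forall z \near D, U (x z, u z).
Proof.
move=> FD U0 xx uu; have nU : nbhs (x0, u0) U by exact: open_nbhs_nbhs.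
have H : (fun z => (x z, u z)) @ D --> (x0, u0) by exact: cvg_pair.
exact: (H _ nU).
Qed.

(** Parameter, base point, directions and step vary together. The position on the segment from [u z]
    to [u z + t z *: r z] is adjoined as a second factor of the filter, so continuity of the
    derivative along filters is automatically uniform on the segment, and the mean value estimate
    turns this into convergence of the quotients. *)
Lemma psmooth_quot (Z : Type) (D : set_system Z) (x : Z -> X) (u r : Z -> E)
    (t : Z -> R) x0 u0 r0 (ps : seq ((Z -> E) * E)) :
  Filter D -> U (x0, u0) -> x @ D --> x0 -> u @ D --> u0 -> r @ D --> r0 ->
  t @ D --> (0 : R) -> (\forall z \near D, t z != 0) -> tcvgs D ps ->
  (fun z => (t z)^-1 *:
     (iter_dirderiv (phi (x z)) [seq p.1 z | p <- ps] (u z + t z *: r z) -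
      iter_dirderiv (phi (x z)) [seq p.1 z | p <- ps] (u z))) @ D -->
    iter_dirderiv (phi x0) (r0 :: [seq p.2 | p <- ps]) u0.
Proof.
move=> FD U0 xx uu rr tt t0 pp; apply/cvg_seminorm => q sq e e0.
set L0 := iter_dirderiv _ _ u0.
pose I01 := [set a : R | 0 <= a <= 1].
pose G := filter_prod D (globally I01).
have g1 : (fun w : Z * R => w.1) @ G --> D.
  by move=> A DA; exists (A, I01) => //= -[z a] [].
have FG : Filter G by exact: filter_prod_filter.
have gc (T : nbhsType) (f : Z -> T) (l : set_system T) : f @ D --> l -> (fun w : Z * R => f w.1) @ G --> l.
  by move=> fl A lA; exact: (g1 _ (fl A lA)).
have at0 : (fun w : Z * R => w.2 * t w.1) @ G --> (0 : R).
  move=> A /nbhs_ballP[d /= d0 Hd].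
  have := tt _ (nbhsx_ballx (0 : R) _ d0); rewrite /= => Dd.
  exists ([set z | ball 0 d (t z)], I01) => //= -[z a] /= [tz /andP[a0 a1]].
  apply: Hd; move: tz; rewrite /ball/= !sub0r !normrN normrM => td.
  by apply: le_lt_trans td; rewrite ger0_norm// ler_piMl.
have uG : (fun w : Z * R => u w.1 + (w.2 * t w.1) *: r w.1) @ G --> u0.
  rewrite -[u0]addr0 -(scale0r r0); apply: tcvgD; first exact: gc.
  by apply: tcvgZ => //; exact: gc.
pose ps' := (fun w : Z * R => r w.1, r0) ::
  [seq (fun w : Z * R => p.1 w.1, p.2) | p <- ps].
have pG : tcvgs G ps'.
  split; first exact: gc.
  by apply: Fall_map; apply: Fall_imp pp => p; exact: gc.
have cG : (fun w : Z * R => iter_dirderiv (phi (x w.1)) (r w.1 :: [seq p.1 w.1 | p <- ps])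
    (u w.1 + (w.2 * t w.1) *: r w.1)) @ G --> L0.
  have -> : L0 = iter_dirderiv (phi x0) [seq p.2 | p <- ps'] u0.
    by rewrite /ps' [map _ _]/= -map_comp.
  apply: (cvg_congr (sphi.2 _ G _ _ x0 u0 ps' FG U0 (gc _ _ _ xx) uG pG)).
  by apply: filterE => w /=; rewrite -map_comp.
move/cvg_seminorm : cG => cG.
have UG := psmooth_near FG U0 (gc _ _ _ xx) uG.
have {cG UG} [[A B] [/= DA GB] AB] := filterI UG (cG _ sq _ e0).
have {}AB z a : A z -> 0 <= a <= 1 -> U (x z, u z + (a * t z) *: r z) /\
    q (iter_dirderiv (phi (x z)) (r z :: [seq p.1 z | p <- ps])
       (u z + (a * t z) *: r z) - L0) <= e.
  move=> Az a01; exact: (AB (z, a) (conj Az (GB a a01))).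
apply: (filter_imp2 _ DA t0) => z Az tz0.
have [qD qZ _] := sq; set f := iter_dirderiv (phi (x z)) _.
have H : q (f (u z + t z *: r z) - f (u z) - t z *: L0) <= `|t z| * e.
  apply: segment_mvt => // a a01; have [Uz qz] := AB z a Az a01.
  exists (t z *: iter_dirderiv (phi (x z)) (r z :: [seq p.1 z | p <- ps])
       (u z + (a * t z) *: r z)).
    by rewrite scalerA; apply: is_dirderiv_dirZ; exact: psmooth_deriv.
  by rewrite -scalerBr qZ ler_wpM2l.
have -> : (t z)^-1 *: (f (u z + t z *: r z) - f (u z)) - L0 =
    (t z)^-1 *: (f (u z + t z *: r z) - f (u z) - t z *: L0).
  by rewrite [RHS]scalerBr scalerA mulVf// scale1r.
by rewrite qZ normfV mulrC ler_pdivrMr ?normr_gt0// mulrC.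
Qed.

Lemma dnbhs0_proper : ProperFilter ((0 : R)^').
Proof. exact: Proper_dnbhs_numFieldType. Qed.

Lemma tcvgs_cst (Z : Type) (D : set_system Z) (FD : Filter D) (vs : seq E) :
  tcvgs D [seq (fun=> v, v) | v <- vs].
Proof. by elim: vs => //= v vs IH; split=> //=; exact: cvg_cst. Qed.

Lemma map_cst_fst (Z : Type) (z : Z) (vs : seq E) :
  [seq p.1 z | p <- [seq ((fun=> v) : Z -> E, v) | v <- vs]] = vs.
Proof. by elim: vs => //= v vs ->. Qed.

Lemma map_cst_snd (Z : Type) (vs : seq E) :
  [seq p.2 | p <- [seq ((fun=> v) : Z -> E, v) | v <- vs]] = vs.
Proof. by elim: vs => //= v vs ->. Qed.

(** The increment along [v + w] is split at [u + t *: w]; the piece along [v] then has a moving base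
    point, which [psmooth_quot] allows. *)
Lemma psmooth_dir_add vs x u v w : U (x, u) ->
  iter_dirderiv (phi x) ((v + w) :: vs) u =
  iter_dirderiv (phi x) (v :: vs) u + iter_dirderiv (phi x) (w :: vs) u.
Proof.
move=> Uxu; set f := iter_dirderiv (phi x) vs.
have H1 := psmooth_deriv vs (v + w) Uxu.
have H2 := psmooth_deriv vs w Uxu.
have H3 : (fun t : R => t^-1 *: (f (u + t *: w + t *: v) - f (u + t *: w))) @ (0 : R)^'
    --> iter_dirderiv (phi x) (v :: vs) u.
  have FD : Filter ((0 : R)^') by exact: within_filter.
  have c1 : (fun=> x) @ (0 : R)^' --> x by exact: cvg_cst.
  have c2 : (fun=> v) @ (0 : R)^' --> v by exact: cvg_cst.
  have := psmooth_quot FD Uxu c1 (cvg_line u w) c2 cvg_dnbhs0 dnbhs0_neq0 (tcvgs_cst FD vs).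
  rewrite map_cst_snd => H; apply: (cvg_congr H); apply: filterE => t /=.
  by rewrite map_cst_fst.
have H4 : (fun t : R => t^-1 *: (f (u + t *: w + t *: v) - f (u + t *: w)) +
    t^-1 *: (f (u + t *: w) - f u)) @ (0 : R)^' -->
    iter_dirderiv (phi x) (v :: vs) u + iter_dirderiv (phi x) (w :: vs) u.
  by apply: tcvgD; [exact: H3|exact: H2].
apply: (@tcvg_unique _ _ _ _ dnbhs0_proper _ _ _ hF H1).
apply: (cvg_congr H4); apply: filterE => t /=.
by rewrite -scalerDr addrA subrK -addrA -scalerDr (addrC w).
Qed.

Lemma psmooth_dir_scale vs x u v (a : R) : U (x, u) ->
  iter_dirderiv (phi x) ((a *: v) :: vs) u = a *: iter_dirderiv (phi x) (v :: vs) u.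
Proof.
move=> Uxu; apply: (dirderiv_unique hF).
by apply: is_dirderiv_dirZ; exact: psmooth_deriv.
Qed.

(** Additivity in the slot before [vs] holds on a whole neighbourhood, hence survives the further
    derivatives along [c]. *)
Lemma psmooth_slot_add c vs x u v w : U (x, u) ->
  iter_dirderiv (phi x) (c ++ (v + w) :: vs) u =
  iter_dirderiv (phi x) (c ++ v :: vs) u + iter_dirderiv (phi x) (c ++ w :: vs) u.
Proof.
elim: c u => [|a c IH] u Uxu; first exact: psmooth_dir_add.
rewrite cat_cons iter_dirderiv_cons; apply: (dirderiv_unique hF).
apply: (is_dirderiv_near (is_dirderivD (psmooth_deriv (c ++ v :: vs) a Uxu)
  (psmooth_deriv (c ++ w :: vs) a Uxu))).
by apply: filterS (psmooth_slice Uxu) => y Uy; rewrite -IH.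
Qed.

Lemma psmooth_slot_scale c vs x u v (a : R) : U (x, u) ->
  iter_dirderiv (phi x) (c ++ (a *: v) :: vs) u =
  a *: iter_dirderiv (phi x) (c ++ v :: vs) u.
Proof.
elim: c u => [|b c IH] u Uxu; first exact: psmooth_dir_scale.
rewrite cat_cons iter_dirderiv_cons; apply: (dirderiv_unique hF).
apply: (is_dirderiv_near (is_dirderivZ a (psmooth_deriv (c ++ v :: vs) b Uxu))).
by apply: filterS (psmooth_slice Uxu) => y Uy; rewrite -IH.
Qed.

Lemma psmooth_slot0 c vs x u : U (x, u) ->
  iter_dirderiv (phi x) (c ++ 0 :: vs) u = 0.
Proof. by move=> Uxu; rewrite -(scale0r (0 : E)) psmooth_slot_scale// scale0r. Qed.

End Theory.
Arguments psmooth_deriv {X E F U phi} sphi vs {x u} v _.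

Lemma psmooth_local (X : topologicalType) (E F : tvsType R) (U : set (X * E))
    (phi : X -> E -> F) : 
  (forall x u, U (x, u) -> exists V (psi : X -> E -> F),
    [/\ open V, V (x, u), psmooth V psi & forall y w, V (y, w) -> phi y w = psi y w]) ->
  psmooth U phi.
Proof.
move=> H; split.
  move=> vs x u v /H[V [psi [oV Vxu spsi E1]]].
  have [l Hl] := spsi.1 vs x u v Vxu; exists l; apply: (is_dirderiv_near Hl).
  apply: filterS (psmooth_slice oV Vxu) => y Vy.
  by apply: (iter_dirderiv_open (open_slice oV x)) => // w Vw; rewrite E1.
move=> Z D x u x0 u0 ps FD Uxu xx uu pp.
have [V [psi [oV Vxu spsi E1]]] := H _ _ Uxu.
have eqi y w vs : V (y, w) -> iter_dirderiv (phi y) vs w = iter_dirderiv (psi y) vs w.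
  move=> Vyw; by apply: (iter_dirderiv_open (open_slice oV y)) => // ? ?; exact: E1.
rewrite eqi//; apply: (cvg_congr (spsi.2 _ _ _ _ _ _ _ FD Vxu xx uu pp)).
by apply: (filter_imp _ (psmooth_near oV FD Vxu xx uu)) => z Vz /=; rewrite eqi.
Qed.

Lemma iter_dirderiv_linear (X : topologicalType) (E F G : tvsType R) (U : set (X * E))
    (phi : X -> E -> F) (L : F -> G) : hausdorff_space G -> open U -> psmooth U phi ->
  linear L -> continuous L -> forall x vs u, U (x, u) ->
  iter_dirderiv (L \o phi x) vs u = L (iter_dirderiv (phi x) vs u).
Proof.
move=> hG oU sphi lL cL x; elim=> [|v vs IH] u Uxu //.
rewrite iter_dirderiv_cons; apply: (dirderiv_unique hG).
apply: (is_dirderiv_near (is_dirderiv_linear lL cL (psmooth_deriv sphi vs v Uxu))).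
by apply: filterS (psmooth_slice oU Uxu) => y Uy; rewrite IH.
Qed.

Lemma psmooth_linear (X : topologicalType) (E F G : tvsType R) (U : set (X * E))
    (phi : X -> E -> F) (L : F -> G) : hausdorff_space G -> open U -> psmooth U phi ->
  linear L -> continuous L -> psmooth U (fun x => L \o phi x).
Proof.
move=> hG oU sphi lL cL; have iL := iter_dirderiv_linear hG oU sphi lL cL.
split.
  move=> vs x u v Uxu; exists (L (iter_dirderiv (phi x) (v :: vs) u)).
  apply: (is_dirderiv_near (is_dirderiv_linear lL cL (psmooth_deriv sphi vs v Uxu))).
  by apply: filterS (psmooth_slice oU Uxu) => y Uy; rewrite iL.
move=> Z D x u x0 u0 ps FD Uxu xx uu pp; rewrite iL//.
apply: (cvg_congr (cvg_comp _ _ (sphi.2 _ _ _ _ _ _ _ FD Uxu xx uu pp) (cL _))).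
by apply: (filter_imp _ (psmooth_near oU FD Uxu xx uu)) => z Uz /=; rewrite iL.
Qed.

End ParametrizedSmoothness.
Arguments psmooth_deriv {R X E F U phi} sphi vs {x u} v _.

(** * Composition of parametrized smooth maps *)

Section SmoothComposition.
Context {R : realType}.

Lemma tcvgs_ptws (E : tvsType R) (Z : Type) (D : set_system Z) (FD : Filter D)
    (ps : seq ((Z -> E) * E)) : tcvgs D ps ->
  (fun z => (fun i : 'I_(size ps) => nth 0 [seq p.1 z | p <- ps] i)
     : {ptws 'I_(size ps) -> E}) @ D -->
  ((fun i : 'I_(size ps) => nth 0 [seq p.2 | p <- ps] i)
     : {ptws 'I_(size ps) -> E}).
Proof.
move=> pp; apply/cvg_sup => i A [_ [] [P oP <-] /= Pi] /filterS; apply.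
have H : (fun z => nth 0 [seq p.1 z | p <- ps] i) @ D --> nth 0 [seq p.2 | p <- ps] i.
  elim: ps i pp {A Pi} => [|p ps IH] [i /= ilt] //= [p1 p2].
  by case: i ilt => [|i] ilt //=; exact: (IH (Ordinal (ilt : (i < size ps)%N))).
exact: (H _ (open_nbhs_nbhs (conj oP Pi))).
Qed.

Lemma map_nth_enum (T : Type) (x0 : T) (s : seq T) (n : nat) : n = size s ->
  [seq nth x0 s (nat_of_ord i) | i <- enum 'I_n] = s.
Proof.
move=> ->; rewrite -[RHS](mkseq_nth x0) /mkseq -val_enum_ord -map_comp.
by apply: eq_map.
Qed.

(** [smooth_on] tests continuity on finite powers indexed by ['I_k]; the directions of a list are
    fed in through [nth]. *)
Lemma smooth_on_cvg (M F : tvsType R) (W : set M) (f : M -> F) (Z : Type)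
    (D : set_system Z) (u : Z -> M) u0 (ps : seq ((Z -> M) * M)) :
  open W -> smooth_on W f -> Filter D -> W u0 -> u @ D --> u0 -> tcvgs D ps ->
  (fun z => iter_dirderiv f [seq p.1 z | p <- ps] (u z)) @ D -->
    iter_dirderiv f [seq p.2 | p <- ps] u0.
Proof.
move=> oW [_ s2] FD Wu0 uu pp.
set k := size ps.
pose w z : M * {ptws 'I_k -> M} := (u z, fun i : 'I_k => nth 0 [seq p.1 z | p <- ps] i).
pose w0 : M * {ptws 'I_k -> M} := (u0, fun i : 'I_k => nth 0 [seq p.2 | p <- ps] i).
have ww : w @ D --> w0 by exact: (cvg_pair uu (tcvgs_ptws FD pp)).
have Ww0 : (W `*` [set: {ptws 'I_k -> M}]) w0 by split.
have near0 : D [set z | (W `*` [set: {ptws 'I_k -> M}]) (w z)].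
  have : D [set z | W (u z)] by exact: (uu _ (open_nbhs_nbhs (conj oW Wu0))).
  by apply: filterS.
have /subspace_continuousP/(_ _ Ww0) H := s2 k.
have {}ww : w @ D --> within (W `*` [set: {ptws 'I_k -> M}]) (nbhs w0).
  move=> A /= wA; apply: (filter_imp2 _ near0 (ww _ wA)) => z Wz; exact.
have e0 : [seq w0.2 i | i <- enum 'I_k] = [seq p.2 | p <- ps].
  by apply: map_nth_enum; rewrite size_map.
have e1 z : [seq (w z).2 i | i <- enum 'I_k] = [seq p.1 z | p <- ps].
  by apply: map_nth_enum; rewrite size_map.
have := cvg_comp _ _ ww H; rewrite /= -[in X in _ -> X]e0.
move=> {}H; apply: (cvg_congr H); apply: filterE => z /=.
by rewrite -e1.
Qed.

(** The bridge from manifolds to bundles: with [c x] the coordinates of a base point and [L] the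
    inclusion of the fibre coordinates, a map that is smooth on the total space becomes smooth in
    the fibre and continuous in the base point. *)
Lemma psmooth_of_smooth (M F : tvsType R) (W : set M) (f : M -> F)
    (X : topologicalType) (E : tvsType R) (U : set (X * E)) (c : X -> M) (L : E -> M) :
  hausdorff_space F -> open W -> smooth_on W f ->
  linear L -> continuous L -> open U ->
  (forall x u, U (x, u) -> W (c x + L u)) ->
  (forall x u, U (x, u) -> {for x, continuous c}) ->
  psmooth U (fun x u => f (c x + L u)).
Proof.
move=> hF oW sW lL cL oU UW cc; have [s1 _] := sW.
have H vs x u v : U (x, u) -> 
    is_dirderiv (fun u => iter_dirderiv f (map L vs) (c x + L u)) u v
      (iter_dirderiv f (map L (v :: vs)) (c x + L u)).
  by move=> Uxu; apply: is_dirderiv_comp_affine => //; apply: dirderivP; apply: s1; exact: UW.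
have iE x vs u : U (x, u) ->
    iter_dirderiv (fun u => f (c x + L u)) vs u = iter_dirderiv f (map L vs) (c x + L u).
  elim: vs u => [//|v vs IH] u Uxu; rewrite iter_dirderiv_cons; apply: (dirderiv_unique hF).
  apply: (is_dirderiv_near (H _ _ _ _ Uxu)); apply: filterS (psmooth_slice oU Uxu) => y Uy.
  by rewrite IH.
split.
  move=> vs x u v Uxu; exists (iter_dirderiv f (map L (v :: vs)) (c x + L u)).
  by apply: (is_dirderiv_near (H _ _ _ _ Uxu)); apply: filterS (psmooth_slice oU Uxu) => y Uy; rewrite iE.
move=> Z D x u x0 u0 ps FD Uxu xx uu pp; rewrite iE//.
pose ps' := [seq (L \o p.1, L p.2) | p <- ps].
have pp' : tcvgs D ps'.
  apply: Fall_map; apply: Fall_imp pp => p /= pl; exact: (cvg_comp _ _ pl (cL _)).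
have c1 : (fun z => c (x z) + L (u z)) @ D --> c x0 + L u0.
  apply: tcvgD; first exact: (cvg_comp _ _ xx (cc _ _ Uxu)).
  exact: (cvg_comp _ _ uu (cL _)).
have := smooth_on_cvg oW sW FD (UW _ _ Uxu) c1 pp'.
have -> : [seq p.2 | p <- ps'] = [seq L i | i <- [seq p.2 | p <- ps]] by rewrite -!map_comp.
move=> {}H; apply: (cvg_congr H).
apply: (filter_imp _ (psmooth_near oU FD Uxu xx uu)) => z Uz /=.
by rewrite iE// /ps' -!map_comp.
Qed.

Lemma smooth_on_psmooth (M F : tvsType R) (W : set M) (f : M -> F) (X : topologicalType) :
  hausdorff_space F -> open W -> smooth_on W f ->
  psmooth [set p : X * M | W p.2] (fun=> f).
Proof.
move=> hF oW sW.
have oU : open [set p : X * M | W p.2] by apply: open_comp => // p _; exact: cvg_snd.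
have E1 : (fun=> f) = (fun (x : X) (u : M) => f ((fun=> 0) x + idfun u)).
  by apply/funext => x; apply/funext => u; rewrite add0r.
rewrite E1; apply: (psmooth_of_smooth hF oW sW) => //.
- by move=> x.
- by move=> x u /=; rewrite add0r.
- by move=> x u _; exact: cvg_cst.
Qed.

(* [faa vs] indexes the terms of the Faa di Bruno formula: each term is a
   partition of [vs] into lists of directions for the inner function. *)
Section Partitions.
Variables (A : Type).

Fixpoint insertions (v : A) (T : seq (seq A)) : seq (seq (seq A)) :=
  if T is t :: T' then ((v :: t) :: T') :: [seq t :: T'' | T'' <- insertions v T']
  else [::].

Fixpoint faa (vs : seq A) : seq (seq (seq A)) :=
  if vs is v :: vs' then
    flatten [seq ([:: v] :: T) :: insertions v T | T <- faa vs']
  else [:: [::]].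

Lemma Fall_insertions (P : A -> Prop) v T : P v -> Fall (Fall P) T ->
  Fall (Fall (Fall P)) (insertions v T).
Proof.
move=> Pv; elim: T => //= t T IH [Pt PT]; split; first by split.
apply: Fall_map; apply: Fall_imp (IH PT) => T' PT'; by split.
Qed.

Lemma Fall_faa (P : A -> Prop) vs : Fall P vs -> Fall (Fall (Fall P)) (faa vs).
Proof.
elim: vs => [|v vs IH] //= [Pv /IH]; elim: (faa vs) => //= T s IH' [PT Ps].
split; first by split.
by apply: Fall_cat; [exact: Fall_insertions|exact: IH'].
Qed.

End Partitions.

Lemma insertions_map (A B : Type) (f : A -> B) v T :
  insertions (f v) [seq [seq f x | x <- t] | t <- T] =
  [seq [seq [seq f x | x <- t] | t <- T'] | T' <- insertions v T].
Proof. by elim: T => //= t T ->; rewrite -!map_comp. Qed.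

Lemma faa_map (A B : Type) (f : A -> B) vs :
  faa [seq f x | x <- vs] = [seq [seq [seq f x | x <- t] | t <- T] | T <- faa vs].
Proof.
elim: vs => //= v vs ->; rewrite map_flatten -!map_comp; congr flatten.
by apply: eq_map => T /=; rewrite insertions_map.
Qed.

Section Composition.
Context (X : topologicalType) (E F G : tvsType R) (U : set (X * E)) (V : set (X * F)).
Context (phi : X -> E -> F) (psi : X -> F -> G).
Hypotheses (hF : hausdorff_space F) (hG : hausdorff_space G) (oU : open U) (oV : open V).
Hypotheses (sphi : psmooth U phi) (spsi : psmooth V psi).
Hypothesis UV : forall x u, U (x, u) -> V (x, phi x u).

Let term x u (T : seq (seq E)) :=
  iter_dirderiv (psi x) [seq iter_dirderiv (phi x) t u | t <- T] (phi x u).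

Let FD : Filter ((0 : R)^').
Proof. exact: within_filter. Qed.

Let iter_cvg x u v t : U (x, u) ->
  (fun s : R => iter_dirderiv (phi x) t (u + s *: v)) @ (0 : R)^' --> iter_dirderiv (phi x) t u.
Proof.
move=> Uxu; have c1 : (fun=> x) @ (0 : R)^' --> x by exact: cvg_cst.
have := sphi.2 _ _ _ _ _ _ _ FD Uxu c1 (cvg_line u v) (tcvgs_cst FD t).
rewrite map_cst_snd => H; apply: (cvg_congr H); apply: filterE => s /=.
by rewrite map_cst_fst.
Qed.

(* Slotwise difference quotient, by telescoping over the slots. *)
Let term_slots x u v c T : U (x, u) ->
  (fun s : R => s^-1 *:
    (iter_dirderiv (psi x) (c ++ [seq iter_dirderiv (phi x) t (u + s *: v) | t <- T]) (phi x u)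
     - iter_dirderiv (psi x) (c ++ [seq iter_dirderiv (phi x) t u | t <- T]) (phi x u)))
    @ (0 : R)^' -->
  \sum_(T' <- insertions v T)
    iter_dirderiv (psi x) (c ++ [seq iter_dirderiv (phi x) t u | t <- T']) (phi x u).
Proof.
move=> Uxu; have Vxu := UV Uxu; elim: T c => [|t T IH] c /=.
  rewrite big_nil; under eq_fun do rewrite subrr scaler0; exact: cvg_cst.
rewrite big_cons big_map.
have c1 : (fun=> x) @ (0 : R)^' --> x by exact: cvg_cst.
have c2 : (fun=> phi x u) @ (0 : R)^' --> phi x u by exact: cvg_cst.
have H1 : (fun s : R => iter_dirderiv (psi x)
    (c ++ (s^-1 *: (iter_dirderiv (phi x) t (u + s *: v) - iter_dirderiv (phi x) t u)) ::
     [seq iter_dirderiv (phi x) t (u + s *: v) | t <- T]) (phi x u)) @ (0 : R)^' -->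
    iter_dirderiv (psi x) (c ++ iter_dirderiv (phi x) (v :: t) u ::
      [seq iter_dirderiv (phi x) t u | t <- T]) (phi x u).
  pose ps : seq ((R -> F) * F) := [seq (fun=> a, a) | a <- c] ++
    (fun s : R => s^-1 *: (iter_dirderiv (phi x) t (u + s *: v) - iter_dirderiv (phi x) t u),
     iter_dirderiv (phi x) (v :: t) u) ::
    [seq (fun s => iter_dirderiv (phi x) t (u + s *: v), iter_dirderiv (phi x) t u) | t <- T].
  have pp : tcvgs ((0 : R)^') ps.
    apply: Fall_cat; first exact: tcvgs_cst.
    split; first exact: (psmooth_deriv sphi t v Uxu).
    by apply: Fall_map; apply: Fall_all => t' /=; exact: iter_cvg.
  have := spsi.2 _ _ _ _ _ _ _ FD Vxu c1 c2 pp.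
  rewrite /ps map_cat map_cst_snd /= -map_comp => H.
  apply: (cvg_congr H); apply: filterE => s /=.
  by rewrite map_cat map_cst_fst /= -map_comp.
have H2 := IH (rcons c (iter_dirderiv (phi x) t u)).
under [X in _ --> _ + X]eq_bigr do rewrite -cat_rcons.
apply: (cvg_congr (tcvgD H1 H2)); apply: filterE => s /=.
rewrite (psmooth_slot_scale hG oV spsi)// -scalerDr; congr (_ *: _).
rewrite !cat_rcons.
rewrite -[X in _ = iter_dirderiv _ (c ++ X :: _) _ - _](subrK (iter_dirderiv (phi x) t u)).
by rewrite [in RHS](psmooth_slot_add hG oV spsi)// addrA.
Qed.

(** Moving the base point of [psi] opens a new block [[:: v]]; moving its directions puts [v] into
    an existing block. *)
Let term_deriv x u v T : U (x, u) ->
  is_dirderiv (fun u => term x u T) u v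
    (\sum_(T' <- ([:: v] :: T) :: insertions v T) term x u T').
Proof.
move=> Uxu; have Vxu := UV Uxu; rewrite big_cons.
have c1 : (fun=> x) @ (0 : R)^' --> x by exact: cvg_cst.
have c2 : (fun=> phi x u) @ (0 : R)^' --> phi x u by exact: cvg_cst.
have H1 : (fun s : R => s^-1 *:
    (iter_dirderiv (psi x) [seq iter_dirderiv (phi x) t (u + s *: v) | t <- T] (phi x (u + s *: v))
   - iter_dirderiv (psi x) [seq iter_dirderiv (phi x) t (u + s *: v) | t <- T] (phi x u)))
   @ (0 : R)^' --> term x u ([:: v] :: T).
  pose ps : seq ((R -> F) * F) :=
    [seq (fun s => iter_dirderiv (phi x) t (u + s *: v), iter_dirderiv (phi x) t u) | t <- T].
  have pp : tcvgs ((0 : R)^') ps.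
    by apply: Fall_map; apply: Fall_all => t' /=; exact: iter_cvg.
  have c3 := psmooth_deriv sphi [::] v Uxu.
  have := psmooth_quot oV spsi FD Vxu c1 c2 c3 cvg_dnbhs0 dnbhs0_neq0 pp.
  rewrite /ps -map_comp => H; apply: (cvg_congr H).
  apply: filterS dnbhs0_neq0 => s s0 /=.
  rewrite -map_comp; congr (_ *: (iter_dirderiv _ _ _ - _)).
  by rewrite scalerA divff// scale1r addrC subrK.
have H2 := @term_slots x u v [::] T Uxu.
apply: (cvg_congr (tcvgD H1 H2)); apply: filterE => s /=.
by rewrite -scalerDr addrA subrK.
Qed.

Lemma iter_dirderiv_comp x vs u : U (x, u) ->
  iter_dirderiv (psi x \o phi x) vs u = \sum_(T <- faa vs) term x u T.
Proof.
elim: vs u => [|v vs IH] u Uxu; first by rewrite big_seq1.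
rewrite iter_dirderiv_cons; apply: (dirderiv_unique hG).
have H : is_dirderiv (fun u => \sum_(T <- faa vs) term x u T) u v
    (\sum_(T <- faa vs) \sum_(T' <- ([:: v] :: T) :: insertions v T) term x u T').
  by apply: is_dirderiv_sum => T; exact: term_deriv.
rewrite /= big_flatten big_map.
apply: (is_dirderiv_near H); apply: filterS (psmooth_slice oU Uxu) => y Uy.
by rewrite IH.
Qed.

Lemma psmooth_comp : psmooth U (fun x => psi x \o phi x).
Proof.
split.
  move=> vs x u v Uxu.
  exists (\sum_(T <- faa vs) \sum_(T' <- ([:: v] :: T) :: insertions v T) term x u T').
  have H : is_dirderiv (fun u => \sum_(T <- faa vs) term x u T) u v
    (\sum_(T <- faa vs) \sum_(T' <- ([:: v] :: T) :: insertions v T) term x u T').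
    by apply: is_dirderiv_sum => T; exact: term_deriv.
  apply: (is_dirderiv_near H); apply: filterS (psmooth_slice oU Uxu) => y Uy.
  by rewrite iter_dirderiv_comp.
move=> Z D x u x0 u0 ps FZ Uxu xx uu pp; rewrite iter_dirderiv_comp//.
(* Partitions are formed on the list of pairs, so that [Fall_faa] hands each block its convergent
   directions; [faa_map] recovers the two projections. *)
have H : (fun z => \sum_(T <- faa ps) term (x z) (u z) [seq [seq p.1 z | p <- t] | t <- T]) @ D -->
    \sum_(T <- faa ps) term x0 u0 [seq [seq p.2 | p <- t] | t <- T].
  apply: tcvg_Fall; apply: Fall_imp (Fall_faa pp) => T TT.
  pose qs : seq ((Z -> F) * F) := [seq (fun z => iter_dirderiv (phi (x z)) [seq p.1 z | p <- t] (u z),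
     iter_dirderiv (phi x0) [seq p.2 | p <- t] u0) | t <- T].
  have qq : tcvgs D qs.
    by apply: Fall_map; apply: Fall_imp TT => t tt; exact: (sphi.2 _ _ _ _ _ _ _ FZ Uxu xx uu tt).
  have pz : (fun z => phi (x z) (u z)) @ D --> phi x0 u0.
    exact: (sphi.2 _ _ _ _ _ _ [::] FZ Uxu xx uu I).
  have := spsi.2 _ _ _ _ _ _ _ FZ (UV Uxu) xx pz qq.
  rewrite /term -map_comp /qs -map_comp => {}H.
  by apply: (cvg_congr H); apply: filterE => z /=; rewrite -!map_comp.
rewrite faa_map big_map; apply: (cvg_congr H).
apply: (filter_imp _ (psmooth_near oU FZ Uxu xx uu)) => z Uz /=.
by rewrite -/((psi (x z) \o phi (x z))) iter_dirderiv_comp// faa_map big_map.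
Qed.

End Composition.

End SmoothComposition.

(** * Paracompactness and extension of metrics *)

Section Stone.
Context {R : realType}.

Definition pseudometric (T : Type) (d : T -> T -> R) : Prop :=
  [/\ forall x, d x x = 0, forall x y, d x y = d y x &
      forall x y z, d x z <= d x y + d y z].

Lemma pseudometric_ge0 (T : Type) (d : T -> T -> R) x y : pseudometric d -> 0 <= d x y.
Proof.
move=> [d0 dC dT]; have := dT x y x; rewrite d0 (dC y) => H; lra.
Qed.

(* M. E. Rudin's proof: [stage n] is the union of the sets built before step [n]. *)
Lemma stone (T : Type) (d : T -> T -> R) (I : choiceType) (U : I -> set T) :
  pseudometric d ->
  (forall i x, U i x -> exists2 e, 0 < e & forall y, d x y < e -> U i y) ->
  exists V : I * nat -> set T,
    [/\ forall k x, V k x -> exists2 e, 0 < e & forall y, d x y < e -> V k y,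
        forall k, V k `<=` U k.1,
        forall i x, U i x -> exists k, V k x &
        forall i x, U i x -> exists2 e, 0 < e &
          finite_set [set k | exists2 y, V k y & d x y < e]].
Proof.
move=> dd oU; have [d0 dC dT] := dd.
have [wo woP] := well_ordering_principle I.
have {}woP (P : I -> Prop) i : P i -> exists j,
    [/\ P j, forall k, P k -> wo j k & forall l, P l -> (forall k, P k -> wo l k) -> j = l].
  move=> Pi; have mem k : (k \in [pred j | `[<P j>]]) = `[<P k>] by [].
  have [|j [[jP Hj] uj]] := woP [pred j | `[<P j>]].
    by exists i; rewrite mem; apply/asboolP.
  exists j; split; first by move: jP; rewrite mem => /asboolP.
    by move=> k Pk; apply: Hj; rewrite mem; apply/asboolP.
  move=> l Pl Hl; apply: uj; split; first by rewrite mem; apply/asboolP.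
  by move=> k; rewrite mem => /asboolP; exact: Hl.
pose least i x := U i x /\ forall j, U j x -> wo i j.
have leastP i x : U i x -> exists j, least j x.
  by move=> /(woP (fun j => U j x))[j [jx Hj _]]; exists j.
have refl k : wo k k by have [m [-> + _]] := woP (fun j => j = k) k erefl; exact.
have wo_total i j : wo i j \/ wo j i.
  have [l [+ Hl _]] := woP (fun k => k = i \/ k = j) i (or_introl erefl).
  by move=> [|] E; [left|right]; rewrite -E; apply: Hl; [right|left].
have wo_anti i j : wo i j -> wo j i -> i = j.
  move=> ij ji; have [l [_ _ uniq]] := woP (fun k => k = i \/ k = j) i (or_introl erefl).
  transitivity l; [symmetry|]; apply: uniq; [by left|by move=> k [->|->]|by right|by move=> k [->|->]].
pose e n : R := (2^-1) ^+ n.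
have e0 n : 0 < e n by rewrite exprn_gt0.
have eS n : e n = 2 * e n.+1 by rewrite /e exprS mulrA divff ?mul1r.
have ele m n : (m <= n)%N -> e n <= e m.
  by move=> mn; rewrite /e ler_wiXn2l// invf_le1// ler1n.
have esmall a : 0 < a -> exists n, e n < a.
  move=> a0; have := @cvg_geometric R 1 (2^-1).
  rewrite ger0_norm// invf_lt1// ltr1n => /(_ isT)/cvgrPdist_lt/(_ _ a0)[n _ /(_ n)].
  rewrite /= leqnn sub0r normrN => /(_ isT); rewrite /geometric/= mul1r ger0_norm; first by exists n.
  exact/ltW/e0.
(* The index is the first one at the centre, the centre escapes the earlier stages, and the ball of
   three times the radius fits into [U i]. The factor 3 is what separates distinct indices within
   one stage. *)
pose D n (P : set T) i := [set y | exists x,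
  [/\ least i x, ~ P x, (forall z, d x z < 3 * e n -> U i z) & d x y < e n]].
pose stage := fix stage n : set T :=
  if n is m.+1 then stage m `|` [set y | exists i, D m (stage m) i y] else set0.
pose V (k : I * nat) := D k.2 (stage k.2) k.1.
have stage_lt m n i : (m < n)%N -> V (i, m) `<=` stage n.
  elim: n => // n IH; rewrite ltnS leq_eqVlt => /orP[/eqP->|mn] y Vy.
    by right; exists i.
  by left; exact: IH Vy.
have stageE n x : stage n x -> exists k, V k x.
  elim: n => //= n IH [/IH//|[i Di]]; by exists (i, n).
have oV k x : V k x -> exists2 e, 0 < e & forall y, d x y < e -> V k y.
  move=> [c [lc nc Uc cx]]; exists (e k.2 - d c x); first by rewrite subr_gt0.
  move=> y xy; exists c; split=> //; have := dT c x y; move: xy; lra.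
have cover i x : U i x -> exists k, V k x.
  move=> /leastP[j lj]; have [a a0 Ha] := oU j x lj.1.
  have [|n na] := esmall (a / 3); first by rewrite divr_gt0.
  have [sx|nsx] := pselect (stage n x); first exact: stageE sx.
  exists (j, n), x; split=> //=; last by rewrite d0.
  by move=> z xz; apply: Ha; apply: lt_le_trans xz _; rewrite mulrC -ler_pdivlMr// ltW.
exists V; split => //.
  move=> k y [c [_ _ Uc cy]]; apply: Uc; have := e0 k.2; move: cy; lra.
move=> i x /cover[[a n] Vx]; have [b b0 Hb] := oV _ _ Vx.
have [j jb] := esmall b b0.
exists (e (n + j).+1) => //.
(* A centre of a stage after [n] lies outside [V (a, n)], which contains a ball of radius larger
   than [e j] around [x]; late sets therefore stay away from [x]. *)
have sep m : (n + j < m)%N -> forall i' y, V (i', m) y -> d x y < e (n + j).+1 -> False.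
  move=> nm i' y [c [_ nc _ cy]] xy; apply: nc; apply: (@stage_lt n _ a).
    by apply: leq_ltn_trans nm; exact: leq_addr.
  apply: Hb; apply: lt_trans jb; apply: (@lt_le_trans _ _ (e (n + j)%N)).
    have := dT x y c; rewrite (dC y); have := ele _ _ nm; move: cy xy; rewrite (eS (n + j)%N); lra.
  by apply: ele; exact: leq_addl.
(* Two centres of stage [m] whose sets come this close to [x] are less than [3 * e m] apart, so each
   first index precedes the other. *)
have one m i1 i2 y1 y2 : (m <= n + j)%N -> V (i1, m) y1 -> V (i2, m) y2 ->
    d x y1 < e (n + j).+1 -> d x y2 < e (n + j).+1 -> i1 = i2.
  have aux i3 i4 y3 y4 : (m <= n + j)%N -> V (i3, m) y3 -> V (i4, m) y4 ->
    d x y3 < e (n + j).+1 -> d x y4 < e (n + j).+1 -> wo i3 i4 -> i3 = i4.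
    move=> mn [c3 [l3 _ U3 H3]] [c4 [l4 _ U4 H4]] x3 x4 w34.
    apply: wo_anti => //; apply: l4.2; apply: U3.
    have h1 := dT c3 y3 c4; have h2 := dT y3 x c4; have h3 := dT x y4 c4.
    have h4 := ele _ _ mn; rewrite (eS (n + j)%N) in h4.
    move: H3 H4 h2 h3; rewrite /= (dC y3 x) (dC c4); lra.
  move=> mn V1 V2 x1 x2; have [w|w] := wo_total i1 i2; first exact: (aux _ _ _ _ mn V1 V2).
  by symmetry; exact: (aux _ _ _ _ mn V2 V1).
apply: (@sub_finite_set _ _ (\bigcup_(m in `I_(n + j).+1)
   [set k : I * nat | k.2 = m /\ exists2 y, V k y & d x y < e (n + j).+1])).
  move=> [i' m] [y Vy xy]; exists m; last by split => //; exists y.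
  by rewrite /= ltnS leqNgt; apply/negP => nm; exact: (sep m nm i' y).
apply: bigcup_finite; first exact: finite_II.
move=> m; rewrite /= ltnS => mn.
have [[[i1 m1] [/= m1m [y1 V1 x1]]]|H] :=
  pselect (exists k : I * nat, k.2 = m /\ exists2 y, V k y & d x y < e (n + j).+1); last first.
  rewrite (_ : mkset _ = set0); first exact: finite_set0.
  by apply/seteqP; split=> // k Hk; apply: H; exists k.
apply: (@sub_finite_set _ _ [set (i1, m)]); last exact: finite_set1.
move=> [i2 m2] [/= m2m [y2 V2 x2]]; subst m1 m2; congr pair.
by rewrite (one _ _ _ _ _ mn V2 V1 x2 x1).
Qed.

Lemma metrizable_paracompact (T : topologicalType) : metrizable R T -> paracompact T.
Proof.
move=> [d [[d0 dE dC dT] dnbhs]] C Co CT.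
have dd : pseudometric d by split => // x; apply/dE.
pose U (i : set T) := [set x | C i /\ i x].
have [|V [oV VU cV fV]] := @stone T d _ U dd.
  move=> i x [Ci ix]; have /dnbhs[e e0 He] : nbhs x i.
    by apply: open_nbhs_nbhs; split => //; exact: Co.
  by exists e => // y xy; split => //; exact: He.
have VT x : exists k, V k x.
  have : (\bigcup_(U in C) U) x by rewrite CT.
  by move=> [i Ci ix]; exact: (cV i x).
exists [set V k | k in [set k | V k !=set0]]; split.
- move=> _ [k _ <-]; rewrite openE => x /oV[e e0 He].
  by apply/dnbhs; exists e.
- apply/seteqP; split=> // x _; have [k Vx] := VT x; exists (V k) => //.
  by exists k => //; exists x.
- move=> _ [k [y Vy] <-].
  by have [Ck _] := VU _ _ Vy; exists k.1 => // z /VU[].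
move=> x; have : (\bigcup_(U in C) U) x by rewrite CT.
move=> [i Ci ix]; have [e e0 fe] := fV i x (conj Ci ix).
exists [set y | d x y < e]; first by apply/dnbhs; exists e.
apply: sub_finite_set (finite_image V fe) => _ [[k _ <-] [y [Vy xy]]].
by exists k => //; exists y.
Qed.

End Stone.

Lemma fsum_seq (V : nmodType) (K : choiceType) (S : seq K) (f : K -> V) :
  uniq S -> (forall k, k \notin S -> f k = 0) ->
  \sum_(k \in [set: K]) f k = \sum_(k <- S) f k.
Proof.
move=> uS f0; rewrite (fsbigE S _ uS)//; last by move=> k _; exact: f0.
by apply: eq_bigl => k; rewrite in_setT.
Qed.

Lemma finite_seq_uniq (K : choiceType) (A : set K) : finite_set A ->
  exists2 S : seq K, uniq S & forall k, A k <-> k \in S.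
Proof.
move=> /finite_seqP[s ->]; exists (undup s); first exact: undup_uniq.
by move=> k; rewrite mem_undup.
Qed.

Lemma fmap_ultra (T U : Type) (f : T -> U) (F : set_system T) :
  UltraFilter F -> UltraFilter (f @ F).
Proof.
move=> UF; split=> [|G PG FG]; first exact: fmap_proper_filter.
apply/seteqP; split=> // B GB; have [//|nB] := in_ultra_setVsetC (f @^-1` B) UF.
have GnB : G (~` B) by apply: FG.
by have /filter_ex[x []] : G (B `&` ~` B) by exact: filterI.
Qed.

(** * The Dugundji operator for a pseudometric *)

Section Dugundji.
Context {R : realType} (X : topologicalType) (d : X -> X -> R).
Hypothesis dd : pseudometric d.
Hypothesis dcont : forall x e, 0 < e -> \forall y \near x, d x y < e.

Let d0 x : d x x = 0. Proof. by have [] := dd. Qed.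
Let dC x y : d x y = d y x. Proof. by have [] := dd. Qed.
Let dT x y z : d x z <= d x y + d y z. Proof. by have [] := dd. Qed.
Let dge0 x y : 0 <= d x y. Proof. exact: pseudometric_ge0. Qed.

Lemma lipschitz_cvg (u : X -> R) : (forall x y, u x <= u y + d x y) -> continuous u.
Proof.
move=> uL x; apply/cvgrPdist_lt => e e0; apply: filterS (dcont x e0) => y xy.
by rewrite ltr_norml; have := uL x y; have := uL y x; rewrite (dC y x); move: xy; lra.
Qed.

Lemma near_gt0 (u : X -> R) x : {for x, continuous u} -> 0 < u x -> \forall y \near x, 0 < u y.
Proof.
move=> cu ux; move/cvgrPdist_lt: cu => /(_ _ ux); apply: filterS => y.
rewrite ltr_norml => /andP[_]; lra.
Qed.

Section DistanceToComplement.
Variable V : set X.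

(** The value 1 keeps the infimum over a non-empty set when [V] is everything. *)
Definition dist_compl (x : X) : R := inf ([set 1] `|` [set d x y | y in ~` V]).

Let has x : has_inf ([set 1] `|` [set d x y | y in ~` V]).
Proof. by split; [exists 1; left|exists 0 => _ [->//|[y _ <-]]]. Qed.

Lemma dist_compl_ge0 x : 0 <= dist_compl x.
Proof. by apply: lb_le_inf; [exact: (has x).1|move=> _ [->//|[y _ <-]]]. Qed.

Lemma dist_compl_lip x y : dist_compl x <= dist_compl y + d x y.
Proof.
rewrite -lerBlDr; apply: lb_le_inf; first exact: (has y).1.
move=> _ [->|[z Vz <-]]; rewrite lerBlDr.
  have : dist_compl x <= 1 by apply: ge_inf; [exact: (has x).2|left].
  by move=> /le_trans; apply; rewrite lerDl.
have : dist_compl x <= d x z by apply: ge_inf; [exact: (has x).2|right; exists z].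
by move=> /le_trans; apply; rewrite addrC.
Qed.

Lemma dist_compl_cvg : continuous dist_compl.
Proof. exact: lipschitz_cvg dist_compl_lip. Qed.

Lemma dist_compl_out x : ~ V x -> dist_compl x = 0.
Proof.
move=> nV; apply/eqP; rewrite eq_le dist_compl_ge0 andbT -(d0 x).
by apply: ge_inf; [exact: (has x).2|right; exists x].
Qed.

Lemma dist_compl_gt0 x e : 0 < e -> (forall y, d x y < e -> V y) -> 0 < dist_compl x.
Proof.
move=> e0 He; apply: (@lt_le_trans _ _ (Num.min 1 e)); first by rewrite lt_min ltr01.
apply: lb_le_inf; first exact: (has x).1.
move=> _ [->|[y Vy <-]]; first by rewrite ge_min lexx.
by rewrite ge_min leNgt [X in _ || X]leNgt; apply/orP; right; apply/negP => /He.
Qed.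

End DistanceToComplement.

(** Distances to the complements of the sets given by [stone], divided by their sum. The [U i] need
    not cover [X]: outside their union all numerators vanish and the quotients are 0. *)
Lemma stone_partition (I : choiceType) (U : I -> set X) :
  (forall i x, U i x -> exists2 e, 0 < e & forall y, d x y < e -> U i y) ->
  exists psi : I * nat -> X -> R,
    [/\ forall k x, 0 <= psi k x,
        forall k x, psi k x != 0 -> U k.1 x &
        forall i x, U i x -> (forall k, {for x, continuous (psi k)}) /\
          exists2 S, uniq S & \forall y \near x,
            (forall k, k \notin S -> psi k y = 0) /\ \sum_(k <- S) psi k y = 1].
Proof.
move=> oU; have [V [oV VU cV fV]] := stone dd oU.
pose u k x := dist_compl (V k) x.
pose s x := \sum_(k \in [set: I * nat]) u k x.
have locS i x : U i x -> exists2 S, uniq S & \forall y \near x,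
    (forall k, k \notin S -> u k y = 0) /\ s y = \sum_(k <- S) u k y.
  move=> Ux; have [e e0 fe] := fV i x Ux.
  have [S uS SE] := finite_seq_uniq fe.
  exists S => //; apply: filterS (dcont x e0) => y xy.
  have H k : k \notin S -> u k y = 0.
    move=> kS; apply: dist_compl_out => Vy; move/negP : kS; apply.
    by apply/SE; exists y.
  by split => //; exact: fsum_seq.
have u_ge0 k x : 0 <= u k x by exact: dist_compl_ge0.
have s_gt0 i x : U i x -> 0 < s x.
  move=> Ux; have [S uS /nbhs_singleton[S0 ->]] := locS i x Ux.
  have [k Vk] := cV i x Ux; have [e e0 He] := oV k x Vk.
  have uk : 0 < u k x by exact: (dist_compl_gt0 e0).
  have kS : k \in S by apply: contraT => /S0 uk0; rewrite uk0 ltxx in uk.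
  rewrite (bigD1_seq k)//=; apply: ltr_wpDr => //; exact: sumr_ge0.
exists (fun k x => u k x / s x); split.
- move=> k x; rewrite mulr_ge0// invr_ge0; have [i|nU] := pselect (exists i, U i x).
    by case: i => i /s_gt0/ltW.
  by rewrite /s fsbig1// => k' _; apply: dist_compl_out => /VU ?; apply: nU; exists k'.1.
- move=> k x; apply: contraNP => nU; rewrite /u dist_compl_out ?mul0r//.
  by move=> /VU.
move=> i x Ux; have [S uS HS] := locS i x Ux.
have cs : {for x, continuous s}.
  have H : (fun y => \sum_(k <- S) u k y) @ x --> \sum_(k <- S) u k x.
    by apply: (@tcvg_sum R R^o) => // k _; exact: dist_compl_cvg.
  rewrite /prop_for /continuous_at (nbhs_singleton HS).2.
  by apply: (cvg_congr H); apply: filterS HS => y /= [_ <-].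
split.
  move=> k; apply: cvgM; first exact: dist_compl_cvg.
  by apply: cvgV => //; rewrite gt_eqF//; exact: s_gt0 Ux.
exists S => //; have sx : 0 < s x by exact: s_gt0 Ux.
have near_s : \forall y \near x, 0 < s y by exact: near_gt0.
apply: (filter_imp2 _ HS near_s) => y [S0 sE] sy; split; first by move=> k /S0 ->; rewrite mul0r.
by rewrite -mulr_suml -sE divff// gt_eqF.
Qed.

Context (A : set X).
(** For a pseudometric, closedness takes the form that distance 0 from [A] is attained; the point
    attaining it carries the value of the extension. *)
Hypothesis Aclosed : forall x, (forall e, 0 < e -> exists2 a, A a & d x a < e) ->
  exists2 a, A a & d x a = 0.
Hypothesis Asep : forall a b, A a -> A b -> d a b = 0 -> a = b.
Hypothesis Acompat : forall a V, A a -> nbhs a V ->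
  exists2 e, 0 < e & forall b, A b -> d a b < e -> V b.

(* The extension of [f] at [x] off [A] averages the values of [f] at points of [A]
   nearly closest to [x]. The last clause is stated on a pair [C], [K] because the
   convergence of [D F (f z)] on a compact set [K] only involves [f z] on the
   compact set [C] of the points of [A] which are used on [K]. *)
Lemma dugundji : exists D : forall F : tvsType R, (X -> F) -> X -> F,
  [/\ forall (F : tvsType R) a f g x, D F (fun y => a *: f y + g y) x = a *: D F f x + D F g x,
      forall (F : tvsType R) f a, A a -> D F f a = f a,
      forall (F : tvsType R) f, (forall a, A a -> f a = 0) -> forall x, D F f x = 0 &
      forall K : set X, exists C : set X,
        [/\ C `<=` A, compact K -> compact C &
            forall (F : tvsType R) (Z : Type) (G : set_system Z) (f : Z -> X -> F) (f0 : X -> F),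
              Filter G ->
              (forall a0, C a0 -> (fun p : Z * X => f p.1 p.2 : F) @
                 (filter_prod G (within C (nbhs a0))) --> f0 a0) ->
              forall x0, K x0 -> (fun p : Z * X => D F (f p.1) p.2 : F) @
                 (filter_prod G (within K (nbhs x0))) --> D F f0 x0]].
Proof.
have [[a00 Aa00]|A0] := pselect (A !=set0); last first.
  exists (fun F f x => 0); split => //.
  - by move=> F a f g x; rewrite scaler0 addr0.
  - by move=> F f a Aa; exfalso; apply: A0; exists a.
  - move=> K; exists set0; split => //; first by move=> _; exact: compact0.
    by move=> F Z G f f0 FG _ x0 _; exact: cvg_cst.
pose r x := inf [set d x a | a in A].
have hasr x : has_inf [set d x a | a in A].
  by split; [exists (d x a00); exists a00|exists 0 => _ [a _ <-]].
have r_ge0 x : 0 <= r x by apply: lb_le_inf; [exact: (hasr x).1|move=> _ [a _ <-]].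
have r_le x a : A a -> r x <= d x a by move=> Aa; apply: ge_inf; [exact: (hasr x).2|exists a].
have r_lip x y : r x <= r y + d x y.
  rewrite -lerBlDr; apply: lb_le_inf; first exact: (hasr y).1.
  move=> _ [a Aa <-]; rewrite lerBlDr; apply: le_trans (r_le x a Aa) _.
  by rewrite addrC.
have r_lt x e : r x < e -> exists2 a, A a & d x a < e.
  by rewrite -subr_gt0 => /inf_adherent/(_ (hasr x))[_ [a Aa <-]]; rewrite addrC subrK; exists a.
have r_eq0 x : exists a, r x = 0 -> A a /\ d x a = 0.
  have [rx|rx] := pselect (r x = 0); last by exists a00.
  have [|a Aa xa] := Aclosed (x := x); last by exists a.
  by move=> e e0; apply: r_lt; rewrite rx.
have [pt ptP] := choice r_eq0.
(* On the ball of radius [r i / 4] around [i] one has [r i <= 4 / 3 * r x], so a point of [A] within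
   [2 * r i] of the centre is within [9 / 4 * r i <= 3 * r x] of every [x] in the ball. *)
pose U (i : X) := [set x | 0 < r i /\ d i x < r i / 4].
have oU i x : U i x -> exists2 e, 0 < e & forall y, d x y < e -> U i y.
  move=> [ri ix]; exists (r i / 4 - d i x); first by rewrite subr_gt0.
  by move=> y xy; split => //; have := dT i x y; lra.
have Upos i x : U i x -> 0 < r x /\ r i <= 4 / 3 * r x.
  move=> [ri ix]; have := r_lip i x; move: ix; lra.
have Uself x : 0 < r x -> U x x by move=> rx; split => //; rewrite d0 divr_gt0.
have [psi [psi_ge0 psiU psiP]] := stone_partition oU.
have y_ex i : exists a, A a /\ (0 < r i -> d i a < 2 * r i).
  have [ri|ri] := ltP 0 (r i); last by exists a00; split => //; rewrite ltNge ri.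
  have [|a Aa ia] := r_lt i (2 * r i); first by rewrite ltr_pMl// ltr1n.
  by exists a.
have [y_ y_P] := choice y_ex.
have near_y k x : psi k x != 0 -> d x (y_ k.1) <= 3 * r x.
  move=> /psiU Ux; have [rx ri] := Upos _ _ Ux; have [rk kx] := Ux.
  by have := (y_P k.1).2 rk; have := dT x k.1 (y_ k.1); rewrite (dC x k.1); move: kx; lra.
pose D (F : tvsType R) (f : X -> F) x : F :=
  if r x == 0 then f (pt x) else \sum_(k \in [set: X * nat]) psi k x *: f (y_ k.1).
have DE x : 0 < r x -> exists2 S, uniq S & \forall y \near x,
    [/\ 0 < r y, (forall k, k \notin S -> psi k y = 0), \sum_(k <- S) psi k y = 1 &
     forall (F : tvsType R) (f : X -> F), D F f y = \sum_(k <- S) psi k y *: f (y_ k.1)].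
  move=> rx; have [_ [S uS HS]] := psiP x x (Uself x rx).
  exists S => //; have near_r : \forall y \near x, 0 < r y by apply: near_gt0 => //; exact: lipschitz_cvg.
  apply: (filter_imp2 _ HS near_r) => y [S0 S1] ry; split => // F f.
  rewrite /D (gt_eqF ry); apply: fsum_seq => // k kS.
  by rewrite S0// scale0r.
have D0 F f x : r x = 0 -> D F f x = f (pt x) by move=> rx; rewrite /D rx eqxx.
have rcase x : r x = 0 \/ 0 < r x.
  by have := r_ge0 x; rewrite le_eqVlt eq_sym => /orP[/eqP|]; [left|right].
have rA a : A a -> r a = 0.
  by move=> Aa; apply/eqP; rewrite eq_le r_ge0 andbT -(d0 a) r_le.
exists D; split.
- move=> F a f g x; have [rx|/DE[S uS /nbhs_singleton[_ _ _ DS]]] := rcase x.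
    by rewrite !D0.
  rewrite !DS scaler_sumr -big_split/=; apply: eq_bigr => k _.
  by rewrite scalerDr !scalerA mulrC.
- move=> F f a Aa; rewrite D0 ?rA//; congr f.
  by have [Ap dp] := ptP a (rA a Aa); apply: Asep => //; rewrite dC.
- move=> F f f0 x; have [rx|/DE[S uS /nbhs_singleton[_ _ _ DS]]] := rcase x.
    by rewrite D0// f0//; have [] := ptP x rx.
  by rewrite DS big1// => k _; rewrite f0 ?scaler0//; have [] := y_P k.1.
move=> K; pose C := [set c | exists x, K x /\
   ((r x = 0 /\ c = pt x) \/ (0 < r x /\ exists2 k, psi k x != 0 & c = y_ k.1))].
exists C; split.
- move=> c [x [_ [[rx ->]|[rx [k _ ->]]]]]; first by have [] := ptP x rx.
  by have [] := y_P k.1.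
- move=> cK; rewrite compact_ultra => G UG GC.
  have ka_ex c : exists x, C c -> K x /\
      ((r x = 0 /\ c = pt x) \/ (0 < r x /\ exists2 k, psi k x != 0 & c = y_ k.1)).
    by have [[x Hx]|nC] := pselect (C c); [exists x|exists c].
  (* Each [c] in [C] is sent to a point of [K] at which it is used; the image of the ultrafilter
     then converges to some [x0] in [K]. *)
  have [ka kaP] := choice ka_ex.
  have dka c : C c -> d (ka c) c <= 3 * r (ka c).
    move=> /kaP[_ [[rx cE]|[rx [k /near_y H cE]]]]; last by rewrite {2}cE.
    by rewrite {2}cE rx mulr0; have [_ ->] := ptP _ rx.
  have UG' : UltraFilter (ka @ G) by exact: fmap_ultra.
  have GK : G [set c | K (ka c)] by apply: (filter_imp _ GC) => c /kaP[].
  move: cK; rewrite compact_ultra => /(_ _ UG' GK)[x0 [Kx0 cx0]].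
  have [rx0|rx0] := rcase x0.
    have [Ap dp] := ptP _ rx0; exists (pt x0); split.
      by exists x0; split => //; left.
    move=> V /(Acompat Ap)[e e0 He].
    (* As [r x0 = 0], [r (ka c)] is at most the distance from [ka c] to [x0]. Hence [c], which is
       within [3 * r (ka c)] of [ka c], is within four times that distance of [x0]. *)
    have e50 : 0 < e / 5 by rewrite divr_gt0.
    have H : G [set c | d x0 (ka c) < e / 5] by exact: (cx0 _ (dcont x0 e50)).
    apply: (filter_imp2 _ GC H) => c Cc xc; apply: He.
      by have [x [_ [[rx ->]|[rx [k _ ->]]]]] := Cc; [have [] := ptP x rx|have [] := y_P k.1].
    have h1 := dT (pt x0) x0 c; have h2 := dT x0 (ka c) c; have h3 := dka c Cc.
    have h4 := r_lip (ka c) x0; rewrite (dC (ka c)) in h4; rewrite (dC (pt x0) x0) dp in h1.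
    move: xc h1 h2 h3 h4; rewrite /= rx0; lra.
  have [S uS HS] := DE _ rx0.
  (* Near a point where [r] is positive only finitely many points of [A] are used, so the
     ultrafilter lives on a finite set. *)
  pose fin := [set` [seq y_ k.1 | k <- S]] `&` C.
  have Gfin : G fin.
    have H : G [set c | [/\ 0 < r (ka c) & (forall k, k \notin S -> psi k (ka c) = 0)]].
      have nW : nbhs x0 [set x | 0 < r x /\ (forall k, k \notin S -> psi k x = 0)].
        by apply: filterS HS => y [].
      exact: (cx0 _ nW).
    apply: (filter_imp2 _ GC H) => c Cc [rk k0]; split => //=.
    have [_ [[rx0' _]|[_ [k pk cE]]]] := kaP c Cc; first by rewrite rx0' ltxx in rk.
    rewrite cE; apply/map_f; apply: contraT => /k0 pk0; by rewrite pk0 eqxx in pk.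
  have cfin : compact fin.
    apply: finite_compact; apply: sub_finite_set (@subIsetl _ _ _) _.
    exact: finite_seq.
  move: cfin; rewrite compact_ultra => /(_ _ UG Gfin)[c [[_ Cc] Gc]].
  by exists c.
move=> F Z G f f0 FG fC x0 Kx0.
have [rx0|rx0] := rcase x0.
  have [Ap dp] := ptP _ rx0.
  have Cp : C (pt x0) by exists x0; split => //; left.
  rewrite D0//; apply/cvg_seminorm => q sq e e0.
  have /cvg_seminorm/(_ q sq e e0)[[P Q] [/= GP WQ] PQ] := fC _ Cp.
  have [e1 e10 He1] := Acompat Ap WQ.
  have e50 : 0 < e1 / 5 by rewrite divr_gt0.
  exists (P, [set x | K x /\ d x0 x < e1 / 5]).
    split => //=; apply: filterS (dcont x0 e50) => x xx Kx; by split.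
  move=> [z x] [/= Pz [Kx xx]].
  have near_pt c : A c -> C c -> d x c <= 3 * r x -> q (f z c - f0 (pt x0)) <= e.
    move=> Ac Cc xc; apply: (PQ (z, c)); split => //=; apply: He1 => //.
    have h1 := dT (pt x0) x0 c; have h2 := dT x0 x c.
    have h4 := r_lip x x0; rewrite (dC x) in h4; rewrite (dC (pt x0) x0) dp in h1.
    move: xx h1 h2 xc h4; rewrite /= rx0; lra.
  have [rx|rx] := rcase x.
    have [Ax dx] := ptP _ rx; rewrite D0//; apply: near_pt => //.
      by exists x; split => //; left.
    by rewrite dx rx mulr0.
  have [S uS /nbhs_singleton[_ S0 S1 ->]] := DE _ rx.
  have -> : f0 (pt x0) = \sum_(k <- S) psi k x *: f0 (pt x0) by rewrite -scaler_suml S1 scale1r.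
  rewrite -sumrB; apply: le_trans (seminorm_sum _ _ sq) _.
  rewrite -[e]mul1r -S1 mulr_suml; apply: ler_sum => k _.
  have [_ qZ _] := sq; rewrite -scalerBr qZ ger0_norm//.
  have [->|pk] := eqVneq (psi k x) 0; first by rewrite !mul0r.
  apply: ler_wpM2l => //; apply: near_pt; [by have [] := y_P k.1| |exact: near_y].
  by exists x; split => //; right; split => //; exists k.
have [S uS HS] := DE _ rx0; have [_ _ _ ->] := nbhs_singleton HS.
have FGK : Filter (filter_prod G (within K (nbhs x0))) by exact: filter_prod_filter.
(* Convergence of [f] is known on [C] only; a term whose point [y_ k.1] is not in [C] has weight 0
   on all of [K] and may be cut off. *)
have H : (fun p : Z * X => \sum_(k <- S) (if `[< C (y_ k.1) >] then psi k p.2 *: f p.1 (y_ k.1) else 0))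
    @ (filter_prod G (within K (nbhs x0))) --> \sum_(k <- S) psi k x0 *: f0 (y_ k.1).
  apply: tcvg_sum => k kS; case: asboolP => Ck; last first.
    have [->|pk] := eqVneq (psi k x0) 0; first by rewrite scale0r; exact: cvg_cst.
    exfalso; apply: Ck; exists x0; split => //; right; split => //; by exists k.
  apply: tcvgZ.
    have c1 := (psiP x0 x0 (Uself _ rx0)).1 k.
    move=> V /c1 cV; exists (setT, [set x | V (psi k x)]).
      split => //=; first exact: filterT.
      have {}cV : nbhs x0 [set x | V (psi k x)] by exact: cV.
      by apply: filterS cV.
    by move=> [z x] [].
  move=> V /(fC _ Ck)[[P Q] [/= GP WQ] PQ]; exists (P, setT).
    by split => //=; exact: filterT.
  move=> [z x] [/= Pz _]; apply: (PQ (z, y_ k.1)); split => //=.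
  exact: (nbhs_singleton WQ).
apply: (cvg_congr H); exists (setT, [set x | K x /\
   [/\ 0 < r x, (forall k, k \notin S -> psi k x = 0), \sum_(k <- S) psi k x = 1 &
     forall (F : tvsType R) (f : X -> F), D F f x = \sum_(k <- S) psi k x *: f (y_ k.1)]]).
  by split => /=; [exact: filterT|apply: filterS HS => x Hx Kx].
move=> [z x] [_ /= [Kx [rx _ _ ->]]]; apply: eq_bigr => k _.
case: asboolP => // Ck; have [->|pk] := eqVneq (psi k x) 0; first by rewrite scale0r.
exfalso; apply: Ck; exists x; split => //; right; split => //; by exists k.
Qed.

End Dugundji.

Lemma near_seq (T : Type) (F : set_system T) (FF : Filter F) (I : eqType) (s : seq I)
    (P : I -> set T) : (forall i, i \in s -> F (P i)) -> F [set x | forall i, i \in s -> P i x].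
Proof.
elim: s => [_|i s IH H]; first by apply: filterE => x j.
have F1 : F (P i) by apply: H; rewrite mem_head.
have F2 := IH (fun j js => H j (mem_behead (s := i :: s) js)).
apply: (filter_imp2 FF F1 F2) => x Pi Ps j; rewrite inE => /orP[/eqP->//|]; exact: Ps.
Qed.

(** * Separation and partitions of unity on paracompact spaces *)

Section Paracompact.
Context {R : realType} (X : topologicalType).
Hypotheses (hX : hausdorff_space X) (pX : paracompact X).

(** The common argument for regularity and normality. In a locally finite refinement the members
    meeting [A] are each disjoint from an open set around [B]; [U] is their union, and local
    finiteness keeps a neighbourhood of each point of [B] off [U]. *)
Let separate (A B : set X) : closed A ->
  (forall a, A a -> exists U V, [/\ open U, open V, U a, B `<=` V & U `&` V = set0]) ->
  exists U V, [/\ open U, open V, A `<=` U, B `<=` V & U `&` V = set0].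
Proof.
move=> cA H.
pose C := [set U : set X | open U /\ exists2 V, open V /\ B `<=` V & U `&` V = set0] `|` [set ~` A].
have [||D [oD DT DC Df]] := pX (C := C).
- by move=> U [[oU _]//|->]; exact: closed_openC.
- apply/seteqP; split=> // x _; have [Ax|nA] := pselect (A x); last by exists (~` A) => //; right.
  have [U [V [oU oV Ux BV UV]]] := H x Ax; exists U => //; left; split => //; by exists V.
pose U := \bigcup_(W in [set W | D W /\ W `&` A !=set0]) W.
exists U, ((~` U)°); split.
- by apply: bigcup_open => W [DW _]; exact: oD.
- exact: open_interior.
- move=> a Aa; have : (\bigcup_(V in D) V) a by rewrite DT.
  by move=> [W DW Wa]; exists W => //; split => //; exists a.
- move=> b Bb; rewrite /interior; have [N nN fN] := Df b.
  have [S _ SE] := finite_seq_uniq fN.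
  have nS : nbhs b [set y | forall W, W \in S -> W `&` A !=set0 -> ~ W y].
    apply: near_seq => W /SE[DW _]; have [WA|nWA] := pselect (W `&` A !=set0); last first.
      by apply: filterE => y /nWA.
    have [G [[oG [V [oV BV] GV]]|->] WG] := DC W DW; last first.
      by case: WA => a [/WG].
    have : nbhs b V by apply: open_nbhs_nbhs; split => //; exact: BV.
    apply: filterS => y Vy _ /WG Gy; have : (G `&` V) y by split.
    by rewrite GV.
  apply: (filter_imp2 _ nN nS) => y Ny Hy [W [DW WA] Wy]; apply: (Hy W) => //.
  by apply/SE; split => //; exists y.
- by apply/seteqP; split=> // x [Ux /interior_subset].
Qed.

Lemma paracompact_regular x (U : set X) : open U -> U x ->
  exists W, [/\ open W, W x & closure W `<=` U].
Proof.
move=> oU Ux; have [|a nUa|V [W [oV oW UV Wx VW]]] := @separate (~` U) [set x].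
- exact: open_closedC.
- have ax : a != x by apply/eqP => ax; apply: nUa; rewrite ax.
  have := hX; rewrite open_hausdorff => /(_ a x ax)[[G H] /= [Ga Hx] [oG oH /eqP GH]].
  exists G, H; split => //; first by rewrite inE in Ga.
  by move=> _ ->; rewrite inE in Hx.
exists W; split => //; first exact: Wx.
have -> : U = ~` ~` U by rewrite setCK.
move=> y cWy nUy; have [z [Wz Vz]] := cWy V (open_nbhs_nbhs (conj oV (UV _ nUy))).
have : (V `&` W) z by split.
by rewrite VW.
Qed.

Lemma paracompact_normal : normal_space X.
Proof.
apply/(@normal_openP R) => A B cA cB AB.
have [|U [V [oU oV AU BV UV]]] := @separate A B cA; last by exists U, V.
move=> a Aa; have nBa : (~` B) a by move=> Ba; have : (A `&` B) a by []; rewrite AB.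
have [W [oW Wa WB]] := paracompact_regular (closed_openC cB) nBa.
exists W, (~` closure W); split => //.
- exact/closed_openC/closed_closure.
- by move=> b Bb /WB.
- by apply/seteqP; split=> // y [/subset_closure Wy].
Qed.

Lemma closed_locally_finite (D P : set (set X)) :
  (forall x : X, exists2 W, nbhs x W & finite_set [set V | D V /\ V `&` W !=set0]) ->
  closed (\bigcup_(W in [set W | D W /\ P W]) closure W).
Proof.
move=> Df; rewrite -[X in closed X]setCK; apply: open_closedC; rewrite openE => x nx.
have [N nN fN] := Df x; have [S _ SE] := finite_seq_uniq fN.
have nS : nbhs x [set y | forall W, W \in S -> P W -> ~ closure W y].
  apply: near_seq => W /SE[DW _]; have [PW|nPW] := pselect (P W); last by apply: filterE => y /nPW.
  have : nbhs x (~` closure W).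
    apply: open_nbhs_nbhs; split; first exact/closed_openC/closed_closure.
    by move=> cW; apply: nx; exists W.
  exact: filterS.
have := nN; rewrite nbhsE => -[N' [oN' N'x] N'N].
have nN' : nbhs x N' by exact: open_nbhs_nbhs.
apply: (filter_imp2 _ nN' nS) => y Ny Hy [W [DW PW] cWy]; apply: (Hy W) => //.
apply/SE; split => //; have [z [Wz Nz]] := cWy N' (open_nbhs_nbhs (conj oN' Ny)).
by exists z; split => //; exact: N'N.
Qed.

Definition is_partition_of_unity (I : choiceType) (h : I -> X -> R) : Prop :=
  [/\ forall i, continuous (h i), forall i x, 0 <= h i x &
      forall x : X, exists2 S : seq I, uniq S & \forall y \near x,
        (forall i, i \notin S -> h i y = 0) /\ \sum_(i <- S) h i y = 1].

(** The cover is shrunk twice. The unions [F V] of closures of members of the second refinement are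
    closed, lie in the open sets [V] of the first one and still cover [X]; Urysohn functions that
    are 1 on [F V] and 0 off [V] can therefore be normalised. *)
Lemma partition_of_unity (C : set (set X)) : C `<=` open -> \bigcup_(U in C) U = setT ->
  exists (I : choiceType) (h : I -> X -> R), is_partition_of_unity h /\
    forall i, exists2 U, C U & closure [set x | h i x != 0] `<=` U.
Proof.
move=> oC CT.
have shrink (C' : set (set X)) : C' `<=` open -> \bigcup_(U in C') U = setT ->
    exists D : set (set X), [/\ D `<=` open, \bigcup_(V in D) V = setT,
      forall V, D V -> exists2 U, C' U & closure V `<=` U &
      forall x : X, exists2 W, nbhs x W & finite_set [set V | D V /\ V `&` W !=set0]].
  move=> oC' C'T.
  have [||D [oD DT DC Df]] := pX (C := [set W | open W /\ exists2 U, C' U & closure W `<=` U]).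
  - by move=> W [].
  - apply/seteqP; split=> // x _; have : (\bigcup_(U in C') U) x by rewrite C'T.
    move=> [U C'U Ux]; have [W [oW Wx WU]] := paracompact_regular (oC' _ C'U) Ux.
    by exists W => //; split => //; exists U.
  exists D; split => // V /DC[W [_ [U C'U WU]] VW]; exists U => //.
  exact: subset_trans (closure_subset VW) WU.
have [D [oD DT DC Df]] := shrink C oC CT.
have [D' [oD' D'T D'D D'f]] := shrink D oD DT.
pose F (V : set X) := \bigcup_(W in [set W | D' W /\ closure W `<=` V]) closure W.
have cF V : closed (F V) by exact: closed_locally_finite.
have FV V : F V `<=` V by move=> x [W [_ WV] /WV].
have f_ex (V : set_type D) : exists f : X -> R, [/\ continuous f, forall x, 0 <= f x <= 1,
    forall x, F (set_val V) x -> f x = 1 & forall x, ~ set_val V x -> f x = 0].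
  have oV : open (set_val V) by apply: oD; exact: set_valP.
  have [|f [cf f0 f1 f01]] := @urysohn_ext_itv X R paracompact_normal (~` set_val V)
     (F (set_val V)) 0 1 (open_closedC oV) (cF _) _ ltr01.
    by apply/seteqP; split=> // x [nV /FV].
  exists f; split => //.
  - by move=> x; have := f01 (f x); rewrite /= in_itv/=; apply; exists x.
  - by move=> x Fx; apply: f1; exists x.
  - by move=> x Vx; apply: f0; exists x.
have [f fP] := choice f_ex.
pose s x := \sum_(V \in [set: set_type D]) f V x.
have locS (x : X) : exists2 S : seq (set_type D), uniq S & \forall y \near x,
    (forall V, V \notin S -> f V y = 0) /\ s y = \sum_(V <- S) f V y.
  have [N nN fN] := Df x.
  have fN' : finite_set [set V : set_type D | set_val V `&` N !=set0].
    have inj : {in set_val @^-1` [set V | D V /\ V `&` N !=set0] &,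
      injective (set_val : set_type D -> set X)} by move=> V W _ _; exact: val_inj.
    apply: sub_finite_set (finite_preimage inj fN) => V VN; split => //.
    exact: set_valP.
  have [S uS SE] := finite_seq_uniq fN'.
  exists S => //; apply: filterS nN => y Ny.
  have H V : V \notin S -> f V y = 0.
    move=> VS; have [_ _ _ f0] := fP V; apply: f0 => Vy; move/negP : VS; apply.
    by apply/SE; exists y.
  by split => //; exact: fsum_seq.
have s_gt0 x : 0 < s x.
  have [S uS /nbhs_singleton[S0 ->]] := locS x.
  have : (\bigcup_(V in D') V) x by rewrite D'T.
  move=> [W D'W Wx]; have [V DV WV] := D'D W D'W.
  pose V' : set_type D := exist _ V (mem_set DV).
  have fV : f V' x = 1.
    have [_ _ f1 _] := fP V'; apply: f1; exists W; first by split.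
    exact: subset_closure.
  have VS : V' \in S by apply: contraT => /S0; rewrite fV => /eqP; rewrite oner_eq0.
  rewrite (bigD1_seq V')//= fV; apply: ltr_wpDr => //; apply: sumr_ge0 => W' _.
  by have [_ /(_ x)/andP[]] := fP W'.
have cs : continuous s.
  move=> x; have [S uS HS] := locS x.
  have H : (fun y => \sum_(k <- S) f k y) @ x --> \sum_(k <- S) f k x.
    by apply: (@tcvg_sum R R^o) => // k _; have [+ _ _ _] := fP k; exact.
  rewrite /continuous_at (nbhs_singleton HS).2.
  by apply: (cvg_congr H); apply: filterS HS => y /= [_ <-].
exists (set_type D), (fun V x => f V x / s x); split; [split|].
- move=> V x; apply: cvgM; first by have [+ _ _ _] := fP V; exact.
  by apply: cvgV; [rewrite gt_eqF|exact: cs].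
- move=> V x; apply: divr_ge0; last exact/ltW.
  by have [_ /(_ x)/andP[]] := fP V.
- move=> x; have [S uS HS] := locS x; exists S => //.
  apply: filterS HS => y [S0 sE]; split; first by move=> k /S0 ->; rewrite mul0r.
  by rewrite -mulr_suml -sE divff// gt_eqF.
- move=> V; have [U CU VU] := DC _ (set_valP V); exists U => //.
  apply: subset_trans VU; apply: closure_subset => x /=; apply: contraNP => nVx.
  by have [_ _ _ ->] := fP V; rewrite ?mul0r.
Qed.

End Paracompact.

Lemma partition_support_nbhs (R : realType) (X : topologicalType) (I : choiceType) (h : I -> X -> R) (x : X) :
  is_partition_of_unity h ->
  exists2 S : seq I, uniq S & exists2 N : set X, nbhs x N &
    forall i, i \notin S -> forall y, N y -> ~ closure [set z | h i z != 0] y.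
Proof.
move=> [_ _ /(_ x)[S uS HS]]; exists S => //.
have : nbhs x [set y | (forall i, i \notin S -> h i y = 0) /\ \sum_(i <- S) h i y = 1] := HS.
rewrite {1}nbhsE => -[N [oN Nx] NS]; exists N; first exact: (open_nbhs_nbhs (conj oN Nx)).
move=> i iS y Ny cy; have [z [/= hz Nz]] := cy N (open_nbhs_nbhs (conj oN Ny)).
by have [S0 _] := NS z Nz; rewrite S0 ?eqxx in hz.
Qed.

(** * A continuous pseudometric on [X] inducing the topology of [Y] *)

Section PseudometricExtension.
Context {R : realType} (X : topologicalType) (Y : set X).
Hypotheses (hX : hausdorff_space X) (pX : paracompact X) (cY : closed Y).
Hypothesis mY : metrizable R Y.

Let n1 (n : nat) : R := n.+1%:R^-1.

Let n1_gt0 n : 0 < n1 n.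
Proof. by rewrite invr_gt0. Qed.

Let n1_small e : 0 < e -> exists n, n1 n < e.
Proof.
move=> e0; have [n ne] := ltr_add_invr (y := 0) (x := e) e0.
by exists n; move: ne; rewrite add0r.
Qed.

(** One scale of the pseudometric: the l^1-distance between the values of a partition of unity whose
    supports meet [Y] in sets of small radius. The values at a point sum to 1, so points with
    disjoint sets of nonzero values are at distance exactly 2; below 2, one member is nonzero at
    both points. *)
Let stage (dY : Y -> Y -> R) (n : nat) : defines_topology dY ->
  exists d : X -> X -> R, [/\ pseudometric d,
    forall x e, 0 < e -> \forall y \near x, d x y < e &
    forall y y' : Y, d (set_val y) (set_val y') < 2 -> dY y y' < 2 * n1 n].
Proof.
move=> [[d0 dE dC dT] dn].
pose C := [set U : set X | open U /\ exists y : Y, forall y', U (set_val y') -> dY y y' < n1 n]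
  `|` [set ~` Y].
have [||I [h [[ch h0 hS] hC]]] := @partition_of_unity R X hX pX C.
- by move=> U [[]//|->]; exact: closed_openC.
- apply/seteqP; split=> // x _; have [Yx|nY] := pselect (Y x); last by exists (~` Y) => //; right.
  pose y : Y := exist _ x (mem_set Yx).
  have : nbhs y [set y' | dY y y' < n1 n] by apply/dn; exists (n1 n).
  move=> [_ [[W oW <-] /= Wy] WU]; exists W => //; left; split => //.
  by exists y => y' Wy'; apply: WU.
pose d x y := \sum_(i \in [set: I]) `|h i x - h i y|.
have dS x y S : uniq S -> (forall i, i \notin S -> h i x = 0 /\ h i y = 0) ->
    d x y = \sum_(i <- S) `|h i x - h i y|.
  by move=> uS S0; apply: fsum_seq => // i /S0[-> ->]; rewrite subrr normr0.
have supp x : exists S : seq I, forall i, i \notin S -> h i x = 0.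
  by have [S uS /nbhs_singleton[S0 _]] := hS x; exists S.
exists d; split.
- split.
  + by move=> x; rewrite /d fsbig1// => i _; rewrite subrr normr0.
  + by move=> x y; rewrite /d; apply: eq_fsbigr => i _; rewrite distrC.
  + move=> x y z; have [S1 H1] := supp x; have [S2 H2] := supp y; have [S3 H3] := supp z.
    pose S := undup (S1 ++ S2 ++ S3).
    have nS i : i \notin S -> [/\ h i x = 0, h i y = 0 & h i z = 0].
      rewrite mem_undup !mem_cat !negb_or => /and3P[? ? ?].
      by split; [exact: H1|exact: H2|exact: H3].
    have uS : uniq S by exact: undup_uniq.
    rewrite (dS x z S)//; last by move=> i /nS[].
    rewrite (dS x y S)//; last by move=> i /nS[].
    rewrite (dS y z S)//; last by move=> i /nS[].
    rewrite -big_split; apply: ler_sum => i _ /=.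
    have -> : h i x - h i z = (h i x - h i y) + (h i y - h i z) by rewrite addrA subrK.
    exact: ler_normD.
- move=> x e e0; have [S uS HS] := hS x.
  have H : (fun y => \sum_(i <- S) `|h i x - h i y|) @ x --> \sum_(i <- S) `|h i x - h i x|.
    apply: (@tcvg_sum R R^o) => // i _; apply: cvg_norm; apply: cvgB; first exact: cvg_cst.
    exact: ch.
  rewrite big1 in H; last by move=> i _; rewrite subrr normr0.
  have /cvgrPdist_lt/(_ _ e0) H1 := H.
  apply: (filter_imp2 _ HS H1) => y [Sy _]; rewrite sub0r normrN => Hy.
  rewrite (dS x y S)//; first by apply: le_lt_trans Hy; exact: ler_norm.
  by move=> i iS; split; [exact: (nbhs_singleton HS).1|exact: Sy].
- move=> y y' dyy'.
  have [i [hy hy']] : exists i, h i (set_val y) != 0 /\ h i (set_val y') != 0.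
    apply: contrapT => nh; have {}nh i : h i (set_val y) = 0 \/ h i (set_val y') = 0.
      have [|hy] := eqVneq (h i (set_val y)) 0; first by left.
      have [|hy'] := eqVneq (h i (set_val y')) 0; first by right.
      by exfalso; apply: nh; exists i.
    have [S1 uS1 /nbhs_singleton[H1 E1]] := hS (set_val y).
    have [S2 uS2 /nbhs_singleton[H2 E2]] := hS (set_val y').
    have E1' : \sum_(i \in [set: I]) h i (set_val y) = 1 by rewrite (fsum_seq uS1).
    have E2' : \sum_(i \in [set: I]) h i (set_val y') = 1 by rewrite (fsum_seq uS2).
    pose S := undup (S1 ++ S2).
    have nS i : i \notin S -> h i (set_val y) = 0 /\ h i (set_val y') = 0.
      by rewrite mem_undup mem_cat negb_or => /andP[? ?]; split; [exact: H1|exact: H2].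
    have uS : uniq S by exact: undup_uniq.
    move: E1' E2' dyy'; rewrite (dS _ _ S)// !(fsum_seq uS); first last.
    + by move=> i /nS[].
    + by move=> i /nS[].
    move=> E1' E2'; rewrite (eq_bigr (fun i => h i (set_val y) + h i (set_val y'))).
      by rewrite big_split/= E1' E2' -[1 + 1]/2%:R ltxx.
    move=> i _; have [->|->] := nh i; rewrite ?sub0r ?subr0 ?normrN ger0_norm//.
    - by rewrite add0r.
    - by rewrite addr0.
  have [U [[oU [z Uz]]|->] hU] := hC i; last first.
    by exfalso; apply: (hU (set_val y)); [exact: subset_closure|exact: set_valP].
  have h1 := Uz y (hU _ (@subset_closure _ [set x | h i x != 0] _ hy)).
  have h2 := Uz y' (hU _ (@subset_closure _ [set x | h i x != 0] _ hy')).
  have := dT y z y'; rewrite (dC y z); move: h1 h2; lra.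
Qed.

(** The scales are glued as the supremum of the truncations of [dn n] at [n1 n]. Truncation makes
    all but finitely many scales uniformly small, which gives continuity, while a value of [d] below
    [n1 n] still bounds the scale [n] itself. *)
Lemma pseudometric_extension : exists d : X -> X -> R, [/\ pseudometric d,
    forall x e, 0 < e -> \forall y \near x, d x y < e &
    forall a V, Y a -> nbhs a V -> exists2 e, 0 < e & forall b, Y b -> d a b < e -> V b].
Proof.
have [dY dYP] := mY.
have [dn dnP] := choice (fun n => stage n dYP).
pose d x y := sup [set Num.min (dn n x y) (n1 n) | n in [set: nat]].
have dge0 n x y : 0 <= dn n x y by apply: pseudometric_ge0; have [] := dnP n.
have hs x y : has_sup [set Num.min (dn n x y) (n1 n) | n in [set: nat]].
  split; first by exists (Num.min (dn 0%N x y) (n1 0)); exists 0%N.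
  exists 1 => _ [n _ <-]; rewrite ge_min; apply/orP; right.
  by rewrite invf_le1// ler1n.
have dle x y c : (forall n, Num.min (dn n x y) (n1 n) <= c) -> d x y <= c.
  by move=> H; apply: ge_sup; [exact: (hs x y).1|move=> _ [n _ <-]].
have le_d x y n : Num.min (dn n x y) (n1 n) <= d x y.
  by apply: ub_le_sup; [exact: (hs x y).2|exists n].
exists d; split.
- split.
  + move=> x; apply/eqP; rewrite eq_le; apply/andP; split.
      apply: dle => n; rewrite ge_min; have [[-> _ _] _ _] := dnP n; by rewrite lexx.
    apply: le_trans (le_d x x 0%N); by rewrite le_min dge0 ltW.
  + move=> x y; congr sup; apply: eq_imagel => n _.
    by have [[_ -> _] _ _] := dnP n.
  + move=> x y z; apply: dle => n; have [[_ _ dT] _ _] := dnP n.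
    apply: le_trans (lerD (le_d x y n) (le_d y z n)).
    have := dT x y z; have := dge0 n x y; have := dge0 n y z; have := n1_gt0 n.
    case: (leP (dn n x y) (n1 n)) => a1; case: (leP (dn n y z) (n1 n)) => a2;
      rewrite ge_min; move=> ? ? ? ?; apply/orP; [left|right|right|right]; lra.
- move=> x e e0; have e20 : 0 < e / 2 by rewrite divr_gt0.
  have [N Ne] := n1_small e20.
  have nS : \forall y \near x, forall n, n \in iota 0 N -> dn n x y < e / 2.
    by apply: near_seq => n _; have [_ dc _] := dnP n; exact: dc.
  apply: filterS nS => y Hy; apply: (@le_lt_trans _ _ (e / 2)); last first.
    by rewrite ltr_pdivrMr// ltr_pMr// ltr1n.
  apply: dle => n; rewrite ge_min; have [nN|Nn] := ltnP n N.
    by rewrite ltW// Hy// mem_iota.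
  apply/orP; right; apply: ltW; apply: le_lt_trans Ne.
  by rewrite lef_pV2 ?posrE// ler_nat.
- move=> a V Ya Va; pose y : Y := exist _ a (mem_set Ya).
  have : nbhs y (set_val @^-1` V) by apply: (@initial_continuous _ _ (set_val : Y -> X) y).
  move=> /(proj2 dYP)[e e0 He].
  have e20 : 0 < e / 2 by rewrite divr_gt0.
  have [n ne] := n1_small e20.
  exists (n1 n) => // b Yb dab; pose z : Y := exist _ b (mem_set Yb).
  apply: (He z); rewrite /=.
  have [_ _ H] := dnP n.
  have : dn n a b < 2.
    have := le_lt_trans (le_d a b n) dab; rewrite gt_min ltxx orbF => h.
    apply: lt_le_trans h _; apply: (@le_trans _ _ 1); last by rewrite ler1n.
    by rewrite invf_le1// ler1n.
  move=> /(H y z) h; apply: lt_trans h _.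
  by rewrite mulrC -ltr_pdivlMr.
Qed.

End PseudometricExtension.

(** * Extension of sections *)

Local Notation total := Defs.total.
Local Notation proj := Defs.proj.

Lemma initial_cvg (S : choiceType) (T : topologicalType) (f : S -> T) (Z : Type)
    (D : set_system Z) {FD : Filter D} (s : Z -> S) (s0 : S) :
  (f \o s) @ D --> f s0 -> (s : Z -> initial_topology f) @ D --> (s0 : initial_topology f).
Proof.
move=> H A [_ [] [P oP <-] /= Ps] /filterS; apply.
exact: (H _ (open_nbhs_nbhs (conj oP Ps))).
Qed.

Section Bundles.
Context {R : realType} {X : topologicalType} (E : vfamily R X).

Lemma within_open_cvg (S T : topologicalType) (A : set S) (f : S -> T) (Z : Type)
    (D : set_system Z) (s : Z -> S) (s0 : S) :
  open A -> {within A, continuous f} -> A s0 -> s @ D --> s0 -> (f \o s) @ D --> f s0.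
Proof.
move=> oA; rewrite continuous_open_subspace// => cf As0 ss.
by apply: (cvg_comp _ _ ss); apply: cf; rewrite inE.
Qed.

Lemma tot_cvg (U : set X) (F : tvsType R) (h : forall x, fib E x -> F)
    (g : forall x, F -> fib E x) (Z : Type) (D : set_system Z) {FD : Filter D}
    (xs : Z -> X) (e : forall z, fib E (xs z)) (x0 : X) (e0 : fib E x0) :
  continuous (@proj R X E) -> open U -> U x0 -> trivialization U h g ->
  ((fun z => tot (e z)) @ D --> (tot e0 : total E)) <->
  (xs @ D --> x0 /\ (fun z => h _ (e z)) @ D --> h x0 e0).
Proof.
move=> cp oU Ux0 [hg ch cg]; split=> [te|[xx he]].
  split; first exact: (cvg_comp _ _ te (cp (tot e0))).
  have oV : open (@proj R X E @^-1` U) by apply: open_comp => // p _; exact: cp.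
  exact: (within_open_cvg oV ch _ te).
have oV : open (U `*` [set: F]).
  rewrite openE => -[x v] [/= Ux _]; exists (U, setT) => //=.
  by split; [exact: open_nbhs_nbhs|exact: filterT].
have c1 : (fun z => (xs z, h _ (e z))) @ D --> (x0, h x0 e0) by exact: cvg_pair.
have H : (fun z => tot (g (xs z) (h _ (e z)))) @ D --> (tot e0 : total E).
  have := within_open_cvg oV cg (conj Ux0 I : (U `*` [set: F]) (x0, h x0 e0)) c1.
  by have [_ hK _] := hg _ Ux0; rewrite /= hK.
apply: (cvg_congr H).
have nU : D [set z | U (xs z)] by exact: (xx _ (open_nbhs_nbhs (conj oU Ux0))).
by apply: filterS nU => z Uz /=; have [_ -> _] := hg _ Uz.
Qed.

(** Compactness turns joint convergence near each point of [K], with the point kept in [K], into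
    convergence that is uniform on [K]. *)
Lemma section_cvg (Z : Type) (D : set_system Z) {FD : Filter D} (s : Z -> section E) (s0 : section E) :
  (forall K x0, compact K -> K x0 ->
    (fun p : Z * X => tot (s p.1 p.2)) @ (filter_prod D (within K (nbhs x0)))
      --> (tot (s0 x0) : total E)) ->
  s @ D --> s0.
Proof.
move=> H; apply: initial_cvg; apply/compact_open_cvgP => K W cK oW KW.
have cov : near_covering_within K.
  by apply/near_covering_withinP/compact_near_coveringP.
have /= := cov Z D (fun z x => W (tot (s z x))) FD _.
have Hc x : K x -> \forall x' \near x & z \near D, K x' -> W (tot (s z x')).
  move=> Kx; have Wx : W (tot (s0 x)) by apply: KW; exists x.
  have [[P Q] [/= DP WQ] PQ] := H K x cK Kx _ (open_nbhs_nbhs (conj oW Wx)).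
  exists ([set x' | K x' -> Q x'], P) => //= -[x' z] [/= Kx' Pz] Kx''.
  by apply: (PQ (z, x')); split => //; exact: Kx'.
move=> /(_ Hc) Dz; apply: (filter_imp FD Dz) => z zK _ [x Kx <-].
exact: zK.
Qed.

(** Converse to [section_cvg]. Regularity gives a closed neighbourhood of [x0] on which [s0] stays
    in [W]; its intersection with [K] is a compact set to which the compact-open topology
    applies. *)
Lemma section_eval (K : set X) (x0 : X) (s0 : section E) :
  hausdorff_space X -> paracompact X -> compact K -> K x0 ->
  (fun p : section E * X => tot (p.1 p.2)) @
    (filter_prod (nbhs s0) (within K (nbhs x0))) --> (tot (s0 x0) : total E).
Proof.
move=> hX pX cK Kx0 V; rewrite {1}nbhsE => -[W [oW Wx] WV].
pose U : set X := [set x | W (tot (s0 x))].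
have oU : open U by apply: open_comp => // x _; exact: sec_continuous.
have [B [oB Bx BU]] := paracompact_regular hX pX oU Wx.
have cC : compact (K `&` closure B) by apply: compact_closedI => //; exact: closed_closure.
pose O1 := [set s : section E | (section_map s) @` (K `&` closure B) `<=` W].
have oO1 : open O1.
  by exists [set g : {compact-open, X -> total E} | g @` (K `&` closure B) `<=` W] => //;
    exact: compact_open_open.
exists (O1, [set x | K x /\ B x]).
  split => /=; last by apply: (filterS _ (open_nbhs_nbhs (conj oB Bx))) => x Bx' Kx.
  by apply: open_nbhs_nbhs; split => // _ [x [_ /BU Ux] <-].
move=> [s x] [/= sW [Kx Bx']]; apply: WV; apply: sW; exists x => //; split => //.
exact: subset_closure.
Qed.

Lemma section_cvg_point (x : X) (s0 : section E) :
  (fun s : section E => tot (s x)) @ s0 --> (tot (s0 x) : total E).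
Proof.
move=> V; rewrite {1}nbhsE => -[W [oW Wx] WV].
pose O1 := [set s : section E | (section_map s) @` [set x] `<=` W].
have oO1 : open O1.
  exists [set g : {compact-open, X -> total E} | g @` [set x] `<=` W] => //.
  by apply: compact_open_open => //; exact: compact_set1.
have : nbhs s0 O1 by apply: open_nbhs_nbhs; split => // _ [_ -> <-].
by apply: filterS => s sW; apply: WV; apply: sW; exists x.
Qed.

Lemma filter_prod_snd (Z : Type) (D : set_system Z) {FD : Filter D} (K : set X) (x0 : X) :
  (fun p : Z * X => p.2) @ (filter_prod D (within K (nbhs x0))) --> x0.
Proof.
move=> V nV; exists (setT, V); last by move=> [z x] [].
by split => /=; [exact: filterT|apply: filterS nV => x Vx _].
Qed.

End Bundles.

Lemma filter_prod_fst (Z X : Type) (D : set_system Z) (G : set_system X) (T : nbhsType)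
    (f : Z -> T) (l : set_system T) : Filter G ->
  f @ D --> l -> (fun p : Z * X => f p.1) @ (filter_prod D G) --> l.
Proof.
move=> FG fl V nV; exists ([set z | V (f z)], setT); last by move=> [z x] [].
by split => /=; [exact: (fl _ nV)|exact: filterT].
Qed.

(** * Extension operators for sections of a bundle *)

Section Extension.
Context {R : realType} {X : topologicalType} (Y : set X) (E : vfamily R X).
Hypotheses (hX : hausdorff_space X) (pX : paracompact X).
Hypothesis cproj : continuous (@proj R X E).

(** The condition [Aclosed] of the Dugundji operator. It holds for compact sets, and for closed sets
    if [d] is a metric defining the topology. *)
Definition zero_closed (d : X -> X -> R) (A : set X) : Prop :=
  forall x, (forall e, 0 < e -> exists2 a, A a & d x a < e) -> exists2 a, A a & d x a = 0.

Context (d : X -> X -> R).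
Hypothesis dd : pseudometric d.
Hypothesis dcont : forall x e, 0 < e -> \forall y \near x, d x y < e.
Hypothesis dcompat : forall a V, Y a -> nbhs a V ->
  exists2 e, 0 < e & forall b, Y b -> d a b < e -> V b.

Context (C : set (set X)).
Hypotheses (oC : C `<=` open) (CT : \bigcup_(U in C) U = setT).
Hypothesis Ctriv : forall U, C U -> exists F : tvsType R, hausdorff_space F /\
  exists h g, @trivialization R X E U F h g.
Hypothesis Czero : forall U A, C U -> closed A -> A `<=` U -> zero_closed d (Y `&` A).

(* [Ext s x = \sum_i h_i(x) g_i x (D_i (k_i s) x)] for a partition of unity [h],
   trivializations [(k_i, g_i)] and the Dugundji operators [D_i] of [Y `&` supp h_i]. *)
Lemma bundle_extension : exists Ext : (forall y : Y, fib E (set_val y)) -> forall x, fib E x,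
  [/\ forall (a : R) s t u, (forall y, u y = a *: s y + t y) ->
        forall x, Ext u x = a *: Ext s x + Ext t x,
      forall s y, Ext s (set_val y) = s y,
      forall (K : set X) (Z : Type) (D : set_system Z)
        (s : Z -> forall y : Y, fib E (set_val y)) s0, Filter D ->
        (forall (C : set X) (y0 : Y), C `<=` Y -> (compact K -> compact C) -> C (set_val y0) ->
          (fun p : Z * Y => tot (s p.1 p.2)) @ (filter_prod D (within (set_val @^-1` C) (nbhs y0)))
            --> (tot (s0 y0) : total E)) ->
        forall x0, K x0 -> (fun p : Z * X => tot (Ext (s p.1) p.2)) @
          (filter_prod D (within K (nbhs x0))) --> (tot (Ext s0 x0) : total E) &
      exists (I : choiceType) (A : I -> set X),
        [/\ forall i, exists2 U, C U & A i `<=` U, forall i, closed (A i),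
            forall x : X, exists2 S : seq I, uniq S & exists2 N, nbhs x N &
              forall i, i \notin S -> forall y, N y -> ~ A i y &
            forall s x, Ext s x != 0 -> exists i, A i x /\
              exists y : Y, A i (set_val y) /\ s y != 0]].
Proof.
have [I [h [hP hC]]] := @partition_of_unity R X hX pX C oC CT.
have [ch h_ge0 hS] := hP.
pose A i := closure [set x | h i x != 0].
have cA i : closed (A i) by exact: closed_closure.
have data i : exists Q : {F : tvsType R & ((forall x, fib E x -> F) * (forall x, F -> fib E x) *
     (forall F : tvsType R, (X -> F) -> X -> F))%type},
  [/\ exists U, [/\ open U, A i `<=` U & trivialization U (projT2 Q).1.1 (projT2 Q).1.2],
   [/\ forall (F : tvsType R) a f g x, (projT2 Q).2 F (fun y => a *: f y + g y) x =
          a *: (projT2 Q).2 F f x + (projT2 Q).2 F g x,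
      forall (F : tvsType R) f a, (Y `&` A i) a -> (projT2 Q).2 F f a = f a &
      forall (F : tvsType R) f, (forall a, (Y `&` A i) a -> f a = 0) -> forall x, (projT2 Q).2 F f x = 0] &
      forall K : set X, exists C : set X,
        [/\ C `<=` Y `&` A i, compact K -> compact C &
            forall (F : tvsType R) (Z : Type) (G : set_system Z) (f : Z -> X -> F) (f0 : X -> F),
              Filter G ->
              (forall a0, C a0 -> (fun p : Z * X => f p.1 p.2 : F) @
                 (filter_prod G (within C (nbhs a0))) --> f0 a0) ->
              forall x0, K x0 -> (fun p : Z * X => (projT2 Q).2 F (f p.1) p.2 : F) @
                 (filter_prod G (within K (nbhs x0))) --> (projT2 Q).2 F f0 x0]].
  have [U CU AU] := hC i; have [F [hF [th [tg tt]]]] := Ctriv CU.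
  have [|||D [D1 D2 D3 D4]] := @dugundji R X d dd dcont (Y `&` A i).
  - exact: (Czero CU).
  - move=> a b [Ya _] [Yb _] ab; apply: hX => P Q nP nQ.
    have [e e0 He] := dcompat Ya nP; exists b; split; last exact: nbhs_singleton.
    by apply: He => //; rewrite ab.
  - move=> a V [Ya _] nV; have [e e0 He] := dcompat Ya nV.
    by exists e => // b [Yb _]; exact: He.
  exists (existT _ F (th, tg, D)); split => //.
  by exists U; split => //; exact: oC.
have [Q QP] := choice data.
pose F i := projT1 (Q i).
pose th i : forall x, fib E x -> F i := (projT2 (Q i)).1.1.
pose tg i : forall x, F i -> fib E x := (projT2 (Q i)).1.2.
pose D i : forall F : tvsType R, (X -> F) -> X -> F := (projT2 (Q i)).2.
(* The operator takes functions on [X], while [s] lives on [Y]. The default 0 is harmless, since the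
   operator only sees values at points of [Y] in [A i]. *)
pose loc i (s : forall y : Y, fib E (set_val y)) (x : X) : F i :=
  if pselect ((Y `&` A i) x) is left Yx then th i x (s (exist _ x (mem_set Yx.1))) else 0.
have locE i s (y : Y) : A i (set_val y) -> loc i s (set_val y) = th i _ (s y).
  move=> Ay; rewrite /loc; case: pselect => [Yy|]; last first.
    by move=> nY; case: nY; split => //; exact: set_valP.
  case: y Ay Yy => x xY Ay Yy; rewrite /set_val/=.
  by rewrite (Prop_irrelevance (mem_set Yy.1) xY).
pose term i s x : fib E x := h i x *: tg i x (D i (F i) (loc i s) x).
pose Ext s x : fib E x := \sum_(i \in [set: I]) term i s x.
have h0 i x : ~ A i x -> h i x = 0.
  by move=> nA; apply/eqP; apply: contra_notT nA => hx; exact: subset_closure.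
have ExtE (x : X) : exists2 S : seq I, uniq S & \forall y \near x, 
    [/\ forall i, i \notin S -> h i y = 0, \sum_(i <- S) h i y = 1 &
     forall s, Ext s y = \sum_(i <- S) term i s y].
  have [S uS HS] := hS x; exists S => //; apply: filterS HS => y [S0 S1]; split => // s.
  by apply: fsum_seq => // i /S0 hi; rewrite /term hi scale0r.
have tlin i x : A i x -> [/\ linear (th i x), linear (tg i x), cancel (th i x) (tg i x) & cancel (tg i x) (th i x)].
  move=> Ax; have [[U [_ AU [tt _ _]]] _ _] := QP i.
  have [lh hK gK] := tt x (AU _ Ax); split => // a u v; apply: (can_inj hK).
  by rewrite gK lh !gK.
exists Ext; split.
- move=> a s t u ust x; have [S uS /nbhs_singleton[S0 S1 SE]] := ExtE x.
  rewrite !SE scaler_sumr -big_split/=; apply: eq_bigr => i _.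
  rewrite /term; have [Ax|/h0->] := pselect (A i x); last by rewrite !scale0r scaler0 addr0.
  have [lh lg _ _] := tlin i x Ax; rewrite scalerA mulrC -scalerA -scalerDr; congr (_ *: _).
  rewrite -lg; congr (tg i x _); have [_ [D1 _ _] _] := QP i; rewrite -D1; congr (D i (F i) _ x).
  apply/funext => y; rewrite /loc; case: pselect => [Yy|_]; last by rewrite scaler0 addr0.
  by have [lhy _ _ _] := tlin i y Yy.2; rewrite ust lhy.
- move=> s y; have [S uS /nbhs_singleton[S0 S1 ->]] := ExtE (set_val y).
  rewrite (eq_bigr (fun i => h i (set_val y) *: s y)); first by rewrite -scaler_suml S1 scale1r.
  move=> i _; rewrite /term; have [Ay|/h0->] := pselect (A i (set_val y)); last by rewrite !scale0r.
  have [_ [_ D2 _] _] := QP i; have [_ _ hK _] := tlin i _ Ay.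
  by congr (_ *: _); rewrite /D D2; [rewrite locE// hK|split => //; exact: set_valP].
- move=> K Z G s s0 FG sC x0 Kx0.
  have : (\bigcup_(U in C) U) x0 by rewrite CT.
  move=> [U0 CU0 U0x]; have [F0 [hF0 [h1 [g1 t1]]]] := Ctriv CU0.
  have FGK : Filter (filter_prod G (within K (nbhs x0))) by exact: filter_prod_filter.
  have oU0 := oC CU0; have c2 := @filter_prod_snd X Z G FG K x0.
  have [S uS HS] := ExtE x0; have [_ _ S0E] := nbhs_singleton HS.
  have HU : (filter_prod G (within K (nbhs x0))) [set p | U0 p.2].
    exact: (c2 _ (open_nbhs_nbhs (conj oU0 U0x))).
  have lin1 x : U0 x -> linear (h1 x) by have [t11 _ _] := t1; move=> /t11[].
  have lin1D x : U0 x -> forall I (S : seq I) f, h1 x (\sum_(i <- S) f i) = \sum_(i <- S) h1 x (f i).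
    move=> /lin1 l; pose L : {linear fib E x -> F0} := HB.pack (h1 x) (GRing.isLinear.Build _ _ _ _ _ l).
    by move=> I' S' f; rewrite -[h1 x]/(L : _ -> _) linear_sum.
  have lin10 x : U0 x -> h1 x 0 = 0.
    by move=> Ux; have := lin1D x Ux void [::] (fun _ => 0); rewrite !big_nil.
  have Hterm i : (fun p : Z * X => h1 _ (term i (s p.1) p.2)) @
      (filter_prod G (within K (nbhs x0))) --> h1 x0 (term i s0 x0).
    have [Ax|nA] := pselect (A i x0); last first.
      rewrite /term h0// scale0r lin10//.
      have nN : nbhs x0 (~` A i) by apply: open_nbhs_nbhs; split => //; exact: closed_openC.
      have HN := c2 _ nN.
      apply: (cvg_congr (@cvg_cst _ 0 _ _ FGK)).
      by apply: (filter_imp2 _ HU HN) => p /= Up nAp; rewrite h0// scale0r lin10.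
    have [[U [oU AU tt]] _ D4] := QP i; have Ux := AU _ Ax.
    have [Ci [CiA Cic D5]] := D4 K.
    (* Each term converges in its own trivialization; [tot_cvg] carries this to the common one
       around [x0], in which the terms can be added. *)
    suff : (fun p : Z * X => tot (term i (s p.1) p.2)) @ (filter_prod G (within K (nbhs x0)))
        --> (tot (term i s0 x0) : total E).
      by move=> /(tot_cvg _ _ cproj oU0 U0x t1)[].
    apply/(tot_cvg _ _ cproj oU Ux tt); split => //.
    have [tt1 _ _] := tt.
    have thE x s' : U x -> th i x (term i s' x) = h i x *: D i (F i) (loc i s') x.
      move=> /tt1[l hK gK]; have lg : linear (tg i x).
        by move=> a u v; apply: (can_inj hK); rewrite gK l !gK.
      pose L : {linear fib E x -> F i} := HB.pack (th i x) (GRing.isLinear.Build _ _ _ _ _ l).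
      by rewrite /term -[th i x]/(L : _ -> _) linearZ/=; congr (_ *: _); exact: gK.
    rewrite -/(th i) thE//.
    have HU' : (filter_prod G (within K (nbhs x0))) [set p | U p.2].
      exact: (c2 _ (open_nbhs_nbhs (conj oU Ux))).
    have H : (fun p : Z * X => h i p.2 *: D i (F i) (loc i (s p.1)) p.2) @
       (filter_prod G (within K (nbhs x0))) --> h i x0 *: D i (F i) (loc i s0) x0.
      apply: tcvgZ; first exact: (cvg_comp _ _ c2 (ch i x0)).
      apply: (D5 (F i) Z G (fun z => loc i (s z))) => // a0 Ca0.
      have [Ya Aa] := CiA _ Ca0; pose y0 : Y := exist _ a0 (mem_set Ya).
      have CY : Ci `<=` Y by move=> c /CiA[].
      have /(tot_cvg _ _ cproj oU (AU _ Aa) tt)[_ H1] := sC Ci y0 CY Cic Ca0.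
      rewrite -[a0]/(set_val y0) locE//.
      move=> V /H1[[P W] [/= GP nW] PW].
      have [_ [[N oN <-] /= Ny] NW] := nW.
      exists (P, [set x | Ci x /\ N x]).
        split => //=; have : nbhs a0 N by apply: open_nbhs_nbhs.
        by apply: filterS => x Nx Cx.
      move=> [z x] [/= Pz [Cx Nx]]; have [Yx Axx] := CiA _ Cx.
      pose y : Y := exist _ x (mem_set Yx).
      rewrite -[x]/(set_val y) locE//; apply: (PW (z, y)); split => //=.
      exact: (NW y).
    by apply: (cvg_congr H); apply: (filter_imp FGK HU') => p /= Up; rewrite -/(th i) thE.
  apply/(tot_cvg _ _ cproj oU0 U0x t1); split => //.
  rewrite S0E lin1D//.
  have H : (fun p : Z * X => \sum_(i <- S) h1 _ (term i (s p.1) p.2)) @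
      (filter_prod G (within K (nbhs x0))) --> \sum_(i <- S) h1 x0 (term i s0 x0).
    by apply: tcvg_sum => i _; exact: Hterm.
  have HS' := c2 _ HS.
  by apply: (cvg_congr H); apply: (filter_imp2 FGK HU HS') => p /= Up [_ _ ->]; rewrite lin1D.
exists I, A; split => //.
- move=> x; exact: (@partition_support_nbhs R X I h x hP).
- move=> s x Ex; have [S uS /nbhs_singleton[_ _ SE]] := ExtE x.
  have [i ti] : exists i, term i s x != 0.
    apply: contrapT => nt; move/negP: Ex; apply; rewrite SE big1// => i _.
    by apply/eqP; apply: contrapT => /negP ti; apply: nt; exists i.
  have Ax : A i x by apply: contrapT => /h0 hi; move: ti; rewrite /term hi scale0r eqxx.
  exists i; split => //; apply: contrapT => ny; move/negP: ti; apply; apply/eqP.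
  have [_ [_ _ D3] _] := QP i; rewrite /term /D D3.
    have [_ lg _ _] := tlin i x Ax.
    pose L : {linear F i -> fib E x} := HB.pack (tg i x) (GRing.isLinear.Build _ _ _ _ _ lg).
    by rewrite -[tg i x]/(L : _ -> _) linear0 scaler0.
  move=> a [Ya Aa]; pose y : Y := exist _ a (mem_set Ya).
  rewrite -[a]/(set_val y) locE//.
  have -> : s y = 0 by apply/eqP; apply: contrapT => /negP sy; apply: ny; exists y.
  have [lh _ _ _] := tlin i _ Aa.
  pose L : {linear fib E a -> F i} := HB.pack (th i a) (GRing.isLinear.Build _ _ _ _ _ lh).
  by rewrite -[th i (set_val y)]/(L : _ -> _) linear0.
Qed.

End Extension.

Lemma within_setT (T : Type) (F : set_system T) (A : set T) : Filter F ->
  within [set: T] F A -> F A.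
Proof. by move=> FF FA; apply: (filter_imp FF FA) => x; apply. Qed.

Section Pullback.
Context {R : realType} {X' X : topologicalType} (g : X' -> X) (E : vfamily R X).

Lemma pullback_cvg (Z : Type) (D : set_system Z) {FD : Filter D} (xs : Z -> X')
    (e : forall z, fib E (g (xs z))) (x0 : X') (e0 : fib E (g x0)) :
  ((fun z => @tot R X' (pullback g E) (xs z) (e z)) @ D -->
     (@tot R X' (pullback g E) x0 e0 : total (pullback g E))) <->
  (xs @ D --> x0 /\ (fun z => tot (e z)) @ D --> (tot e0 : total E)).
Proof.
split=> [H|[xx ee]]; last first.
  apply: initial_cvg; exact: (cvg_pair xx ee).
have H1 := cvg_comp _ _ H (@initial_continuous _ _ (@pullback_map R X' X g E) _).
split; first exact: (cvg_comp _ _ H1 cvg_fst).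
exact: (cvg_comp _ _ H1 cvg_snd).
Qed.

Lemma pullback_proj_continuous : continuous (@proj R X' (pullback g E)).
Proof.
move=> [x e]; have := @initial_continuous _ _ (@pullback_map R X' X g E) (existT _ x e).
by move=> H; exact: (cvg_comp _ _ H cvg_fst).
Qed.

End Pullback.

Section Subtype.
Context {X : topologicalType} (Y : set X).

Lemma subtype_hausdorff : hausdorff_space X -> hausdorff_space (set_type Y).
Proof.
move=> hX p q pq; apply: val_inj; apply: hX => A B nA nB.
have [||z [Az Bz]] := pq (set_val @^-1` A) (set_val @^-1` B).
- exact: (@initial_continuous _ _ (set_val : Y -> X) p).
- exact: (@initial_continuous _ _ (set_val : Y -> X) q).
by exists (set_val z).
Qed.

Lemma compact_subtype (C : set X) : C `<=` Y -> compact C -> compact (set_val @^-1` C : set Y).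
Proof.
move=> CY cC F PF FC.
have [c [Cc clc]] := cC (set_val @ F) (fmap_proper_filter _ _) FC.
pose y : Y := exist _ c (mem_set (CY _ Cc)).
exists y; split => // A N FA [_ [[W oW <-] /= Wy] WN].
have FA' : F [set z | (set_val @` A) (set_val z)].
  by apply: (filter_imp _ FA) => z Az; exists z.
have [_ [[z Az <-] Wz]] := clc _ _ FA' (open_nbhs_nbhs (conj oW Wy)).
by exists z; split => //; exact: WN.
Qed.

Lemma compact_set_val (C : set Y) : compact C -> compact (set_val @` C).
Proof.
move=> cC; apply: continuous_compact => //; apply: continuous_subspaceT.
exact: initial_continuous.
Qed.

Lemma closed_paracompact : closed Y -> paracompact X -> paracompact (set_type Y).
Proof.
move=> cY pX C oC CT.
pose C' := [set W : set X | open W /\ C (set_val @^-1` W)] `|` [set ~` Y].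
have [||D [oD DT DC Df]] := pX C'.
- by move=> W [[]//|->]; exact: closed_openC.
- apply/seteqP; split=> // x _; have [Yx|nY] := pselect (Y x); last by exists (~` Y) => //; right.
  pose y : Y := exist _ x (mem_set Yx).
  have : (\bigcup_(U in C) U) y by rewrite CT.
  move=> [U CU Uy]; have [W oW WU] := oC U CU; exists W; first by left; split => //; rewrite WU.
  by move: Uy; rewrite -WU.
exists [set (set_val @^-1` V : set Y) | V in [set V | D V /\ V `&` Y !=set0]]; split.
- by move=> _ [V [DV _] <-]; exists V => //; exact: oD.
- apply/seteqP; split=> // y _; have : (\bigcup_(V in D) V) (set_val y) by rewrite DT.
  move=> [V DV Vy]; exists (set_val @^-1` V) => //; exists V => //; split => //.
  by exists (set_val y); split => //; exact: set_valP.
- move=> _ [V [DV [z [Vz Yz]]] <-]; have [W [[oW CW]|->] VW] := DC V DV; last first.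
    by case: (VW _ Vz).
  by exists (set_val @^-1` W) => // y /VW.
- move=> y; have [N nN fN] := Df (set_val y).
  exists (set_val @^-1` N); first exact: (@initial_continuous _ _ (set_val : Y -> X) y).
  apply: sub_finite_set (finite_image (fun V => set_val @^-1` V : set Y) fN).
  move=> _ [[V [DV _] <-] [z [Vz Nz]]]; exists V => //; split => //.
  by exists (set_val z).
Qed.

Lemma closed_locally_compact : closed Y -> hausdorff_space X ->
  locally_compact [set: X] -> locally_compact [set: set_type Y].
Proof.
move=> cY hX lX y _; have [B nB [cB clB]] := lX (set_val y) I.
have nB' : nbhs (set_val y) B by apply: within_setT nB.
exists (set_val @^-1` B).
  have nB2 : nbhs y (set_val @^-1` B) by exact: (@initial_continuous _ _ (set_val : Y -> X) y _ nB').
  by apply: (filter_imp _ nB2).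
have -> : set_val @^-1` B = set_val @^-1` (B `&` Y) :> set Y.
  by apply/seteqP; split => z //= Bz; [split => //; exact: set_valP|case: Bz].
split.
  apply: compact_subtype; first exact: subIsetr.
  exact: compact_closedI.
apply: compact_closed; first exact: subtype_hausdorff.
apply: compact_subtype; first exact: subIsetr.
exact: compact_closedI.
Qed.

End Subtype.

Section SectionExtension.
Context {R : realType} {X : topologicalType} (Y : set X) (E : vfamily R X).

Lemma trivialization_sub (U V : set X) (F : tvsType R) (h : forall x, fib E x -> F)
    (g : forall x, F -> fib E x) : V `<=` U -> trivialization U h g -> trivialization V h g.
Proof.
move=> VU [t1 t2 t3]; split; first by move=> x /VU; exact: t1.
- by apply: continuous_subspaceW t2 => e /VU.
- by apply: continuous_subspaceW t3 => p [/VU].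
Qed.

(** The sets of points of [K] at distance less than [e] from [x] form a filter base; any cluster
    point in [K] is at distance 0. *)
Lemma zero_closed_compact (d : X -> X -> R) (K : set X) : pseudometric d ->
  (forall x e, 0 < e -> \forall y \near x, d x y < e) -> compact K -> zero_closed d K.
Proof.
move=> dd dcont cK x xK; have [d0 dC dT] := dd.
pose F := filter_from [set e : R | 0 < e] (fun e => K `&` [set a | d x a < e]).
have PF : ProperFilter F.
  apply: filter_from_proper; last by move=> e e0; have [a Ka xa] := xK e e0; exists a.
  apply: filter_from_filter; first by exists 1; rewrite /= ltr01.
  move=> e1 e2 e10 e20; exists (Num.min e1 e2); first by rewrite /= lt_min e10.
  by move=> a [Ka]; rewrite /= lt_min => /andP[? ?].
have FK : F K by exists 1; [exact: ltr01|move=> a []].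
have [a [Ka cla]] := cK F PF FK; exists a => //.
apply/eqP; rewrite eq_le (pseudometric_ge0 _ _ dd) andbT; apply/ler_addgt0Pr => e e0.
have e20 : 0 < e / 2 by rewrite divr_gt0.
have Fe : F [set b | d x b < e / 2] by exists (e / 2) => // b [].
have [b [/= xb ab]] := cla _ _ Fe (dcont a _ e20).
have := dT x b a; rewrite (dC b) add0r; move: xb ab; lra.
Qed.

(** A single function is a family indexed by [unit]; in this form its continuity is an instance of
    joint convergence. *)
Lemma filter_prod_globally_cvg (S T : topologicalType) (f : S -> T) (x0 : S) :
  (fun p : unit * S => f p.2) @ (filter_prod (globally [set: unit]) (within [set: S] (nbhs x0)))
    --> f x0 <-> {for x0, continuous f}.
Proof.
split=> [H V /H[[P Q] [/= GP WQ] PQ]|cf V /cf nV].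
  have WQ' : nbhs x0 Q by apply: within_setT WQ.
  by apply: filterS WQ' => x Qx; apply: (PQ (tt, x)); split => //; exact: GP.
exists (setT, [set x | V (f x)]); last by move=> [z x] [].
split => //=; have {}nV : nbhs x0 [set x | V (f x)] by exact: nV.
by apply: filterS nV.
Qed.

Hypotheses (hX : hausdorff_space X) (pX : paracompact X) (cY : closed Y).
Hypothesis bE : is_vector_bundle E.

Lemma extension_sections (d : X -> X -> R) (C : set (set X)) : pseudometric d ->
  (forall x e, 0 < e -> \forall y \near x, d x y < e) ->
  (forall a V, Y a -> nbhs a V ->
    exists2 e, 0 < e & forall b, Y b -> d a b < e -> V b) ->
  C `<=` open -> \bigcup_(U in C) U = setT ->
  (forall U, C U -> exists F : tvsType R, hausdorff_space F /\
    exists h g, @trivialization R X E U F h g) ->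
  (forall U A, C U -> closed A -> A `<=` U -> zero_closed d (Y `&` A)) ->
  exists ext : section (restrict_bundle Y E) -> section E,
    [/\ continuous ext,
        forall (a : R) (s t u : section (restrict_bundle Y E)),
          (forall y, u y = a *: s y + t y) ->
          forall x, ext u x = a *: ext s x + ext t x,
        forall (s : section (restrict_bundle Y E)) (y : Y),
          ext s (set_val y) = s y &
      exists (I : choiceType) (A : I -> set X),
        [/\ forall i, exists2 U, C U & A i `<=` U, forall i, closed (A i),
            forall x : X, exists2 S : seq I, uniq S & exists2 N, nbhs x N &
              forall i, i \notin S -> forall y, N y -> ~ A i y &
            forall s x, ext s x != 0 -> exists i, A i x /\
              exists y : Y, A i (set_val y) /\ s y != 0]].
Proof.
move=> dd dcont dcompat oC CT Ctriv Czero; have [_ cproj _] := bE.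
have [Ext [e1 e2 e3 e4]] := bundle_extension hX pX cproj dd dcont dcompat oC CT Ctriv Czero.
have cExt (s : section (restrict_bundle Y E)) : continuous (fun x => tot (Ext s x)).
  move=> x0; apply/(@filter_prod_globally_cvg X (total E)).
  have FU : Filter (globally [set: unit]) by exact: globally_filter.
  (* Continuity of one extended section is the clause on families for a constant family and the
     whole space in place of [K]. *)
  apply: (e3 setT unit _ (fun=> s)) => // C0 y0 _ _ Cy0.
  have /(@pullback_cvg R Y X set_val E Y (nbhs y0) _ id (fun y => s y) y0 (s y0))[_ H] :=
    @sec_continuous _ _ _ s y0.
  have FG : Filter (filter_prod (globally [set: unit]) (within (set_val @^-1` C0) (nbhs y0))).
    exact: filter_prod_filter.
  apply: (cvg_comp _ _ _ H); exact: filter_prod_snd.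
exists (fun s => MkSection (cExt s)); split => //.
- move=> s0; apply: (@section_cvg R X E _ (nbhs s0) (nbhs_filter s0) (fun s => MkSection (cExt s))).
  move=> K x0 cK Kx0 /=.
  (* For compact [K] only values on a compact subset of [Y] enter, and on these the compact-open
     topology controls the section. *)
  apply: (e3 K _ (nbhs s0) (fun s => s)) => // C0 y0 CY cC Cy0.
  have hY := subtype_hausdorff (Y := Y) hX.
  have pY := closed_paracompact cY pX.
  have := @section_eval R Y (restrict_bundle Y E) (set_val @^-1` C0) y0 s0 hY pY.
  move=> /(_ (compact_subtype CY (cC cK)) Cy0).
  have FG : Filter (filter_prod (nbhs s0) (within (set_val @^-1` C0) (nbhs y0))).
    exact: filter_prod_filter.
  by move=> /(@pullback_cvg R Y X set_val E _ _ FG (fun p => p.2) (fun p => p.1 p.2) y0 (s0 y0))[].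
- by move=> a s t u ust x /=; exact: e1.
- by move=> s y /=; exact: e2.
- have [I [A [A1 A2 A3 A4]]] := e4; exists I, A; split => // s x /=; exact: A4.
Qed.

(* Members of the cover are shrunk so that the closed subsets of [Y] they
   contain are compact. *)
Lemma compact_cover_trivializations (P : set X -> Prop) :
  (forall U V, V `<=` U -> P U -> P V) -> (forall x, exists U, [/\ open U, U x & P U]) ->
  locally_compact [set: set_type Y] ->
  exists C : set (set X), [/\ C `<=` open, \bigcup_(U in C) U = setT,
    forall U, C U -> P U,
    (forall U, C U -> exists F : tvsType R, hausdorff_space F /\
      exists h g, @trivialization R X E U F h g) &
    forall U A, C U -> closed A -> A `<=` U -> compact (Y `&` A)].
Proof.
move=> Psub Pex lY; have [_ _ triv] := bE.
exists [set U | [/\ open U, P U, exists F : tvsType R, hausdorff_space F /\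
      exists h g, @trivialization R X E U F h g &
      forall A, closed A -> A `<=` U -> compact (Y `&` A)]].
split => //; [by move=> U []| |by move=> U []|by move=> U []|by move=> U A [_ _ _ H]; exact: H].
apply/seteqP; split=> // x _.
have [U1 [oU1 U1x PU1]] := Pex x; have [U2 [oU2 U2x [F [hF [h [g t]]]]]] := triv x.
have [U3 [oU3 U3x U3c]] : exists U, [/\ open U, U x &
    forall A, closed A -> A `<=` U -> compact (Y `&` A)].
  have [Yx|nY] := pselect (Y x); last first.
    exists (~` Y); split => //; first exact: closed_openC.
    move=> A _ AY; rewrite (_ : Y `&` A = set0); first exact: compact0.
    by apply/seteqP; split => // y [Yy /AY].
  pose y : Y := exist _ x (mem_set Yx); have [B nB [cB _]] := lY y I.
  have {nB} [_ [[W oW <-] /= Wy] WB] : nbhs y B by apply: within_setT nB.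
  exists W; split => // A cA AW; apply: (subclosed_compact _ (compact_set_val cB)).
    exact: closedI.
  move=> z [Yz /AW Wz]; pose z' : Y := exist _ z (mem_set Yz); exists z' => //.
  exact: (WB z').
exists (U1 `&` U2 `&` U3) => //; split; [by apply: openI => //; exact: openI| | |].
- by apply: Psub PU1 => z [[]].
- by exists F; split => //; exists h, g; apply: trivialization_sub t => z [[]].
- by move=> A cA AU; apply: U3c => // z /AU[].
Qed.

Lemma section_extension_locally_compact :
  locally_compact [set: set_type Y] -> metrizable R (set_type Y) -> section_extension Y E.
Proof.
move=> lY mY; have [d [dd dcont dcompat]] := pseudometric_extension hX pX cY mY.
have [//||C [oC CT _ Ct Cc]] := @compact_cover_trivializations (fun=> True) _ _ lY.
  by move=> x; exists setT; split => //; exact: openT.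
have [|ext [e1 e2 e3 _]] := extension_sections dd dcont dcompat oC CT Ct; last by exists ext.
move=> U A CU cA AU; apply: zero_closed_compact => //; exact: Cc CU cA AU.
Qed.

End SectionExtension.

Lemma section_extension_metrizable (R : realType) (X : topologicalType) (Y : set X)
    (E : vfamily R X) : metrizable R X -> closed Y -> is_vector_bundle E ->
  section_extension Y E.
Proof.
move=> mX cY bE; have pX := metrizable_paracompact mX.
have [d [[d0 dE dC dT] dn]] := mX.
have dd : pseudometric d by split => // x; apply/dE.
have dcont x e : 0 < e -> \forall y \near x, d x y < e by move=> e0; apply/dn; exists e.
have hX : hausdorff_space X.
  move=> p q pq; apply/dE; apply/eqP; rewrite eq_le d0 andbT; apply/ler_addgt0Pr => e e0.
  have e20 : 0 < e / 2 by rewrite divr_gt0.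
  have [z [/= pz qz]] := pq _ _ (dcont p _ e20) (dcont q _ e20).
  have := dT p z q; rewrite (dC z) add0r; move: pz qz; lra.
have [_ _ triv] := bE.
pose C := [set U : set X | open U /\ exists F : tvsType R, hausdorff_space F /\
      exists h g, @trivialization R X E U F h g].
have [|||||ext [e1 e2 e3 _]] := @extension_sections R X Y E hX pX cY bE d C dd dcont; last by exists ext.
- move=> a V _ /dn[e e0 He]; exists e => // b _ ab; exact: He.
- by move=> U [].
- apply/seteqP; split=> // x _; have [U [oU Ux tU]] := triv x; by exists U.
- by move=> U [].
(* For a metric defining the topology, a point at distance 0 from a closed set belongs to it. *)
- move=> U A _ cA _ x xA; exists x; last exact/dE.
  have : closed (Y `&` A) by exact: closedI.
  apply => V /dn[e e0 He]; have [a Aa xa] := xA e e0; exists a; split => //; exact: He.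
Qed.

(** * Compactly supported sections *)

Lemma filter_prod_map (Z T X : Type) (D : set_system Z) (G : set_system X)
    (f : Z -> T) (l : set_system T) : f @ D `=>` l ->
  (fun p : Z * X => (f p.1, p.2)) @ (filter_prod D G) `=>` filter_prod l G.
Proof.
move=> fl A [[P Q] [/= lP GQ] PQ]; exists (f @^-1` P, Q) => /=.
  by split => //; exact: (fl _ lP).
by move=> [z x] [/= Pz Qx]; apply: (PQ (f z, x)).
Qed.

Section BundleAlgebra.
Context {R : realType} {X : topologicalType} (E : vfamily R X).
Hypothesis bE : is_vector_bundle E.

Lemma trivialization_comb (U : set X) (F : tvsType R) (h : forall x, fib E x -> F)
    (g : forall x, F -> fib E x) (x : X) (a b : R) (u v : fib E x) :
  trivialization U h g -> U x -> h x (a *: u + b *: v) = a *: h x u + b *: h x v.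
Proof.
move=> [t1 _ _] /t1[l _ _].
pose L : {linear fib E x -> F} := HB.pack (h x) (GRing.isLinear.Build _ _ _ _ _ l).
by rewrite -[h x]/(L : _ -> _) linearD !linearZ.
Qed.

Lemma trivialization0 (U : set X) (F : tvsType R) (h : forall x, fib E x -> F)
    (g : forall x, F -> fib E x) (x : X) :
  trivialization U h g -> U x -> h x 0 = 0.
Proof.
move=> tt Ux; rewrite -(addr0 0) -[X in X + _](scale0r 0) -[X in _ + X](scale0r 0).
by rewrite (trivialization_comb _ _ _ _ tt Ux) !scale0r addr0.
Qed.

(** Sums, negatives, multiples and differences are all of the form [a *: u + b *: v], so this is the
    single continuity statement for the fibrewise operations. *)
Lemma bundle_comb_cvg (Z : Type) (D : set_system Z) (FD : Filter D) (xs : Z -> X)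
    (a b : Z -> R) (u v : forall z, fib E (xs z)) (a0 b0 : R) (x0 : X) (u0 v0 : fib E x0) :
  a @ D --> a0 -> b @ D --> b0 ->
  (fun z => tot (u z)) @ D --> (tot u0 : total E) ->
  (fun z => tot (v z)) @ D --> (tot v0 : total E) ->
  (fun z => tot (a z *: u z + b z *: v z)) @ D --> (tot (a0 *: u0 + b0 *: v0) : total E).
Proof.
move=> ca cb; have [_ cproj triv] := bE; have [U [oU Ux [F [_ [h [g tt]]]]]] := triv x0.
move=> /(tot_cvg _ _ cproj oU Ux tt)[xx uu] /(tot_cvg _ _ cproj oU Ux tt)[_ vv].
apply/(tot_cvg _ _ cproj oU Ux tt); split => //.
rewrite (trivialization_comb _ _ _ _ tt Ux).
have H : (fun z => a z *: h _ (u z) + b z *: h _ (v z)) @ D --> a0 *: h _ u0 + b0 *: h _ v0.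
  by apply: tcvgD; exact: tcvgZ.
have HU : D [set z | U (xs z)] by exact: (xx _ (open_nbhs_nbhs (conj oU Ux))).
apply: (cvg_congr H); apply: (filter_imp _ HU) => z Uz; apply/esym.
exact: (trivialization_comb _ _ _ _ tt Uz).
Qed.

Lemma zero_section_continuous : continuous (fun x => tot (0 : fib E x)).
Proof.
move=> x0; have [_ cproj triv] := bE; have [U [oU Ux [F [_ [h [g tt]]]]]] := triv x0.
apply/(@tot_cvg _ _ _ U F h g X (nbhs x0) _ id (fun x => 0) x0 0 cproj oU Ux tt).
split; first exact: cvg_id.
rewrite (trivialization0 tt Ux).
apply: (cvg_congr (@cvg_cst _ 0 _ (nbhs x0) _)).
have HU := open_nbhs_nbhs (conj oU Ux).
by apply: (filter_imp _ HU) => z Uz; apply/esym; exact: (trivialization0 tt Uz).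
Qed.

Definition zero_section := MkSection zero_section_continuous.

Lemma section_comb_continuous (a b : R) (s t : section E) :
  continuous (fun x => tot (a *: s x + b *: t x)).
Proof.
by move=> x0; apply: (@bundle_comb_cvg X (nbhs x0) _ id (fun=> a) (fun=> b) s t);
  [exact: cvg_cst|exact: cvg_cst|exact: (@sec_continuous _ _ _ s)|exact: (@sec_continuous _ _ _ t)].
Qed.

Definition section_comb a b s t := MkSection (@section_comb_continuous a b s t).

Lemma section_eq (s t : section E) : (forall x, s x = t x) -> s = t.
Proof.
case: s t => [s cs] [t ct] /= st; have {}st : s = t by exact: functional_extensionality_dep.
by subst t; rewrite (Prop_irrelevance cs ct).
Qed.

Lemma csection_eq (s t : csection E) : (forall x, s x = t x) -> s = t.
Proof.
case: s t => [s cs] [t ct] /= st; have {}st : s = t by exact: section_eq.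
by subst t; rewrite (Prop_irrelevance cs ct).
Qed.

Lemma section_comb_cvg (Z : Type) (D : set_system Z) (FD : Filter D)
    (a b : Z -> R) (s t : Z -> section E) (a0 b0 : R) (s0 t0 : section E) :
  hausdorff_space X -> paracompact X ->
  a @ D --> a0 -> b @ D --> b0 -> s @ D --> s0 -> t @ D --> t0 ->
  (fun z => section_comb (a z) (b z) (s z) (t z)) @ D --> section_comb a0 b0 s0 t0.
Proof.
move=> hX pX ca cb cs ct; apply: (@section_cvg R X E Z D FD) => K x0 cK Kx0 /=.
have FG : Filter (filter_prod D (within K (nbhs x0))) by exact: filter_prod_filter.
have FK : Filter (within K (nbhs x0)) by exact: within_filter.
apply: (@bundle_comb_cvg _ _ FG (fun p => p.2) (fun p => a p.1) (fun p => b p.1)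
  (fun p => s p.1 p.2) (fun p => t p.1 p.2)).
- exact: (@filter_prod_fst _ _ _ _ _ a (nbhs a0) FK).
- exact: (@filter_prod_fst _ _ _ _ _ b (nbhs b0) FK).
- have H := @filter_prod_map _ _ _ D (within K (nbhs x0)) s (nbhs s0) cs.
  exact: (cvg_comp _ _ H (@section_eval R X E K x0 s0 hX pX cK Kx0)).
- have H := @filter_prod_map _ _ _ D (within K (nbhs x0)) t (nbhs t0) ct.
  exact: (cvg_comp _ _ H (@section_eval R X E K x0 t0 hX pX cK Kx0)).
Qed.

Lemma csection_comb_supported (a b : R) (s t : csection E) :
  exists2 K : set X, compact K & supported K (section_comb a b s t).
Proof.
have [K cK Ks] := csec_supported s; have [L cL Lt] := csec_supported t.
exists (K `|` L); first exact: compactU.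
move=> x nKL /=; rewrite Ks ?Lt ?scaler0 ?addr0// => Kx; apply: nKL; [by right|by left].
Qed.

Definition csection_comb a b s t := MkCSection (@csection_comb_supported a b s t).

Lemma zero_csection_supported : exists2 K : set X, compact K & supported K zero_section.
Proof. by exists set0; [exact: compact0|]. Qed.

Definition zero_csection := MkCSection zero_csection_supported.

End BundleAlgebra.

(* The hypotheses are arguments of the type so that its vector space structure,
   whose construction requires them, can be inferred. *)
Definition csections {R : realType} {X : topologicalType} {E : vfamily R X}
  (hX : hausdorff_space X) (pX : paracompact X) (bE : is_vector_bundle E) : Type :=
  csection E.

(** * The locally convex space of compactly supported sections *)

Section CSections.
Context {R : realType} {X : topologicalType} {E : vfamily R X}.
Context (hX : hausdorff_space X) (pX : paracompact X) (bE : is_vector_bundle E).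
Local Notation V := (csections hX pX bE).

HB.instance Definition _ := Topological.copy V (csection E).

Let addV (s t : V) : V := csection_comb bE 1 1 s t.
Let oppV (s : V) : V := csection_comb bE (-1) 0 s s.
Let scaleV (a : R) (s : V) : V := csection_comb bE a 0 s s.
Let zeroV : V := zero_csection bE.

Let addVE (s t : V) x : (addV s t) x = s x + t x. Proof. by rewrite /= !scale1r. Qed.
Let oppVE (s : V) x : (oppV s) x = - s x. Proof. by rewrite /= scale0r addr0 scaleN1r. Qed.
Let scaleVE a (s : V) x : (scaleV a s) x = a *: s x. Proof. by rewrite /= scale0r addr0. Qed.

Let addVA : associative addV.
Proof. by move=> s t u; apply: csection_eq => x; rewrite !addVE addrA. Qed.
Let addVC : commutative addV.
Proof. by move=> s t; apply: csection_eq => x; rewrite !addVE addrC. Qed.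
Let add0V : left_id zeroV addV.
Proof. by move=> s; apply: csection_eq => x; rewrite !addVE add0r. Qed.
Let addNV : left_inverse zeroV oppV addV.
Proof. by move=> s; apply: csection_eq => x; rewrite !addVE oppVE addNr. Qed.

HB.instance Definition _ := GRing.isZmodule.Build V addVA addVC add0V addNV.

Let scaleVA a b (s : V) : scaleV a (scaleV b s) = scaleV (a * b) s.
Proof. by apply: csection_eq => x; rewrite !scaleVE scalerA. Qed.
Let scale1V : left_id 1 scaleV.
Proof. by move=> s; apply: csection_eq => x; rewrite scaleVE scale1r. Qed.
Let scaleVDr : right_distributive scaleV +%R.
Proof. by move=> a s t; apply: csection_eq => x; rewrite scaleVE !addVE scalerDr !scaleVE. Qed.
Let scaleVDl s : {morph scaleV^~ s : a b / a + b}.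
Proof. by move=> a b; apply: csection_eq => x; rewrite addVE !scaleVE scalerDl. Qed.

HB.instance Definition _ := GRing.Zmodule_isLmodule.Build R V scaleVA scale1V scaleVDr scaleVDl.

Lemma csectionsDE (s t : V) x : (s + t : V) x = s x + t x. Proof. exact: addVE. Qed.
Lemma csectionsNE (s : V) x : (- s : V) x = - s x. Proof. exact: oppVE. Qed.
Lemma csectionsZE a (s : V) x : (a *: s : V) x = a *: s x. Proof. exact: scaleVE. Qed.
Lemma csections0E x : (0 : V) x = 0. Proof. by []. Qed.

Implicit Types (W : set V) (s t u : V).

Lemma lc_convex W (a b : R) s t : lc_zero_nbhs W -> W s -> W t -> `|a| + `|b| <= 1 ->
  W (a *: s + b *: t).
Proof. by move=> [aW _] Ws Wt ab; apply: (aW a b s t) => // x; rewrite csectionsDE !csectionsZE. Qed.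

Lemma lc_nbhs0 W : lc_zero_nbhs W -> W 0.
Proof.
move=> [_ nW]; have [G [_ G0] GW] := nW set0 compact0.
by apply: GW; [move=> x _|apply: G0].
Qed.

Lemma lc_zero_nbhs_intro W : absolutely_convex W ->
  (forall K, compact K -> exists2 G : set (section E), nbhs (zero_section bE) G &
     forall t, supported K t -> G t -> W t) -> lc_zero_nbhs W.
Proof.
move=> aW nW; split => // K cK; have [G nG GW] := nW K cK.
move: nG; rewrite {1}nbhsE => -[B [oB B0] BG]; exists B; last by move=> t Kt /BG; exact: GW.
split => // z z0; suff -> : z = zero_section bE by [].
exact: section_eq.
Qed.

Lemma lc_scale W (c : R) : c != 0 -> lc_zero_nbhs W -> lc_zero_nbhs [set w : V | W (c *: w)].
Proof.
move=> c0 [aW nW]; split.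
  move=> a b s t u Ws Wt ab uE; apply: (aW a b _ _ _ Ws Wt ab) => x.
  by rewrite !csectionsZE uE scalerDr !scalerA ![c * _]mulrC.
move=> K cK; have [G [oG G0] GW] := nW K cK.
exists [set t | G (section_comb bE c 0 t t)].
  split; last by move=> z z0; apply: G0 => x /=; rewrite z0 !scaler0 addr0.
  rewrite openE => t /= Gt.
  have H : (fun t : section E => section_comb bE c 0 t t) @ t --> section_comb bE c 0 t t.
    exact: (@section_comb_cvg R X E bE _ (nbhs t) (nbhs_filter t) (fun=> c) (fun=> 0) id id c 0 t t
      hX pX (cvg_cst _) (cvg_cst _) cvg_id cvg_id).
  exact: (H _ (open_nbhs_nbhs (conj oG Gt))).
by move=> t Kt Gt; apply: (GW (c *: (t : V))) => //; move=> x /Kt; rewrite csectionsZE => ->; rewrite scaler0.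
Qed.

Lemma lc_absorb W s : lc_zero_nbhs W -> exists2 e : R, 0 < e & forall a, `|a| < e -> W (a *: s).
Proof.
move=> [_ nW]; have [K cK Ks] := csec_supported s; have [G [oG G0] GW] := nW K cK.
have H : (fun a : R => section_comb bE a 0 s s) @ (0 : R) --> section_comb bE 0 0 s s.
  exact: (@section_comb_cvg R X E bE R (nbhs (0 : R)) (nbhs_filter (0 : R)) id (fun=> 0)
    (fun=> s : section E) (fun=> s : section E) 0 0 s s hX pX cvg_id (cvg_cst _) (cvg_cst _) (cvg_cst _)).
have Gz : G (section_comb bE 0 0 s s) by apply: G0 => x /=; rewrite !scale0r addr0.
have [e /= e0 He] := H _ (open_nbhs_nbhs (conj oG Gz)).
exists e => // a ae; apply: GW; first by move=> x /Ks; rewrite csectionsZE => ->; rewrite scaler0.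
by apply: (He a); rewrite /ball_/= sub0r normrN.
Qed.

(** A set [W] as in [lc_zero_nbhs] need not be open, but [s + [0, 1) W] is open and convex; these
    sets form the basis of convex open sets. *)
Definition lc_core s W : set V :=
  [set t : V | exists c (w : V), [/\ 0 <= c < 1, W w & t = s + c *: w]].

Lemma lc_core_center s W : lc_zero_nbhs W -> lc_core s W s.
Proof. by exists 0, 0; rewrite lexx ltr01 scaler0 addr0; split => //; exact: lc_nbhs0. Qed.

Lemma lc_core_sub s W t : lc_zero_nbhs W -> lc_core s W t -> W (t - s).
Proof.
move=> lW [c [w [/andP[c0 c1] Ww ->]]]; rewrite addrC addKr.
rewrite -[c *: w]addr0 -[X in _ + X](scale0r 0); apply: lc_convex => //; first exact: lc_nbhs0.
by rewrite normr0 addr0 ger0_norm// ltW.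
Qed.

Lemma lc_core_open s W : lc_zero_nbhs W -> open (lc_core s W).
Proof.
move=> lW; suff : csection_open (lc_core s W) by [].
(* Perturbations in [e *: W] use half of the margin [1 - c], so that the total factor [c + e] stays
   below 1. *)
move=> _ [c [w [/andP[c0 c1] Ww ->]]]; pose e := (1 - c) / 2.
have e0 : 0 < e by rewrite divr_gt0// subr_gt0.
exists [set v : V | W (e^-1 *: v)]; first by apply: lc_scale => //; rewrite invr_neq0// lt0r_neq0.
move=> v t Wv tE; have {}tE : (t : V) = s + (c *: w + e *: (e^-1 *: (v : V))).
  apply: csection_eq => x; rewrite tE !csectionsDE !csectionsZE scalerA divff ?lt0r_neq0// scale1r.
  by rewrite addrA.
have ce : 0 < c + e by rewrite ltr_wpDl.
exists (c + e), ((c / (c + e)) *: w + (e / (c + e)) *: (e^-1 *: (v : V))); split.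
- by apply/andP; split; [exact: ltW|rewrite /e; lra].
- have n1 : 0 <= c / (c + e) by rewrite divr_ge0// ltW.
  have n2 : 0 <= e / (c + e) by rewrite divr_ge0// ltW.
  by apply: lc_convex => //; rewrite !ger0_norm// -mulrDl divff ?lt0r_neq0.
- by rewrite tE scalerDr !scalerA [_ * (c / _)]mulrC [_ * (e / _)]mulrC !mulfVK ?lt0r_neq0.
Qed.

Lemma lc_core_convex s W : lc_zero_nbhs W -> convex_set (lc_core s W).
Proof.
move=> lW _ _ l /set_mem[c [w [/andP[c0 c1] Ww ->]]] /set_mem[d [v [/andP[d0 d1] Wv ->]]].
(* [m] dominates both factors and stays below 1; the summand [2^-1] also makes it positive, as it is
   divided by. *)
apply/mem_set; rewrite /conv/=; set a := l%:inum; pose m := Num.max c d / 2 + 2^-1.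
have [a0 a1] : 0 <= a /\ a <= 1 by rewrite /a; split.
have [cm dm] : c <= m /\ d <= m by rewrite /m; case: (leP c d); lra.
have [m0 m1] : 0 < m /\ m < 1 by rewrite /m; case: (leP c d); lra.
exists m, ((a * (c / m)) *: w + ((1 - a) * (d / m)) *: v); split; first by rewrite ltW.
  have am : 0 <= 1 - a by rewrite subr_ge0.
  have n1 : 0 <= a * (c / m) by rewrite mulr_ge0// divr_ge0// ltW.
  have n2 : 0 <= (1 - a) * (d / m) by rewrite mulr_ge0// divr_ge0// ltW.
  apply: lc_convex => //; rewrite !ger0_norm//.
  have h1 : a * (c / m) <= a by rewrite ler_piMr// ler_pdivrMr// mul1r.
  have h2 : (1 - a) * (d / m) <= 1 - a by rewrite ler_piMr// ler_pdivrMr// mul1r.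
  lra.
rewrite -[unstable.onem a]/(1 - a) !scalerDr !scalerA addrACA -scalerDl subrKC scale1r.
have mE k z : m * (k * (z / m)) = k * z by rewrite mulrCA [m * _]mulrC mulfVK// lt0r_neq0.
by rewrite !mE.
Qed.

Lemma csection_nbhs s (A : set V) :
  nbhs s A <-> exists2 W, lc_zero_nbhs W & forall w, W w -> A (s + w).
Proof.
split=> [|[W lW WA]].
  rewrite {1}nbhsE => -[B [oB Bs] BA]; have [W lW WB] := oB s Bs.
  by exists W => // w Ww; apply: BA; apply: (WB w) => // x; rewrite csectionsDE.
rewrite nbhsE; exists (lc_core s W).
  by split; [exact: lc_core_open|exact: lc_core_center].
by move=> t /(lc_core_sub lW) /WA; rewrite addrC subrK.
Qed.

Let addV_continuous : continuous (fun x : V * V => x.1 + x.2).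
Proof.
move=> [s t] A /csection_nbhs[W lW WA] /=.
have lW2 : lc_zero_nbhs [set w : V | W (2 *: w)] by apply: lc_scale.
exists ([set s' | exists2 w : V, W (2 *: w) & s' = s + w], [set t' | exists2 w : V, W (2 *: w) & t' = t + w]).
  by split; apply/csection_nbhs; exists [set w : V | W (2 *: w)] => // w Ww; exists w.
move=> [_ _] [/= [w Ww ->] [v Wv ->]]; rewrite addrACA; apply: WA.
have -> : w + v = 2^-1 *: (2 *: w) + 2^-1 *: (2 *: v) by rewrite !scalerA mulVf// !scale1r.
apply: lc_convex => //; rewrite ger0_norm ?invr_ge0//; lra.
Qed.

Let scaleV_continuous : continuous (fun z : R^o * V => z.1 *: z.2).
Proof.
move=> [a s] A /csection_nbhs[W lW WA] /=.
have lW2 : lc_zero_nbhs [set w : V | W (2 *: w)] by apply: lc_scale.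
have [e e0 He] := lc_absorb s lW2.
(* [c] bounds the absolute value of [b] when [b] is within 1 of [a]; the two parts of the increment,
   [(b - a) *: s] and [b *: w], then each take half of [W]. *)
pose c := `|a| + 1; have c0 : 0 < c by rewrite ltr_wpDl.
exists ([set b : R | `|b - a| < Num.min e 1], [set t | exists2 w : V, W ((2 * c) *: w) & t = s + w]).
  split.
    exists (Num.min e 1) => /=; first by rewrite lt_min e0 ltr01.
    by move=> b; rewrite /ball_/= distrC.
  apply/csection_nbhs; exists [set w : V | W ((2 * c) *: w)]; last by move=> w Ww; exists w.
  by apply: lc_scale => //; rewrite lt0r_neq0// mulr_gt0.
move=> [b _] [/= ba [w Ww ->]]; move: ba; rewrite lt_min => /andP[be b1].
have -> : b *: (s + w) = a *: s + (2^-1 *: (2 *: ((b - a) *: s)) + (b / (2 * c)) *: ((2 * c) *: w)).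
  rewrite !scalerA mulrA mulVf// mul1r mulfVK ?lt0r_neq0 ?mulr_gt0//.
  by rewrite scalerBl scalerDr addrA [a *: s + _]addrC subrK.
apply: WA; apply: lc_convex => //; first exact: He.
have c20 : 0 <= 2 * c by rewrite mulr_ge0// ltW.
rewrite ger0_norm ?invr_ge0// normrM normfV [`|2 * c|]ger0_norm//.
have bc : `|b| <= c.
  have := ler_normD (b - a) a; rewrite subrK /c; move: b1; lra.
have : `|b| / (2 * c) <= 2^-1 by rewrite ler_pdivrMr ?mulr_gt0// mulrA mulVf// mul1r.
lra.
Qed.

Let V_locally_convex : exists2 B : set_system V,
    (forall b, b \in B -> convex_set b) & basis B.
Proof.
exists [set A : set V | exists s W, lc_zero_nbhs W /\ A = lc_core s W].
  by move=> _ /set_mem[s [W [lW ->]]]; exact: lc_core_convex.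
split=> [_ [s [W [lW ->]]]|s A /csection_nbhs[W lW WA]]; first exact: lc_core_open.
exists (lc_core s W); first by split; [exists s, W|exact: lc_core_center].
by move=> t /(lc_core_sub lW) /WA; rewrite addrC subrK.
Qed.

HB.instance Definition _ := PreTopologicalLmod_isTvs.Build R V
  addV_continuous scaleV_continuous V_locally_convex.
(* The factory above only builds the uniform structure. *)
HB.instance Definition _ :=
  PreTopologicalNmodule_isTopologicalNmodule.Build V addV_continuous.
HB.instance Definition _ :=
  TopologicalNmodule_isTopologicalLmodule.Build R V scaleV_continuous.
HB.instance Definition _ := Uniform_isTvs.Build R V V_locally_convex.

(** Sections that are small at one point, for a continuous seminorm on the fibre, form a
    neighbourhood of zero; inseparable sections therefore agree at every point. *)
Lemma csections_hausdorff : hausdorff_space V.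
Proof.
move=> s t st; apply: csection_eq => x; apply/eqP; rewrite -subr_eq0; apply/eqP.
have [_ cproj triv] := bE; have [U [oU Ux [F [hF [h [g tt]]]]]] := triv x.
have [t1 _ _] := tt; have [_ hK _] := t1 _ Ux.
apply: (can_inj hK); rewrite (trivialization0 tt Ux).
apply: hausdorff_seminorm => // q sq; have [qD qZ _] := sq.
pose W : set V := [set w : V | q (h x (w x)) <= 2^-1].
have hl a b (u v : fib E x) : h x (a *: u + b *: v) = a *: h x u + b *: h x v.
  exact: (trivialization_comb _ _ _ _ tt Ux).
have lW : lc_zero_nbhs W.
  apply: lc_zero_nbhs_intro.
    move=> a b s' t' u; rewrite /W/= => Ws Wt ab ->; rewrite hl.
    apply: le_trans (qD _ _) _; rewrite !qZ.
    have := ler_wpM2l (normr_ge0 a) Ws; have := ler_wpM2l (normr_ge0 b) Wt; lra.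
  move=> K _; exists [set u : section E | q (h x (u x)) <= 2^-1]; last by [].
  have /(tot_cvg _ _ cproj oU Ux tt)[_ H] := @section_cvg_point R X E x (zero_section bE).
  by apply: (seminorm_cvg sq H); rewrite (trivialization0 tt Ux) seminorm0// invr_gt0.
have nW (u : V) : nbhs u [set u' : V | exists2 w, W w & u' = u + w].
  by apply/csection_nbhs; exists W => // w Ww; exists w.
have [_ [[w Ww ->] [v Wv /(congr1 (fun u : V => u x))]]] := st _ _ (nW s) (nW t).
rewrite !csectionsDE => E1.
have -> : s x - t x = 1 *: v x + (-1) *: w x.
  by rewrite scale1r scaleN1r; apply/eqP; rewrite subr_eq addrAC [v x + _]addrC -E1 addrK.
rewrite hl; apply: le_trans (qD _ _) _; rewrite !qZ normrN1 normr1 !mul1r.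
by move: Ww Wv; rewrite /W/=; lra.
Qed.

End CSections.

Section CompactLocallyFinite.
Context {X : topologicalType}.

Lemma near_on_compact (A : set X) (Z : Type) (D : set_system Z) (P : Z -> X -> Prop) :
  compact A -> Filter D ->
  (forall x : X, A x -> exists2 N, nbhs x N & exists2 B, D B &
     forall z y, B z -> N y -> A y -> P z y) ->
  D [set z | forall x, A x -> P z x].
Proof.
move=> cA FD H; have /near_covering_withinP cov := (compact_near_coveringP A).1 cA.
apply: (cov Z D P FD) => x Ax; have [N nN [B DB BN]] := H x Ax.
by exists (N, B) => // -[y z] [/= Ny Bz] Ay; exact: BN.
Qed.

(** Lists ordered by inclusion generate a filter along which the local statement holds eventually,
    so compactness of [K] yields a single list. *)
Lemma compact_locally_finite (I : choiceType) (A : I -> set X) (K : set X) :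
  (forall x : X, exists2 S : seq I, uniq S & exists2 N, nbhs x N &
     forall i, i \notin S -> forall y, N y -> ~ A i y) ->
  compact K -> exists2 S : seq I, uniq S & forall i, i \notin S -> forall y, K y -> ~ A i y.
Proof.
move=> lfA cK.
pose D := filter_from [set: seq I] (fun S => [set S' : seq I | {subset S <= S'}]).
have FD : Filter D.
  apply: filter_from_filter; first by exists [::].
  move=> S S' _ _; exists (S ++ S') => // S'' SS; split => i iS; apply: SS;
    by rewrite mem_cat iS ?orbT.
have [S _ HS] : D [set S : seq I | forall x, K x -> forall i, i \notin S -> ~ A i x].
  apply: near_on_compact => // x Kx; have [S uS [N nN SN]] := lfA x; exists N => //.
  exists [set S' : seq I | {subset S <= S'}]; first by exists S.
  move=> S' y SS Ny _ i iS'; apply: (SN i _ y Ny); apply: contra iS'; exact: SS.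
exists (undup S); first exact: undup_uniq.
by move=> i; rewrite mem_undup => iS y Ky; exact: (HS S).
Qed.

Lemma compact_bigcup_seq (I : eqType) (S : seq I) (A : I -> set X) :
  (forall i, compact (A i)) -> compact [set x | exists2 i, i \in S & A i x].
Proof.
move=> cA; elim: S => [|i S IH].
  rewrite (_ : [set x | _] = set0); first exact: compact0.
  by apply/seteqP; split => // x [].
rewrite (_ : [set x | _] = A i `|` [set x | exists2 i, i \in S & A i x]); first exact: compactU.
apply/seteqP; split => x /=.
  by move=> [j]; rewrite inE => /orP[/eqP->|jS] Aj; [left|right; exists j].
by move=> [Ai|[j jS Aj]]; [exists i; rewrite ?mem_head|exists j; rewrite ?inE ?jS ?orbT].
Qed.

End CompactLocallyFinite.

Section LinearMaps.
Context {R : realType} {X1 X2 : topologicalType} {E1 : vfamily R X1} {E2 : vfamily R X2}.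
Context (hX1 : hausdorff_space X1) (pX1 : paracompact X1) (bE1 : is_vector_bundle E1).
Context (hX2 : hausdorff_space X2) (pX2 : paracompact X2) (bE2 : is_vector_bundle E2).
Local Notation V1 := (csections hX1 pX1 bE1).
Local Notation V2 := (csections hX2 pX2 bE2).

Lemma csections_linear (f : csection E1 -> csection E2) :
  (forall (a : R) (s t u : csection E1), (forall x, u x = a *: s x + t x) ->
     forall x, f u x = a *: f s x + f t x) -> linear (f : V1 -> V2).
Proof.
move=> lf a s t; apply: csection_eq => x; rewrite csectionsDE csectionsZE.
by apply: lf => y; rewrite csectionsDE csectionsZE.
Qed.

(** The universal property of the direct limit: preimages of absolutely convex sets are absolutely
    convex, and for sections supported in [K] the question reduces to compact-open continuity, since
    the images are supported in one compact set. *)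
Lemma csections_continuous (f : V1 -> V2) (phi : section E1 -> section E2) :
  linear f -> continuous phi -> (forall s : V1, csec (f s) = phi (csec s)) ->
  (forall K, compact K -> exists2 L, compact L &
     forall s : V1, supported K s -> supported L (f s)) ->
  continuous f.
Proof.
move=> lf cphi fphi sf.
pose L : {linear V1 -> V2} := HB.pack f (GRing.isLinear.Build _ _ _ _ _ lf).
move=> s A /csection_nbhs[W lW WA]; apply/csection_nbhs; exists (f @^-1` W); last first.
  by move=> w Ww /=; rewrite -[f]/(L : _ -> _) linearD; exact: WA.
apply: (lc_zero_nbhs_intro (hX := hX1) (pX := pX1) (bE := bE1)).
  move=> a b s' t' u Ws Wt ab uE /=.
  have -> : u = a *: (s' : V1) + b *: (t' : V1).
    by apply: csection_eq => x; rewrite uE csectionsDE !csectionsZE.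
  by rewrite -[f]/(L : _ -> _) linearD !linearZ; exact: lc_convex.
move=> K cK; have [K' cK' KK'] := sf K cK; have [_ /(_ K' cK')[G [oG G0] GW]] := lW.
exists (phi @^-1` G).
  apply: cphi; apply: open_nbhs_nbhs; split => //; apply: G0 => x.
  have -> : zero_section bE1 = csec (0 : V1) by exact: section_eq.
  by rewrite -fphi -[f]/(L : _ -> _) linear0.
move=> t Kt Gt; apply: GW; first exact: KK'.
by rewrite fphi.
Qed.

End LinearMaps.

(** * A neighbourhood basis of zero given by families of seminorms *)

Section Box.
Context {R : realType} {X : topologicalType} {E : vfamily R X}.
Context (hX : hausdorff_space X) (pX : paracompact X) (bE : is_vector_bundle E).
Local Notation V := (csections hX pX bE).
Context (I : choiceType) (h : I -> X -> R) (U : I -> set X) (F : I -> tvsType R).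
Context (th : forall i x, fib E x -> F i) (tg : forall i x, F i -> fib E x).
Arguments th : clear implicits.
Arguments tg : clear implicits.
Hypothesis hP : is_partition_of_unity h.
Local Notation A i := (closure [set x | h i x != 0]).
Hypotheses (oU : forall i, open (U i)) (cA : forall i, compact (A i)) (AU : forall i, A i `<=` U i).
Hypothesis tt : forall i, trivialization (U i) (th i) (tg i).

Let h_out i x : ~ A i x -> h i x = 0.
Proof. by move=> nA; apply/eqP; apply: contra_notT nA => hx; exact: subset_closure. Qed.

(** The sections for which the suprema of [q i] on the compact sets [A i] sum to at most 1,
    expressed by upper bounds [c i]. A sum, rather than a maximum, is what makes the decomposition
    of a section into localised pieces a combination with total weight at most 1. *)
Definition box (q : forall i, F i -> R) : set V :=
  [set w : V | exists (S : seq I) (c : I -> R), [/\ uniq S, forall i, 0 <= c i,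
     \sum_(i <- S) c i <= 1, forall i x, i \notin S -> A i x -> w x = 0 &
     forall i x, A i x -> q i (th i x (w x)) <= c i]].

Let cproj : continuous (@proj R X E). Proof. by case: bE. Qed.

Lemma near_zero_section (q : forall i, F i -> R) i (e : R) : seminorm (q i) -> 0 < e ->
  nbhs (zero_section bE) [set t : section E | forall x, A i x -> q i (th i x (t x)) <= e].
Proof.
move=> sq e0; apply: near_on_compact => // x Ax; have Ux := AU Ax.
have /(tot_cvg _ _ cproj (oU i) Ux (tt i))[_ H] :=
  @section_eval R X E (A i) x (zero_section bE) hX pX (cA (i := i)) Ax.
rewrite /= (trivialization0 (tt i) Ux) in H.
have qe : q i 0 < e by rewrite seminorm0.
have [[P Q] [/= nP nQ] PQ] := seminorm_cvg sq H qe.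
by exists [set y | A i y -> Q y] => //; exists P => // t y Pt Qy Ay; apply: (PQ (t, y)); split => //; exact: Qy.
Qed.

Lemma box_lc (q : forall i, F i -> R) : (forall i, seminorm (q i)) -> lc_zero_nbhs (box q).
Proof.
move=> sq; apply: (lc_zero_nbhs_intro (hX := hX) (pX := pX) (bE := bE)).
  move=> a b s t u [S [c [uS c0 cS Sz Sc]]] [S' [c' [uS' c'0 c'S Sz' Sc']]] ab uE.
  pose T := undup (S ++ S').
  have TS i : i \notin T -> i \notin S /\ i \notin S'.
    by rewrite mem_undup mem_cat negb_or => /andP[].
  have H (S1 S2 : seq I) (d : I -> R) : uniq S1 -> uniq S2 -> {subset S1 <= S2} ->
      (forall i, 0 <= d i) -> \sum_(i <- S2 | i \in S1) d i = \sum_(i <- S1) d i.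
    move=> u1 u2 S12 d0; rewrite -big_filter; apply: perm_big; apply: uniq_perm => //.
      exact: filter_uniq.
    by move=> i; rewrite mem_filter; case: (boolP (i \in S1)) => //= /S12->.
  pose d i := `|a| * (if i \in S then c i else 0) + `|b| * (if i \in S' then c' i else 0).
  exists T, d; split.
  - exact: undup_uniq.
  - move=> i; rewrite /d addr_ge0// mulr_ge0//; by case: ifP.
  - rewrite big_split/= -!mulr_sumr -!big_mkcond/= !H ?undup_uniq//.
    + have := ler_wpM2l (normr_ge0 a) cS; have := ler_wpM2l (normr_ge0 b) c'S; lra.
    + by move=> i iS; rewrite mem_undup mem_cat iS orbT.
    + by move=> i iS; rewrite mem_undup mem_cat iS.
  - by move=> i x /TS[iS iS'] Ax; rewrite uE (Sz i)// (Sz' i)// !scaler0 addr0.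
  - move=> i x Ax; have [qD qZ _] := sq i.
    rewrite uE (trivialization_comb _ _ _ _ (tt i) (AU Ax)); apply: le_trans (qD _ _) _.
    rewrite !qZ /d lerD// ler_wpM2l//; case: ifPn => iS; [exact: Sc| |exact: Sc'|].
      by rewrite (Sz i)// (trivialization0 (tt i) (AU Ax)) seminorm0.
    by rewrite (Sz' i)// (trivialization0 (tt i) (AU Ax)) seminorm0.
move=> K cK.
have [S uS SK] := compact_locally_finite (fun x => partition_support_nbhs x hP) cK.
(* Equal shares for the finitely many [A i] that meet [K]; the successor covers the empty list. *)
pose e : R := (size S).+1%:R^-1; have e0 : 0 < e by rewrite invr_gt0 ltr0n.
exists [set t : section E | forall i, i \in S -> forall x, A i x -> q i (th i x (t x)) <= e].
  by apply: near_seq => i _; exact: near_zero_section.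
move=> t Kt Gt; exists S, (fun=> e); split => //.
- by move=> i; exact: ltW.
- rewrite big_const_seq count_predT iter_addr_0 -mulr_natr mulrC ler_pdivrMr ?ltr0n// mul1r.
  by rewrite ler_nat.
- by move=> i x iS Ax; apply: Kt => Kx; exact: (SK i iS x Kx).
- move=> i x Ax; have [iS|iS] := boolP (i \in S); first exact: Gt.
  have -> : t x = 0 by apply: Kt => Kx; exact: (SK i iS x Kx).
  by rewrite (trivialization0 (tt i) (AU Ax)) seminorm0// ltW.
Qed.

Lemma scaled_section_continuous i (w : section E) : continuous (fun x => tot (h i x *: w x)).
Proof.
have [ch _ _] := hP => x0.
have H : (fun x => tot (h i x *: w x + 0 *: w x)) @ x0 --> (tot (h i x0 *: w x0 + 0 *: w x0) : total E).
  exact: (@bundle_comb_cvg R X E bE X (nbhs x0) _ id (h i) (fun=> 0) w w (h i x0) 0 x0 (w x0) (w x0)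
    (ch i x0) (cvg_cst _) (@sec_continuous _ _ _ w x0) (@sec_continuous _ _ _ w x0)).
rewrite /continuous_at; rewrite scale0r addr0 in H; apply: (cvg_congr H).
by apply: filterE => x /=; rewrite scale0r addr0.
Qed.

Lemma scaled_csection_supported i (w : section E) :
  exists2 K : set X, compact K & supported K (MkSection (@scaled_section_continuous i w)).
Proof. by exists (A i) => // x nA /=; rewrite h_out// scale0r. Qed.

Definition scaled_csection i (w : section E) : V := MkCSection (@scaled_csection_supported i w).

Lemma lc_sum W (S : seq I) (d : I -> R) (u : I -> V) : lc_zero_nbhs W ->
  (forall i, 0 <= d i) -> (forall i, i \in S -> W (u i)) ->
  exists2 v : V, W v & \sum_(i <- S) d i *: u i = (\sum_(i <- S) d i) *: v.
Proof.
move=> lW d0; elim: S => [_|i S IH H].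
  by exists 0; [exact: (lc_nbhs0 (bE := bE))|rewrite !big_nil scaler0].
have [v Wv vE] := IH (fun j jS => H j (mem_behead (s := i :: S) jS)).
rewrite !big_cons vE; set D := \sum_(j <- S) d j.
have D0 : 0 <= D by exact: sumr_ge0.
have [dD|dD] := eqVneq (d i + D) 0.
  have [-> ->] : d i = 0 /\ D = 0 by have := d0 i; split; lra.
  by exists 0; [exact: (lc_nbhs0 (bE := bE))|rewrite addr0 !scale0r addr0].
have dD0 : 0 < d i + D by rewrite lt0r dD addr_ge0.
exists ((d i / (d i + D)) *: u i + (D / (d i + D)) *: v).
  have n1 : 0 <= d i / (d i + D) by rewrite divr_ge0// ltW.
  have n2 : 0 <= D / (d i + D) by rewrite divr_ge0// ltW.
  apply: (lc_convex (bE := bE)) => //; first by apply: H; rewrite mem_head.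
  by rewrite !ger0_norm// -mulrDl divff.
by rewrite scalerDr !scalerA ![(d i + D) * _]mulrC !mulfVK.
Qed.

Lemma csections_sumE (J : Type) (S : seq J) (u : J -> V) x :
  (\sum_(i <- S) u i : V) x = \sum_(i <- S) u i x.
Proof. by elim: S => [|i S IH]; rewrite ?big_nil// !big_cons csectionsDE IH. Qed.

(* The sets [box q] form a neighbourhood basis of zero: a section is the finite
   combination of the sections [h i * w], each supported in the compact [A i]. *)
Lemma lc_box W : lc_zero_nbhs W ->
  exists2 q : forall i, F i -> R, (forall i, seminorm (q i)) & box q `<=` W.
Proof.
move=> lW.
have data i : exists2 q : F i -> R, seminorm q & forall u : V, supported (A i) u ->
    (forall x, A i x -> q (th i x (u x)) <= 1) -> W u.
  have [_ /(_ _ (cA (i := i)))[G [oG G0] GW]] := lW.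
  (* Sections supported in [A i] and small for ever larger seminorms form a filter that converges to
     the zero section; hence one seminorm suffices for [G]. *)
  pose D := filter_from [set q : F i -> R | seminorm q] (fun q => [set u : V | supported (A i) u /\
    forall x, A i x -> q (th i x (u x)) <= 1]).
  have FD : Filter D.
    apply: filter_from_filter; first by exists (fun=> 0); exact: seminorm_zero.
    move=> p q sp sq; exists (fun v => p v + q v); first exact: seminormD.
    move=> u [Au Hu]; split; split => // x Ax; apply: le_trans (Hu x Ax).
      by rewrite lerDl seminorm_ge0.
    by rewrite lerDr seminorm_ge0.
  suff H : (fun u : V => csec u) @ D --> zero_section bE.
    have [q sq Hq] := H _ (open_nbhs_nbhs (conj oG (G0 (zero_section bE) (fun=> erefl)))).
    by exists q => // u Au Hu; apply: GW => //; exact: Hq.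
  apply: section_cvg => K x0 cK Kx0.
  have FG : Filter (filter_prod D (within K (nbhs x0))) by exact: filter_prod_filter.
  have c2 : (fun p : V * X => p.2) @ (filter_prod D (within K (nbhs x0))) --> x0.
    exact: filter_prod_snd.
  have DA : D [set u : V | supported (A i) u].
    by exists (fun=> 0); [exact: seminorm_zero|move=> u []].
  have GA : (filter_prod D (within K (nbhs x0))) [set p : V * X | supported (A i) (p.1 : V)].
    exists ([set u : V | supported (A i) u], setT); last by move=> [u x] [].
    by split => //=; exact: filterT.
  have [Ax|nA] := pselect (A i x0); last first.
    have oA : open (~` A i) by apply: closed_openC; exact: closed_closure.
    have HA := c2 _ (open_nbhs_nbhs (conj oA nA)).
    have H := cvg_comp _ _ c2 (@sec_continuous _ _ _ (zero_section bE) x0).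
    apply: (cvg_congr H); apply: (filter_imp2 FG GA HA) => -[u x] /= Au nAx.
    by rewrite Au.
  apply/(tot_cvg _ _ cproj (oU i) (AU Ax) (tt i)); split => //=.
  have HU : (filter_prod D (within K (nbhs x0))) [set z : V * X | U i z.2].
    exact: (c2 _ (open_nbhs_nbhs (conj (oU i) (AU Ax)))).
  rewrite (trivialization0 (tt i) (AU Ax)); apply/cvg_seminorm => p sp e e0.
  have GP : (filter_prod D (within K (nbhs x0)))
      [set z : V * X | forall x, A i x -> e^-1 * p (th i x ((z.1 : V) x)) <= 1].
    exists ([set u : V | forall x, A i x -> e^-1 * p (th i x (u x)) <= 1], setT); last by move=> [u x] [].
    split => /=; last exact: filterT.
    exists (fun v => e^-1 * p v); last by move=> u [].
    by apply: seminormZ_scale => //; rewrite invr_ge0 ltW.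
  have G2 := @filterI _ _ FG _ _ GA GP; apply: (filter_imp2 FG HU G2) => -[u x] /= Ux [Au pu].
  rewrite subr0; have [/pu|nAx] := pselect (A i x).
    by rewrite mulrC ler_pdivrMr// mul1r.
  by rewrite Au// (trivialization0 (tt i) Ux) seminorm0// ltW.
pose q0 i := s2val (cid2 (data i)).
have sq0 i : seminorm (q0 i) := s2valP (cid2 (data i)).
have q0W i := s2valP' (cid2 (data i)).
exists (fun i v => 2 * q0 i v); first by move=> i; exact: seminormZ_scale.
move=> w [S [c [uS c0 cS Sz Sc]]].
(* Half of the total weight goes to the [c i], the other half is spread evenly by [e], so that [d i]
   is positive even where [c i] is 0. The factor 2 in front of [q0] compensates for the halving. *)
pose e : R := (2 * (size S).+1%:R)^-1; have e0 : 0 < e by rewrite invr_gt0 mulr_gt0 ?ltr0n.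
pose d i := c i / 2 + e.
have d0 i : 0 < d i by rewrite /d ltr_wpDl// divr_ge0.
pose u i : V := (d i)^-1 *: scaled_csection i w.
have Wu i : i \in S -> W (u i).
  move=> iS; apply: (q0W i); rewrite -/(q0 i).
    by move=> x nA; rewrite csectionsZE /= h_out// scale0r scaler0.
  move=> x Ax; have hl a b (v v' : fib E x) := trivialization_comb a b v v' (tt i) (AU Ax).
  have hZ a (v : fib E x) : th i x (a *: v) = a *: th i x v.
    by have := hl a 0 v v; rewrite !scale0r !addr0.
  have [_ qZ _] := sq0 i; have [_ h_ge0 _] := hP.
  rewrite csectionsZE/= !hZ !qZ ger0_norm ?invr_ge0 ?(ltW (d0 i))//.
  rewrite mulrC ler_pdivrMr// mul1r ger0_norm//.
  have h1 : h i x <= 1.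
    have [S0 uS0 /nbhs_singleton[S00 S01]] := (let: And3 _ _ H := hP in H) x.
    have [iS0|/S00->] := boolP (i \in S0); last exact: ler01.
    rewrite -S01 (big_rem i)//= lerDl; exact: sumr_ge0.
  have q1 : 0 <= q0 i (th i x (w x)) by exact: seminorm_ge0.
  apply: (@le_trans _ _ (q0 i (th i x (w x)))); first by rewrite ler_piMl.
  rewrite /d; have := Sc i x Ax; move: e0; lra.
have [v Wv vE] := lc_sum lW (fun i => ltW (d0 i)) Wu.
have dS : \sum_(i <- S) d i <= 1.
  rewrite /d big_split/= -mulr_suml big_const_seq count_predT iter_addr_0 -mulr_natr.
  have : e * (size S)%:R <= 2^-1.
    rewrite /e mulrC ler_pdivrMr ?mulr_gt0 ?ltr0n// mulrA mulVf// mul1r.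
    by rewrite ler_nat.
  move: cS; lra.
have -> : w = \sum_(i <- S) d i *: u i.
  apply: csection_eq => x; rewrite csections_sumE.
  rewrite (eq_bigr (fun i => h i x *: w x)); last first.
    by move=> i _; rewrite !csectionsZE scalerA divff ?lt0r_neq0// scale1r.
  have [_ _ /(_ x)[S0 uS0 /nbhs_singleton[S00 S01]]] := hP.
  have H (S1 T : seq I) : uniq S1 -> uniq T -> {subset S1 <= T} ->
      (forall i, i \notin S1 -> h i x *: w x = 0) ->
      \sum_(i <- T) h i x *: w x = \sum_(i <- S1) h i x *: w x.
    move=> u1 u2 S1T S1z; rewrite (bigID (fun i => i \in S1))/= [X in _ + X]big1; last first.
      by move=> i iS1; exact: S1z.
    rewrite addr0 -big_filter; apply: perm_big; apply: uniq_perm => //; first exact: filter_uniq.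
    by move=> i; rewrite mem_filter; case: (boolP (i \in S1)) => //= /S1T->.
  rewrite -(H S (undup (S ++ S0)))//; last first.
  - move=> i iS; have [Ax|/h_out->] := pselect (A i x); last by rewrite scale0r.
    by rewrite (Sz i x)// scaler0.
  - by move=> i iS; rewrite mem_undup mem_cat iS.
  - exact: undup_uniq.
  rewrite (H S0)//.
  - by rewrite -scaler_suml S01 scale1r.
  - exact: undup_uniq.
  - by move=> i iS; rewrite mem_undup mem_cat iS orbT.
  - by move=> i /S00->; rewrite scale0r.
rewrite vE; set a := \sum_(i <- S) d i.
have -> : a *: v = a *: v + 0 *: (0 : V) by rewrite scale0r addr0.
apply: (lc_convex (bE := bE)) => //; first exact: (lc_nbhs0 (bE := bE)).
by rewrite normr0 addr0 ger0_norm//; apply: sumr_ge0 => i _; exact: ltW.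
Qed.

Lemma box_nbhs (q : forall i, F i -> R) (s : V) : (forall i, seminorm (q i)) ->
  nbhs s [set t : V | box q (t - s)].
Proof.
move=> sq; apply/csection_nbhs; exists (box q); first exact: box_lc.
by move=> w bw /=; rewrite addrC addKr.
Qed.

Lemma csections_cvg (Z : Type) (D : set_system Z) (FD : Filter D) (f : Z -> V) (l : V) :
  (forall q : forall i, F i -> R, (forall i, seminorm (q i)) -> D [set z | box q (f z - l)]) ->
  f @ D --> l.
Proof.
move=> H B /csection_nbhs[W /lc_box[q sq qW] WB].
suff : D [set z | B (f z)] by [].
by apply: (filter_imp FD (H q sq)) => z /qW/WB; rewrite -[l + _]/(l + (f z - l) : V) subrKC.
Qed.

(** Compactness of [A i] gives one seminorm ball around the values of [s] that stays in [O']; the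
    box of these seminorms works for all supports at once. *)
Lemma open_range_sections (O' : set (total E)) : open O' ->
  open [set s : V | forall x, O' (tot (s x))].
Proof.
move=> oO; rewrite openE => s Os; apply/csection_nbhs.
have data i : exists2 q : F i -> R, seminorm q & forall x v, A i x -> q v <= 1 ->
    O' (tot (tg i x (th i x (s x) + v))).
  have : nbhs (0 : F i) [set v | forall x, A i x -> O' (tot (tg i x (th i x (s x) + v)))].
    apply: near_on_compact => // x Ax; have Ux := AU Ax.
    pose G := filter_prod (nbhs x) (nbhs (0 : F i)).
    have c1 : (fun p : X * F i => p.1) @ G --> x by exact: cvg_fst.
    have c2 : (fun p : X * F i => p.2) @ G --> (0 : F i) by exact: cvg_snd.
    have [_ H] := (tot_cvg _ _ cproj (oU i) Ux (tt i)).1 (@sec_continuous _ _ _ s x).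
    have H1 : (fun p : X * F i => th i _ (s p.1) + p.2) @ G --> th i x (s x).
      by rewrite -[X in _ --> X]addr0; apply: tcvgD c2; exact: (cvg_comp _ _ c1 H).
    have HU : G [set p | U i p.1] by exact: (c1 _ (open_nbhs_nbhs (conj (oU i) Ux))).
    have [t1 _ _] := tt i.
    have : (fun p : X * F i => tot (tg i p.1 (th i _ (s p.1) + p.2))) @ G --> (tot (s x) : total E).
      apply/(tot_cvg _ _ cproj (oU i) Ux (tt i)); split => //.
      apply: (cvg_congr H1); apply: (filter_imp _ HU) => p Up.
      by have [_ _ gK] := t1 _ Up; rewrite /= gK.
    move=> /(_ _ (open_nbhs_nbhs (conj oO (Os x))))[[P Q] [/= nP nQ] PQ].
    by exists P => //; exists Q => // v y Qv Py _; exact: (PQ (y, v)).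
  move=> /seminorm_nbhs_le[q sq Hq]; exists q => // x v Ax /Hq; exact.
pose q i := s2val (cid2 (data i)).
have sq i : seminorm (q i) := s2valP (cid2 (data i)).
have qO i := s2valP' (cid2 (data i)).
exists (box q); first exact: box_lc.
move=> w [S [c [uS c0 cS Sz Sc]]] x /=.
have [_ _ /(_ x)[S0 uS0 /nbhs_singleton[S00 S01]]] := hP.
have [i hix] : exists i, h i x != 0.
  apply: contrapT => nh; move: S01; rewrite big1; first by move/eqP; rewrite eq_sym oner_eq0.
  by move=> i _; apply/eqP; apply: contrapT => /negP hi; apply: nh; exists i.
have Ax : A i x by exact: subset_closure.
have [t1 _ _] := tt i; have [_ hK _] := t1 _ (AU Ax).
have := trivialization_comb 1 1 (s x) (w x) (tt i) (AU Ax); rewrite !scale1r => E1.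
rewrite -[s x + w x]hK E1.
apply: qO => //; rewrite -/(q i); have [iS|iS] := boolP (i \in S).
  apply: le_trans (Sc i x Ax) _; apply: le_trans cS.
  by rewrite (big_rem i)//= lerDl; exact: sumr_ge0.
by rewrite (Sz i)// (trivialization0 (tt i) (AU Ax)) seminorm0.
Qed.

End Box.

Lemma existT_inj (T : Type) (P : T -> Type) (x : T) (a b : P x) :
  existT P x a = existT P x b -> a = b.
Proof.
move=> ab; pose f (s : {x & P x}) : P x :=
  if pselect (projT1 s = x) is left p then eq_rect _ P (projT2 s) _ p else a.
have := congr1 f ab; rewrite /f/=; case: pselect => // p.
by rewrite (Prop_irrelevance p erefl).
Qed.

Lemma pullback_tot_continuous (R : realType) (X' X : topologicalType) (g : X' -> X)
    (E : vfamily R X) :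
  continuous (fun z : total (pullback g E) => @tot R X E (g (tag z)) (tagged z)).
Proof.
move=> z; have H := @initial_continuous _ _ (@pullback_map R X' X g E) z.
exact: (cvg_comp _ _ H cvg_snd).
Qed.

Lemma pullback_trivialization (R : realType) (X' X : topologicalType) (g : X' -> X)
    (E : vfamily R X) (U : set X) (F : tvsType R) (h : forall x, fib E x -> F)
    (k : forall x, F -> fib E x) :
  continuous g -> continuous (@proj R X E) -> open U -> trivialization U h k ->
  @trivialization R X' (pullback g E) (g @^-1` U) F (fun x => h (g x)) (fun x => k (g x)).
Proof.
move=> cg cproj oU tt.
have oU' : open (g @^-1` U) by apply: open_comp => // z _; exact: cg.
have [t1 t2 t3] := tt; split.
- by move=> x /t1.
- have oV : open (@proj R X' (pullback g E) @^-1` (g @^-1` U)).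
    by apply: open_comp => // z _; exact: pullback_proj_continuous.
  rewrite continuous_open_subspace// => -[x e]; rewrite inE/= => Ux'.
  have H2 : (fun z : total (pullback g E) => @tot R X E (g (tag z)) (tagged z)) @
      (existT _ x e : total (pullback g E)) --> (@tot R X E (g x) e : total E).
    exact: (@pullback_tot_continuous R X' X g E (existT _ x e)).
  have oV' : open (@proj R X E @^-1` U) by apply: open_comp => // p _; exact: cproj.
  exact: (@within_open_cvg (total E) F _ _ _ _ _ (@tot R X E (g x) e) oV' t2 Ux' H2).
- have oV : open ((g @^-1` U) `*` [set: F]).
    rewrite openE => -[x v] [/= Ux' _]; exists (g @^-1` U, setT) => //=.
    by split; [exact: open_nbhs_nbhs|exact: filterT].
  rewrite continuous_open_subspace// => -[x v]; rewrite inE => -[/= Ux' _].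
  apply/(@pullback_cvg R X' X g E _ (nbhs (x, v)) _ (fun p => p.1) (fun p => k (g p.1) p.2)).
  split; first exact: cvg_fst.
  have oV' : open (U `*` [set: F]).
    rewrite openE => -[y w] [/= Uy _]; exists (U, setT) => //=.
    by split; [exact: open_nbhs_nbhs|exact: filterT].
  have H1 : (fun p : X' * F => (g p.1, p.2)) @ (x, v) --> (g x, v).
    apply: cvg_pair; last exact: cvg_snd.
    by apply: (cvg_comp _ _ (@cvg_fst _ _ _ _ _)); exact: cg.
  exact: (@within_open_cvg _ (total E) _ _ _ _ _ _ oV' t3 (conj Ux' I : (U `*` setT) (g x, v)) H1).
Qed.

Lemma pullback_vector_bundle (R : realType) (X' X : topologicalType) (g : X' -> X)
    (E : vfamily R X) : hausdorff_space X' -> continuous g -> is_vector_bundle E ->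
  is_vector_bundle (pullback g E).
Proof.
move=> hX' cg [hE cproj triv]; split; last 2 first.
- exact: pullback_proj_continuous.
- move=> x'; have [U [oU Ux [F [hF [h [k tt]]]]]] := triv (g x').
  have oU' : open (g @^-1` U) by apply: open_comp => // z _; exact: cg.
  exists (g @^-1` U); split => //.
  exists F; split => //; exists (fun x => h (g x)), (fun x => k (g x)).
  exact: pullback_trivialization.
- move=> [x e] [y f] xy.
  have H A B : nbhs x A -> nbhs y B -> exists z, A z /\ B z.
    move=> nA nB; have [[z w] [/= Az Bz]] := xy _ _ (@pullback_proj_continuous _ _ _ g E (existT _ x e) _ nA)
      (@pullback_proj_continuous _ _ _ g E (existT _ y f) _ nB).
    by exists z.
  have ? : x = y by apply: hX' => A B nA nB; have [z [? ?]] := H A B nA nB; exists z.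
  subst y; congr existT.
  have K : @tot R X E (g x) e = @tot R X E (g x) f.
    apply: hE => A B nA nB.
    have c := @pullback_tot_continuous _ _ _ g E.
    have [[z w] [/= Az Bz]] := xy _ _ (c (existT _ x e) _ nA) (c (existT _ x f) _ nB).
    by exists (@tot R X E (g z) w).
  exact: existT_inj K.
Qed.

(** * Extension of compactly supported sections *)

Section CSectionExtension.
Context {R : realType} {X : topologicalType} (Y : set X) (E : vfamily R X).
Hypotheses (hX : hausdorff_space X) (pX : paracompact X) (cY : closed Y).
Hypotheses (lX : locally_compact [set: X]) (bE : is_vector_bundle E).

Lemma restrict_vector_bundle : is_vector_bundle (restrict_bundle Y E).
Proof.
apply: pullback_vector_bundle => //; first exact: subtype_hausdorff.
exact: initial_continuous.
Qed.

Lemma compact_open_nbhs (x : X) : exists U, [/\ open U, U x & exists2 B, compact B & U `<=` B].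
Proof.
have [B nB [cB _]] := lX (x := x) I.
have {nB} : nbhs x B by apply: within_setT nB.
by rewrite {1}nbhsE => -[U [oU Ux] UB]; exists U; split => //; exists B.
Qed.

Lemma csection_extension_metrizable : metrizable R (set_type Y) -> csection_extension Y E.
Proof.
move=> mY; have [d [dd dcont dcompat]] := pseudometric_extension hX pX cY mY.
have lY := closed_locally_compact cY hX lX.
have [|x|C [oC CT CP Ct Cc]] :=
  @compact_cover_trivializations R X Y E cY bE (fun U => exists2 B, compact B & U `<=` B) _ _ lY.
- by move=> U V VU [B cB UB]; exists B => //; exact: subset_trans UB.
- exact: compact_open_nbhs.
have [|ext [e1 e2 e3 [I [A [A1 A2 A3 A4]]]]] :=
  extension_sections hX pX cY bE dd dcont dcompat oC CT Ct.
  by move=> U B CU cB BU; apply: zero_closed_compact => //; exact: Cc CU cB BU.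
have cA i : compact (A i).
  have [U CU AU] := A1 i; have [B cB UB] := CP U CU.
  by apply: (subclosed_compact (A2 i) cB); exact: subset_trans UB.
(* Only the [A i] that meet [K] can contribute, which are finitely many by local finiteness, and
   each [A i] is compact by the choice of the cover. *)
have supp (K : set Y) : compact K -> exists2 L, compact L &
    forall s : section (restrict_bundle Y E), supported K s -> supported L (ext s).
  move=> cK; have [S uS SK] := compact_locally_finite A3 (compact_set_val cK).
  exists [set x | exists2 i, i \in S & A i x]; first exact: compact_bigcup_seq.
  move=> s Ks x nx; apply/eqP; apply: contra_notT nx => /A4[i [Ax [y [Ay sy]]]].
  exists i => //; apply: contrapT => /negP iS; apply: (SK i iS (set_val y)) => //.
  by exists y => //; apply: contrapT => nKy; move: sy; rewrite Ks// eqxx.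
have csupp (s : csection (restrict_bundle Y E)) : exists2 L : set X, compact L & supported L (ext s).
  by have [K cK Ks] := csec_supported s; have [L cL KL] := supp K cK; exists L => //; exact: KL.
pose cext s : csection E := MkCSection (csupp s).
have cext_lin (a : R) (s t u : csection (restrict_bundle Y E)) :
  (forall y, u y = a *: s y + t y) -> forall x, cext u x = a *: cext s x + cext t x.
  by move=> ust x /=; exact: e2.
exists cext; split => //; last by move=> s y /=; exact: e3.
pose V1 := csections (subtype_hausdorff hX) (closed_paracompact cY pX) restrict_vector_bundle.
pose V2 := csections hX pX bE.
apply: (@csections_continuous R Y X (restrict_bundle Y E) E (subtype_hausdorff hX)
  (closed_paracompact cY pX) restrict_vector_bundle hX pX bE cext ext) => //.
  exact: csections_linear.
by move=> K cK; have [L cL KL] := supp K cK; exists L => // s Ks; exact: KL.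
Qed.

End CSectionExtension.

(** * Fibrewise smooth maps act smoothly on sections *)

Section UniformEstimates.
Context {R : realType} {X : topologicalType} {E F : tvsType R}.
Context (U : set (X * E)) (phi : X -> E -> F).
Hypotheses (hF : hausdorff_space F) (oU : open U) (sphi : psmooth U phi).

(** Turns a bound on the unit ball of [p] into a linear one. Where [p] vanishes, all multiples of
    [v] stay in the ball, so [f v] cannot be positive. *)
Lemma homogeneous_bound (f p : E -> R) : (forall v, 0 <= p v) ->
  (forall t v, f (t *: v) = `|t| * f v) -> (forall t v, p (t *: v) = `|t| * p v) ->
  (forall v, p v <= 1 -> f v <= 1) -> forall v, f v <= p v.
Proof.
move=> p0 fZ pZ H v; have [pv|pv] := eqVneq (p v) 0.
  rewrite pv; rewrite leNgt; apply/negP => fv.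
  have := H ((2 / f v) *: v); rewrite pZ fZ pv mulr0 => /(_ ler01).
  rewrite ger0_norm ?divr_ge0 ?(ltW fv)// mulfVK ?lt0r_neq0//; lra.
have pv0 : 0 < p v by rewrite lt0r pv p0.
have := H ((p v)^-1 *: v); rewrite pZ fZ ger0_norm ?invr_ge0// mulVf// => /(_ (lexx _)).
by rewrite mulrC ler_pdivrMr// mul1r.
Qed.

Lemma seminorm_finite (k : nat) (P : nat -> (E -> R) -> Prop) :
  (forall l p p', seminorm p -> seminorm p' -> (forall v, p v <= p' v) -> P l p -> P l p') ->
  (forall l, (l < k)%N -> exists2 p, seminorm p & P l p) ->
  exists2 p, seminorm p & forall l, (l < k)%N -> P l p.
Proof.
move=> mono; elim: k => [_|k IH H]; first by exists (fun=> 0); [exact: seminorm_zero|].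
have [p sp Pp] := IH (fun l lk => H l (ltnW lk)); have [p' sp' Pp'] := H k (ltnSn k).
exists (fun v => p v + p' v); first exact: seminormD.
move=> l; rewrite ltnS leq_eqVlt => /orP[/eqP->|lk].
  apply: (mono _ p') => //; first exact: seminormD.
  by move=> v; rewrite lerDr seminorm_ge0.
apply: (mono _ p) => //; [exact: seminormD| |exact: Pp].
by move=> v; rewrite lerDl seminorm_ge0.
Qed.

Context (A : set X) (u : X -> E) (a : nat -> X -> E).
Hypotheses (cA : compact A) (Uu : forall x, A x -> U (x, u x)).
Hypothesis cu : forall x, A x -> {for x, continuous u}.

Definition psmooth_bounded (a : nat -> X -> E) (k : nat) (q : F -> R) (p : E -> R) : Prop :=
  forall x w b, A x -> p w <= 1 -> (forall m, p (b m) <= 1) ->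
    U (x, u x + w) /\
    q (iter_dirderiv (phi x) (mkseq (fun m => a m x + b m) k) (u x + w)) <= 1.

(** Perturbations of the point and of all directions form one filter generated by seminorms; joint
    continuity and compactness of [A] provide a seminorm valid for every [x]. *)
Lemma psmooth_bound (a' : nat -> X -> E) k q :
  (forall m x, A x -> {for x, continuous (a' m)}) -> seminorm q ->
  (forall x, A x -> q (iter_dirderiv (phi x) (mkseq (a'^~ x) k) (u x)) < 1) ->
  exists2 p, seminorm p & psmooth_bounded a' k q p.
Proof.
move=> ca sq q1.
pose D := filter_from [set p : E -> R | seminorm p]
  (fun p => [set z : E * (nat -> E) | p z.1 <= 1 /\ forall m, p (z.2 m) <= 1]).
have FD : Filter D.
  apply: filter_from_filter; first by exists (fun=> 0); exact: seminorm_zero.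
  move=> p p' sp sp'; exists (fun v => p v + p' v); first exact: seminormD.
  move=> [w b] /= [pw pb].
  have h1 v : p v + p' v <= 1 -> p v <= 1 by apply: le_trans; rewrite lerDl seminorm_ge0.
  have h2 v : p v + p' v <= 1 -> p' v <= 1 by apply: le_trans; rewrite lerDr seminorm_ge0.
  by split; split=> [|m]; [exact: h1|exact: h1|exact: h2|exact: h2].
have D1 : (fun z : E * (nat -> E) => z.1) @ D --> (0 : E).
  by move=> V /seminorm_nbhs_le[p sp pV]; exists p => // -[w b] [/= pw _]; exact: pV.
have D2 m : (fun z : E * (nat -> E) => z.2 m) @ D --> (0 : E).
  by move=> V /seminorm_nbhs_le[p sp pV]; exists p => // -[w b] [/= _ pb]; exact: pV.
have [x Ax|p sp pH] := @near_on_compact X A (E * (nat -> E))%type D (fun z x => U (x, u x + z.1) /\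
    q (iter_dirderiv (phi x) (mkseq (fun m => a' m x + z.2 m) k) (u x + z.1)) <= 1) cA FD _.
  pose G := filter_prod D (nbhs x).
  have FG : Filter G by exact: filter_prod_filter.
  have c2 : (fun z : (E * (nat -> E)) * X => z.2) @ G --> x by exact: cvg_snd.
  have cc (f : X -> E) (g : E * (nat -> E) -> E) : {for x, continuous f} -> g @ D --> (0 : E) ->
      (fun z : (E * (nat -> E)) * X => f z.2 + g z.1) @ G --> f x.
    move=> cf cg; rewrite -[X in _ --> X]addr0; apply: tcvgD; first exact: (cvg_comp _ _ c2 cf).
    exact: (@filter_prod_fst _ _ D (nbhs x) _ g (nbhs 0) _ cg).
  pose ps : seq (((E * (nat -> E)) * X -> E) * E) :=
    mkseq (fun m => (fun z : (E * (nat -> E)) * X => a' m z.2 + z.1.2 m, a' m x)) k.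
  have pps : tcvgs G ps.
    rewrite /ps /mkseq; apply: Fall_map; apply: Fall_all => m /=.
    exact: (cc (a' m) (fun z => z.2 m) (ca m x Ax) (D2 m)).
  have cuw := cc u (fun z => z.1) (cu Ax) D1.
  have := sphi.2 _ G (fun z => z.2) (fun z => u z.2 + z.1.1) x (u x) ps FG (Uu Ax) c2 cuw pps.
  have -> : [seq p.2 | p <- ps] = mkseq (a'^~ x) k by rewrite /ps /mkseq -map_comp.
  move=> H; have [[P1 Q1] [/= DP1 nQ1] PQ1] := seminorm_cvg sq H (q1 x Ax).
  have [[P2 Q2] [/= DP2 nQ2] PQ2] := psmooth_near oU FG (Uu Ax) c2 cuw.
  exists (Q1 `&` Q2); first exact: filterI.
  exists (P1 `&` P2); first exact: filterI.
  move=> z y [Pz1 Pz2] [Qy1 Qy2] _; split; first exact: (PQ2 (z, y)).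
  have := PQ1 (z, y) (conj Pz1 Qy1); rewrite /= /ps /mkseq -map_comp; exact.
by exists p => // x w b Ax pw pb; exact: (pH (w, b)).
Qed.

Lemma psmooth_bounded_mono k a' q p p' : (forall v, p v <= p' v) ->
  psmooth_bounded a' k q p -> psmooth_bounded a' k q p'.
Proof.
move=> pp H x w b Ax pw pb; apply: H => //; first exact: le_trans pw.
by move=> m; exact: le_trans (pb m).
Qed.

Lemma mkseq_split (T : Type) (f : nat -> T) l k : (l < k)%N ->
  mkseq f k = mkseq f l ++ f l :: [seq f m | m <- iota l.+1 (k - l.+1)].
Proof.
move=> lk; rewrite /mkseq -{1}(subnKC lk) addSnnS iotaD map_cat.
by rewrite add0n /=.
Qed.

Hypothesis ca : forall m x, A x -> {for x, continuous (a m)}.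

(* The first summand bounds the change of the base point (mean value estimate
   along a segment), the others the change of each direction (telescoping). *)
Lemma psmooth_estimate k q : seminorm q ->
  exists2 p, seminorm p & forall x w b, A x -> p w <= 1 -> (forall m, p (b m) <= 1) ->
    U (x, u x + w) /\
    q (iter_dirderiv (phi x) (mkseq (fun m => a m x + b m) k) (u x + w) -
       iter_dirderiv (phi x) (mkseq (a^~ x) k) (u x)) <= p w + \sum_(l < k) p (b l).
Proof.
move=> sq; have [qD qZ _] := sq.
(* A zero in the slot of interest makes the derivative vanish, so [psmooth_bound] applies;
   perturbing that slot gives a bound on a unit ball, hence a linear one by homogeneity. [a0]
   prepends a slot for the displacement of the base point, [al l] clears slot [l]. *)
pose a0 m x := if m is m'.+1 then a m' x else 0.
pose al l m x := if m == l then 0 else a m x.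
have [p0 sp0 H0] : exists2 p, seminorm p & psmooth_bounded a0 k.+1 q p.
  apply: psmooth_bound => //.
    by move=> [|m] x Ax; [exact: cvg_cst|exact: ca].
  move=> x Ax; have -> : mkseq (a0^~ x) k.+1 = 0 :: mkseq (a^~ x) k.
    by rewrite /mkseq /= -[1%N]addn0 iotaDl -map_comp.
  by rewrite (psmooth_slot0 hF oU sphi [::])// ?seminorm0//; exact: Uu.
have [p1 sp1 H1] : exists2 p, seminorm p & forall l, (l < k)%N -> psmooth_bounded (al l) k q p.
  apply: seminorm_finite => [l p p' _ _ pp|l lk]; first exact: psmooth_bounded_mono.
  apply: psmooth_bound => //.
    by move=> m x Ax; rewrite /al; case: eqP => _; [exact: cvg_cst|exact: ca].
  move=> x Ax; rewrite (mkseq_split _ lk) {2}/al eqxx.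
  by rewrite (psmooth_slot0 hF oU sphi)// ?seminorm0//; exact: Uu.
exists (fun v => p0 v + p1 v); first exact: seminormD.
move=> x w b Ax pw pb.
have p0w : p0 w <= 1 by apply: le_trans pw; rewrite lerDl seminorm_ge0.
have p1w : p1 w <= 1 by apply: le_trans pw; rewrite lerDr seminorm_ge0.
have p1b m : p1 (b m) <= 1 by apply: le_trans (pb m); rewrite lerDr seminorm_ge0.
have zb (p : E -> R) : seminorm p -> p 0 <= 1.
  by move=> sp; rewrite seminorm0// ler01.
have U0 w' : p0 w' <= 1 -> U (x, u x + w').
  by move=> pw'; have [] := H0 x w' (fun=> 0) Ax pw' (fun=> zb p0 sp0).
split; first exact: U0.
(* Interpolates between the two lists of directions: the first [l] entries are already perturbed. *)
pose M l m := if (m < l)%N then a m x + b m else a m x.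
pose f l := iter_dirderiv (phi x) (mkseq (M l) k) (u x + w).
have fk : iter_dirderiv (phi x) (mkseq (fun m => a m x + b m) k) (u x + w) = f k.
  rewrite /f; congr (iter_dirderiv _ _ _); apply/eq_in_map => m.
  by rewrite mem_iota add0n /M => /= ->.
have f0 : f 0%N = iter_dirderiv (phi x) (mkseq (a^~ x) k) (u x + w) by [].
have step l : (l < k)%N -> q (f l.+1 - f l) <= p1 (b l).
  move=> lk; pose c := mkseq (M l) l; pose d := [seq a m x | m <- iota l.+1 (k - l.+1)].
  have dE n : (n <= l.+1)%N -> [seq M n m | m <- iota l.+1 (k - l.+1)] = d.
    move=> nl; apply/eq_in_map => m; rewrite mem_iota => /andP[lm _].
    by rewrite /M ltnNge (leq_trans nl (lm))//.
  have cE n : (l <= n)%N -> mkseq (M n) l = c.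
    move=> ln; apply/eq_in_map => m; rewrite mem_iota add0n => /= ml.
    by rewrite /M ml (leq_trans ml ln).
  have -> : f l.+1 - f l = iter_dirderiv (phi x) (c ++ b l :: d) (u x + w).
    rewrite /f !(mkseq_split _ lk) !dE// !cE// /M ltnSn ltnn.
    by rewrite (psmooth_slot_add hF oU sphi)//; [rewrite addrC addKr|exact: U0].
  pose fl v := q (iter_dirderiv (phi x) (c ++ v :: d) (u x + w)).
  have := @homogeneous_bound fl p1 (fun v => seminorm_ge0 v sp1) _ _ _ (b l); apply.
  - by move=> t v; rewrite /fl (psmooth_slot_scale hF oU sphi) ?qZ//; exact: U0.
  - by case: sp1.
  - move=> v pv.
    pose b' m := if (m < l)%N then b m else if m == l then v else 0.
    have pb' m : p1 (b' m) <= 1.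
      by rewrite /b'; case: ifP => // _; case: ifP => // _; rewrite seminorm0// ler01.
    have [_] := H1 l lk x w b' Ax p1w pb'; rewrite /fl (mkseq_split _ lk).
    have -> : mkseq (fun m => al l m x + b' m) l = c.
      apply/eq_in_map => m; rewrite mem_iota add0n => /= ml.
      by rewrite /al /b' /M ml; case: eqP => // ml'; move: ml; rewrite ml' ltnn.
    have -> : [seq al l m x + b' m | m <- iota l.+1 (k - l.+1)] = d.
      apply/eq_in_map => m; rewrite mem_iota => /andP[lm _].
      rewrite /al /b' ltnNge (ltnW lm)/=; case: eqP => [ml|]; last by rewrite addr0.
      by move: lm; rewrite ml ltnn.
    by rewrite /al /b' eqxx ltnn add0r.
have tele n : (n <= k)%N -> q (f n - f 0%N) <= \sum_(l < n) p1 (b l).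
  elim: n => [_|n IH nk]; first by rewrite subrr seminorm0// big_ord0.
  rewrite big_ord_recr/=.
  have -> : f n.+1 - f 0%N = (f n - f 0%N) + (f n.+1 - f n) by rewrite [RHS]addrC addrA subrK.
  by apply: le_trans (qD _ _) _; apply: lerD; [exact: IH (ltnW nk)|exact: step].
have base : q (f 0%N - iter_dirderiv (phi x) (mkseq (a^~ x) k) (u x)) <= p0 w.
  rewrite f0 -[X in q X]subr0; apply: segment_mvt => // t /andP[t0 t1].
  have ptw : p0 (t *: w) <= 1.
    have [_ pZ _] := sp0; rewrite pZ ger0_norm//.
    by apply: mulr_ile1 => //; exact: seminorm_ge0.
  exists (iter_dirderiv (phi x) (w :: mkseq (a^~ x) k) (u x + t *: w)).
    exact: (psmooth_deriv sphi _ _ (U0 _ ptw)).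
  rewrite subr0.
  pose fl v := q (iter_dirderiv (phi x) (v :: mkseq (a^~ x) k) (u x + t *: w)).
  have := @homogeneous_bound fl p0 (fun v => seminorm_ge0 v sp0) _ _ _ w; apply.
  - by move=> s v; rewrite /fl (psmooth_slot_scale hF oU sphi [::]) ?qZ//; exact: U0.
  - by case: sp0.
  - move=> v pv; pose b' m := if m is 0%N then v else 0.
    have pb' m : p0 (b' m) <= 1 by case: m => [|m] //=; rewrite seminorm0// ler01.
    have [_] := H0 x (t *: w) b' Ax ptw pb'; rewrite /fl.
    have -> // : mkseq (fun m => a0 m x + b' m) k.+1 = v :: mkseq (a^~ x) k.
    rewrite /mkseq /= add0r -[1%N]addn0 iotaDl -map_comp; congr cons.
    by apply: eq_map => m /=; rewrite addr0.
rewrite fk.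
have -> : f k - iter_dirderiv (phi x) (mkseq (a^~ x) k) (u x) =
    (f k - f 0%N) + (f 0%N - iter_dirderiv (phi x) (mkseq (a^~ x) k) (u x)) by rewrite addrA subrK.
apply: le_trans (qD _ _) _; apply: le_trans (lerD (tele k (leqnn k)) base) _.
rewrite big_split/=; have := seminorm_ge0 w sp1.
have : 0 <= \sum_(l < k) p0 (b l) by apply: sumr_ge0 => l _; exact: seminorm_ge0.
lra.
Qed.

End UniformEstimates.

Section SupportedConvergence.
Context {R : realType} {X : topologicalType} {E : vfamily R X}.
Context (hX : hausdorff_space X) (pX : paracompact X) (bE : is_vector_bundle E).
Local Notation V := (csections hX pX bE).

(** While the difference stays supported in one compact set, the direct limit topology is tested by
    the compact-open one. This is the situation of difference quotients. *)
Lemma csections_cvg_supported (Z : Type) (D : set_system Z) (FD : Filter D) (f : Z -> V)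
    (l : V) (K : set X) : compact K ->
  D [set z | supported K (f z - l : V)] ->
  (fun z => csec (f z)) @ D --> csec l -> f @ D --> l.
Proof.
move=> cK Kf fl B /csection_nbhs[W lW WB]; have [_ /(_ K cK)[G [oG G0] GW]] := lW.
have cl : (fun z => section_comb bE 1 (-1) (csec (f z)) (csec l)) @ D -->
    section_comb bE 1 (-1) (csec l) (csec l).
  exact: (@section_comb_cvg R X E bE Z D FD (fun=> 1) (fun=> -1) (fun z => csec (f z)) (fun=> csec l)
    1 (-1) (csec l) (csec l) hX pX (cvg_cst _) (cvg_cst _) fl (cvg_cst _)).
have Gl : G (section_comb bE 1 (-1) (csec l) (csec l)).
  by apply: G0 => x /=; rewrite scale1r scaleN1r subrr.
have DG := cl _ (open_nbhs_nbhs (conj oG Gl)).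
suff : D [set z | B (f z)] by [].
apply: (filter_imp2 FD Kf DG) => z /= Kz Gz.
have := WB (f z - l : V); rewrite subrKC; apply; apply: GW => //.
rewrite (_ : csec (f z - l : V) = section_comb bE 1 (-1) (csec (f z)) (csec l)); first exact: Gz.
by apply: section_eq => x; rewrite csectionsDE csectionsNE /= scale1r scaleN1r.
Qed.

End SupportedConvergence.

Section BoxCommon.
Context {R : realType} {X : topologicalType} {E : vfamily R X}.
Context (hX : hausdorff_space X) (pX : paracompact X) (bE : is_vector_bundle E).
Local Notation V := (csections hX pX bE).
Context (I : choiceType) (h : I -> X -> R) (U : I -> set X) (F : I -> tvsType R).
Context (th : forall i x, fib E x -> F i) (tg : forall i x, F i -> fib E x).
Arguments th : clear implicits.
Arguments tg : clear implicits.
Local Notation A i := (closure [set x | h i x != 0]).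
Hypotheses (AU : forall i, A i `<=` U i) (tt : forall i, trivialization (U i) (th i) (tg i)).

(** A common list of members lets the bounds of finitely many sections be added member by member. *)
Lemma box_common (q : forall i, F i -> R) (n : nat) (w : 'I_n -> V) :
  (forall i, seminorm (q i)) -> (forall l, box h th q (w l)) ->
  exists (T : seq I) (c : 'I_n -> I -> R), [/\ uniq T, forall l i, 0 <= c l i,
    forall l, \sum_(i <- T) c l i <= 1, forall l i x, i \notin T -> A i x -> w l x = 0 &
    forall l i x, A i x -> q i (th i x (w l x)) <= c l i].
Proof.
move=> sq /choice[S SP]; have /choice[c cP] := SP.
pose T := undup (flatten [seq S l | l <- enum 'I_n]).
have ST l i : i \in S l -> i \in T.
  move=> iS; rewrite mem_undup; apply/flattenP; exists (S l) => //.
  by apply: map_f; rewrite mem_enum.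
exists T, (fun l i => if i \in S l then c l i else 0); split.
- exact: undup_uniq.
- by move=> l i; case: ifP => // _; have [_] := cP l.
- move=> l; have [uS c0 cS _ _] := cP l; rewrite -big_mkcond/= -big_filter.
  apply: le_trans cS; rewrite (perm_big (S l))//; apply: uniq_perm => //.
    by apply: filter_uniq; exact: undup_uniq.
  by move=> i; rewrite mem_filter; case: (boolP (i \in S l)) => //= /ST->.
- move=> l i x iT Ax; have [_ _ _ Sz _] := cP l; apply: Sz Ax.
  by apply: contra iT; exact: ST.
- move=> l i x Ax; have [_ _ _ Sz Sc] := cP l; case: ifPn => iS; first exact: Sc.
  by rewrite (Sz i)// (trivialization0 (tt i) (AU Ax)) seminorm0.
Qed.

End BoxCommon.

Lemma trivialization_preimage_open (R : realType) (X : topologicalType) (E : vfamily R X)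
    (U : set X) (F : tvsType R) (h : forall x, fib E x -> F) (g : forall x, F -> fib E x)
    (B : set (total E)) : open U -> trivialization U h g -> open B ->
  open [set p : X * F | U p.1 /\ B (tot (g p.1 p.2))].
Proof.
move=> oU [_ _ t3] oB.
have oV : open (U `*` [set: F]).
  rewrite openE => -[y w] [/= Uy _]; exists (U, setT) => //=.
  by split; [exact: open_nbhs_nbhs|exact: filterT].
rewrite openE => -[x u] [/= Ux Bu].
have H := within_open_cvg oV t3 (conj Ux I : (U `*` setT) (x, u)) cvg_id.
have nB : nbhs (x, u) [set p : X * F | B (tot (g p.1 p.2))].
  exact: (H _ (open_nbhs_nbhs (conj oB Bu))).
have nU : nbhs (x, u) (U `*` [set: F]) by exact: open_nbhs_nbhs.
by apply: (filter_imp2 _ nB nU) => -[y v] /= ? [].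
Qed.

Section FibrewiseSmooth.
Context {R : realType} {X : topologicalType} (E1 E2 : vfamily R X).
Context (O1 : set (total E1)) (D : forall x, seq (fib E1 x) -> fib E1 x -> fib E2 x).
Arguments D : clear implicits.

(* [D x vs u] plays the role of the iterated directional derivative at [u] of
   the fibre map [D x [::]]; [Phi] is the representation of these maps in the
   trivializations. *)
Definition fibrewise_chart (U : set X) (F1 F2 : tvsType R)
    (h1 : forall x, fib E1 x -> F1) (g1 : forall x, F1 -> fib E1 x)
    (h2 : forall x, fib E2 x -> F2) (g2 : forall x, F2 -> fib E2 x)
    (Phi : X -> F1 -> F2) : Prop :=
  [/\ hausdorff_space F2, trivialization U h1 g1, trivialization U h2 g2,
      psmooth [set p : X * F1 | U p.1 /\ O1 (tot (g1 p.1 p.2))] Phi &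
      forall x u vs, U x -> O1 (tot u) ->
        h2 x (D x vs u) = iter_dirderiv (Phi x) [seq h1 x v | v <- vs] (h1 x u)].

Definition fibrewise_smooth : Prop :=
  forall x, exists U, [/\ open U, U x & exists F1 F2 h1 g1 h2 g2 Phi,
    @fibrewise_chart U F1 F2 h1 g1 h2 g2 Phi].

Context (bE1 : is_vector_bundle E1) (bE2 : is_vector_bundle E2) (oO1 : open O1).

Section Local.
Context (U : set X) (F1 F2 : tvsType R).
Context (h1 : forall x, fib E1 x -> F1) (g1 : forall x, F1 -> fib E1 x).
Context (h2 : forall x, fib E2 x -> F2) (g2 : forall x, F2 -> fib E2 x).
Context (Phi : X -> F1 -> F2).
Arguments h1 : clear implicits.
Arguments g1 : clear implicits.
Arguments h2 : clear implicits.
Arguments g2 : clear implicits.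
Hypotheses (oU : open U) (fc : fibrewise_chart U h1 g1 h2 g2 Phi).

Lemma fibrewise_chart_open : open [set p : X * F1 | U p.1 /\ O1 (tot (g1 p.1 p.2))].
Proof. by have [_ t1 _ _ _] := fc; exact: (trivialization_preimage_open oU t1 oO1). Qed.

Lemma fibrewise_chart_domain x (u : fib E1 x) : U x -> O1 (tot u) ->
  [set p : X * F1 | U p.1 /\ O1 (tot (g1 p.1 p.2))] (x, h1 x u).
Proof. by move=> Ux Ou; split => //=; have [_ [/(_ x Ux)[_ hK _] _ _] _ _ _] := fc; rewrite hK. Qed.

Lemma fibrewise_cvg (Z : Type) (G : set_system Z) (FG : Filter G) (xs : Z -> X) (x0 : X)
    (u : forall z, fib E1 (xs z)) (u0 : fib E1 x0)
    (vs : seq ((forall z, fib E1 (xs z)) * fib E1 x0)) : U x0 -> O1 (tot u0) ->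
  (fun z => tot (u z)) @ G --> (tot u0 : total E1) ->
  Fall (fun v => (fun z => tot (v.1 z)) @ G --> (tot v.2 : total E1)) vs ->
  (fun z => tot (D (xs z) [seq v.1 z | v <- vs] (u z))) @ G -->
    (tot (D x0 [seq v.2 | v <- vs] u0) : total E2).
Proof.
move=> Ux Ou cu cvs; have [_ c1 _] := bE1; have [_ c2 _] := bE2.
have [_ t1 t2 sPhi DPhi] := fc.
have [xx hu] := (tot_cvg _ _ c1 oU Ux t1).1 cu.
apply/(tot_cvg _ _ c2 oU Ux t2); split => //.
rewrite DPhi//.
pose ps : seq ((Z -> F1) * F1) := [seq (fun z => h1 _ (v.1 z), h1 _ v.2) | v <- vs].
have pps : tcvgs G ps.
  apply: Fall_map; apply: Fall_imp cvs => v cv.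
  by have [_ ] := (tot_cvg _ _ c1 oU Ux t1).1 cv.
have H := sPhi.2 _ _ _ _ _ _ _ FG (fibrewise_chart_domain Ux Ou) xx hu pps.
rewrite -map_comp in H.
have HU : G [set z | U (xs z)] by exact: (xx _ (open_nbhs_nbhs (conj oU Ux))).
have HO : G [set z | O1 (tot (u z))] by exact: (cu _ (open_nbhs_nbhs (conj oO1 Ou))).
rewrite -map_comp; apply: (cvg_congr H); apply: (filter_imp2 _ HU HO) => z Uz Oz /=.
by rewrite DPhi// -!map_comp.
Qed.

Lemma fibrewise_slot0 x (c d : seq (fib E1 x)) (u : fib E1 x) : U x -> O1 (tot u) ->
  D x (c ++ 0 :: d) u = 0.
Proof.
move=> Ux Ou; have [hF2 t1 t2 sPhi DPhi] := fc; have [t21 _ _] := t2.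
have [_ hK _] := t21 _ Ux; apply: (can_inj hK).
rewrite (trivialization0 t2 Ux) DPhi// map_cat /= (trivialization0 t1 Ux).
exact: (psmooth_slot0 hF2 fibrewise_chart_open sPhi _ _ (fibrewise_chart_domain Ux Ou)).
Qed.

Lemma fibrewise_quot (Z : Type) (G : set_system Z) (FG : Filter G) (xs : Z -> X) (x0 : X)
    (t : Z -> R) (u r : forall z, fib E1 (xs z)) (u0 r0 : fib E1 x0)
    (vs : seq ((forall z, fib E1 (xs z)) * fib E1 x0)) : U x0 -> O1 (tot u0) ->
  t @ G --> (0 : R) -> G [set z | t z != 0] ->
  (fun z => tot (u z)) @ G --> (tot u0 : total E1) ->
  (fun z => tot (r z)) @ G --> (tot r0 : total E1) ->
  Fall (fun v => (fun z => tot (v.1 z)) @ G --> (tot v.2 : total E1)) vs ->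
  (fun z => tot ((t z)^-1 *: (D (xs z) [seq v.1 z | v <- vs] (u z + t z *: r z) -
     D (xs z) [seq v.1 z | v <- vs] (u z)))) @ G -->
    (tot (D x0 (r0 :: [seq v.2 | v <- vs]) u0) : total E2).
Proof.
move=> Ux Ou ct t0 cu cr cvs; have [_ c1 _] := bE1; have [_ c2 _] := bE2.
have [_ t1 t2 sPhi DPhi] := fc.
have [xx hu] := (tot_cvg _ _ c1 oU Ux t1).1 cu.
have [_ hr] := (tot_cvg _ _ c1 oU Ux t1).1 cr.
apply/(tot_cvg _ _ c2 oU Ux t2); split => //.
rewrite DPhi//.
pose ps : seq ((Z -> F1) * F1) := [seq (fun z => h1 _ (v.1 z), h1 _ v.2) | v <- vs].
have pps : tcvgs G ps.
  apply: Fall_map; apply: Fall_imp cvs => v cv.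
  by have [_ ] := (tot_cvg _ _ c1 oU Ux t1).1 cv.
have H := psmooth_quot fibrewise_chart_open sPhi FG (fibrewise_chart_domain Ux Ou) xx hu hr ct t0 pps.
rewrite -map_comp in H; rewrite /= -map_comp.
have HU : G [set z | U (xs z)] by exact: (xx _ (open_nbhs_nbhs (conj oU Ux))).
have HO : G [set z | O1 (tot (u z))] by exact: (cu _ (open_nbhs_nbhs (conj oO1 Ou))).
have cut : (fun z => tot (1 *: u z + t z *: r z)) @ G --> (tot (1 *: u0 + 0 *: r0) : total E1).
  by apply: (bundle_comb_cvg bE1) => //; exact: cvg_cst.
have Ou' : O1 (tot (1 *: u0 + 0 *: r0)) by rewrite scale1r scale0r addr0.
have HO' : G [set z | O1 (tot (1 *: u z + t z *: r z))] by exact: (cut _ (open_nbhs_nbhs (conj oO1 Ou'))).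
have HUO := @filterI _ _ FG _ _ HU HO.
apply: (cvg_congr H); apply: (filter_imp2 _ HUO HO') => z [/= Uz Oz]; rewrite scale1r => Oz' /=.
have hl a b v v' := trivialization_comb a b (v : fib E2 (xs z)) v' t2 Uz.
have -> (v v' : fib E2 (xs z)) (a : R) : h2 _ (a *: (v - v')) = a *: (h2 _ v - h2 _ v').
  have := hl a (- a) v v'; rewrite !scaleNr -!scalerBr; exact.
rewrite !DPhi// -!map_comp.
by have := trivialization_comb 1 (t z) (u z) (r z) t1 Uz; rewrite !scale1r => ->.
Qed.

End Local.
End FibrewiseSmooth.

(** * Push-forward of compactly supported sections *)

Section Pushforward.
Context {R : realType} {X : topologicalType} {E1 E2 : vfamily R X}.
Context (hX : hausdorff_space X) (pX : paracompact X) (lX : locally_compact [set: X]).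
Context (bE1 : is_vector_bundle E1) (bE2 : is_vector_bundle E2).
Local Notation V1 := (csections hX pX bE1).
Local Notation V2 := (csections hX pX bE2).
Context (O1 : set (total E1)) (D : forall x, seq (fib E1 x) -> fib E1 x -> fib E2 x).
Arguments D : clear implicits.
Hypotheses (oO1 : open O1) (fs : fibrewise_smooth O1 D).
Context (M1 M2 : tvsType R) (rho : M1 -> V1) (i2 : V2 -> M2) (W : set M1) (G : M1 -> M2).
Hypotheses (hM2 : hausdorff_space M2) (lrho : linear rho) (crho : continuous rho).
Hypotheses (li2 : linear i2) (ci2 : continuous i2) (oW : open W).
Hypothesis rhoO : forall m, W m -> forall x, O1 (tot (rho m x)).
(** Compact support of the pushed section is assumed, because [D x [::]] need not map zero to zero.
    For derivatives it follows from the support of a direction, by [push_zero]. *)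
Hypothesis GE : forall m, W m -> exists2 P : V2, (forall x, P x = D x [::] (rho m x)) & G m = i2 P.

Definition is_push (s : V1) (vs : seq V1) (P : V2) : Prop :=
  forall x, P x = D x [seq (v : V1) x | v <- vs] (s x).

Definition push (s : V1) (vs : seq V1) : V2 := xget 0 [set P | is_push s vs P].

Lemma push_section_continuous (s : V1) (vs : seq V1) : (forall x, O1 (tot (s x))) ->
  continuous (fun x => tot (D x [seq (v : V1) x | v <- vs] (s x))).
Proof.
move=> Os x0; have [U [oU Ux [F1 [F2 [h1 [g1 [h2 [g2 [Phi fc]]]]]]]]] := fs x0.
pose vs' : seq ((forall z, fib E1 z) * fib E1 x0) := [seq (fun z => (v : V1) z, (v : V1) x0) | v <- vs].
have cvs : Fall (fun v => (fun z => tot (v.1 z)) @ x0 --> (tot v.2 : total E1)) vs'.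
  by apply: Fall_map; apply: Fall_all => v; exact: (@sec_continuous _ _ _ (v : V1)).
have H := fibrewise_cvg bE1 bE2 oO1 oU fc (nbhs_filter x0) Ux (Os x0) (@sec_continuous _ _ _ s x0) cvs.
rewrite -map_comp in H; apply: (cvg_congr H).
by apply: filterE => z /=; rewrite /vs' -map_comp.
Qed.

Lemma push_zero (x : X) (c d : seq (fib E1 x)) (u : fib E1 x) : O1 (tot u) -> D x (c ++ 0 :: d) u = 0.
Proof.
have [U [oU Ux [F1 [F2 [h1 [g1 [h2 [g2 [Phi fc]]]]]]]]] := fs x.
exact: (fibrewise_slot0 oO1 oU fc).
Qed.

Lemma pushP m vs : W m -> is_push (rho m) vs (push (rho m) vs).
Proof.
move=> Wm; suff [P HP] : exists P, is_push (rho m) vs P.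
  by apply: (@xgetPex _ 0 [set P | is_push (rho m) vs P]); exists P.
case: vs => [|v vs]; first by have [P HP _] := GE Wm; exists P.
have cs := @push_section_continuous (rho m) (v :: vs) (rhoO Wm).
have sup : exists2 K : set X, compact K & supported K (MkSection cs).
  have [K cK Kv] := csec_supported v; exists K => // x nK /=.
  by rewrite (Kv x nK); apply: (push_zero [::]); exact: rhoO.
by exists (MkCSection sup).
Qed.

Let L : {linear M1 -> V1} := HB.pack rho (GRing.isLinear.Build _ _ _ _ _ lrho).
Let L2 : {linear V2 -> M2} := HB.pack i2 (GRing.isLinear.Build _ _ _ _ _ li2).

(** The difference quotient and its limit vanish off the support of [rho w], so compact-open
    convergence suffices; this is local and given by [fibrewise_quot]. *)
Lemma push_deriv m w vs : W m ->
  is_dirderiv (fun m => i2 (push (rho m) vs)) m w (i2 (push (rho m) (rho w :: vs))).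
Proof.
move=> Wm.
have FD : Filter ((0 : R)^') by exact: within_filter.
suff H : (fun t : R => t^-1 *: (push (rho (m + t *: w)) vs - push (rho m) vs)) @ (0 : R)^' -->
    push (rho m) (rho w :: vs).
  have H2 := cvg_comp _ _ H (@ci2 _); apply: (cvg_congr H2).
  by apply: filterE => t /=; rewrite -[i2]/(L2 : _ -> _) linearZ linearB.
have nW : (0 : R)^' [set t | W (m + t *: w)].
  exact: (@cvg_line R M1 m w _ (open_nbhs_nbhs (conj oW Wm))).
have [K cK Kw] := csec_supported (rho w).
have rE t x : rho (m + t *: w) x = rho m x + t *: rho w x.
  by rewrite -[rho]/(L : _ -> _) linearD linearZ csectionsDE csectionsZE.
have P0 := pushP vs Wm; have P1 := pushP (rho w :: vs) Wm.
apply: (csections_cvg_supported FD cK).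
  apply: (filter_imp _ nW) => t Wt x nK.
  rewrite csectionsDE csectionsNE csectionsZE csectionsDE csectionsNE.
  rewrite (P0 x) (P1 x) (pushP vs Wt x) rE (Kw x nK) scaler0 addr0 subrr scaler0 add0r.
  rewrite /= (Kw x nK) (_ : D x _ _ = 0) ?oppr0//.
  by apply: (push_zero [::]); exact: rhoO.
apply: section_cvg => K0 x0 cK0 Kx0.
have [U [oU Ux [F1 [F2 [h1 [g1 [h2 [g2 [Phi fc]]]]]]]]] := fs x0.
pose Q := filter_prod ((0 : R)^') (within K0 (nbhs x0)).
have FK : Filter (within K0 (nbhs x0)) by exact: within_filter.
have FQ : Filter Q by exact: filter_prod_filter.
have c2 : (fun p : R * X => p.2) @ Q --> x0 by exact: filter_prod_snd.
have ct : (fun p : R * X => p.1) @ Q --> (0 : R).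
  exact: (@filter_prod_fst _ _ _ _ _ id (nbhs (0 : R)) FK cvg_dnbhs0).
have tQ (P : set R) : ((0 : R)^') P -> Q [set p | P p.1].
  by move=> HP; exists (P, setT); [split => //; exact: filterT|move=> [t x] []].
have sc (v : V1) : (fun p : R * X => tot (v p.2)) @ Q --> (tot (v x0) : total E1).
  exact: (cvg_comp _ _ c2 (@sec_continuous _ _ _ v x0)).
pose vs' : seq ((forall z : R * X, fib E1 z.2) * fib E1 x0) :=
  [seq (fun z => (v : V1) z.2, (v : V1) x0) | v <- vs].
have cvs : Fall (fun v => (fun z => tot (v.1 z)) @ Q --> (tot v.2 : total E1)) vs'.
  by apply: Fall_map; apply: Fall_all => v; exact: sc.
have H := fibrewise_quot bE1 bE2 oO1 oU fc FQ Ux (rhoO Wm x0) ct (tQ _ dnbhs0_neq0) (sc (rho m))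
  (sc (rho w)) cvs.
rewrite -map_comp in H.
have -> : push (rho m) (rho w :: vs) x0 = D x0 (rho w x0 :: [seq (v : V1) x0 | v <- vs]) (rho m x0).
  exact: P1.
apply: (cvg_congr H); apply: (filter_imp _ (tQ _ nW)) => -[t x] /= Wt.
by rewrite !scale0r !addr0 !scale1r scaleN1r (P0 x) (pushP vs Wt x) rE /vs' -map_comp.
Qed.

Lemma push_iter_dirderiv ws m : W m ->
  iter_dirderiv G ws m = i2 (push (rho m) [seq rho w | w <- ws]).
Proof.
elim: ws m => [|w ws IH] m Wm.
  have [P HP GP] := GE Wm; rewrite -[LHS]/(G m) GP; congr i2; apply: csection_eq => x; rewrite HP.
  by rewrite (pushP [::] Wm x).
rewrite iter_dirderiv_cons; apply: (dirderiv_unique hM2).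
apply: (is_dirderiv_near (@push_deriv m w [seq rho w | w <- ws] Wm)).
have nW : nbhs m W by exact: open_nbhs_nbhs.
by apply: filterS nW => y Wy; rewrite IH.
Qed.

(** Local compactness makes the supports compact, as boxes and uniform estimates require. Model
    spaces vary with the index, hence the choice of dependent tuples. *)
Lemma push_covering : exists (I : choiceType) (h : I -> X -> R) (U : I -> set X)
    (F1 F2 : I -> tvsType R) (h1 : forall i x, fib E1 x -> F1 i) (g1 : forall i x, F1 i -> fib E1 x)
    (h2 : forall i x, fib E2 x -> F2 i) (g2 : forall i x, F2 i -> fib E2 x)
    (Phi : forall i, X -> F1 i -> F2 i),
  [/\ is_partition_of_unity h,
      forall i, open (U i) /\ compact (closure [set x | h i x != 0]),
      forall i, closure [set x | h i x != 0] `<=` U i &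
      forall i, fibrewise_chart O1 D (U i) (h1 i) (g1 i) (h2 i) (g2 i) (Phi i)].
Proof.
pose C := [set U' : set X | open U' /\ ((exists2 B, compact B & U' `<=` B) /\
  exists U, [/\ open U, U' `<=` U & exists F1 F2 h1 g1 h2 g2 Phi,
    @fibrewise_chart R X E1 E2 O1 D U F1 F2 h1 g1 h2 g2 Phi])].
have [||I [h [hP hC]]] := @partition_of_unity R X hX pX C.
- by move=> U' [].
- apply/seteqP; split => // x _; have [U [oU Ux H]] := fs x.
  have [U' [oU' U'x [B cB UB]]] := compact_open_nbhs lX x.
  exists (U `&` U') => //; split; first exact: openI.
  split; first by exists B => // y [_ /UB].
  by exists U; split => // y [].
have data i : exists Q : {FF : tvsType R * tvsType R & ((forall x, fib E1 x -> FF.1) *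
    (forall x, FF.1 -> fib E1 x) * (forall x, fib E2 x -> FF.2) * (forall x, FF.2 -> fib E2 x) *
    (X -> FF.1 -> FF.2))%type}, exists U, [/\ open U, closure [set x | h i x != 0] `<=` U &
    fibrewise_chart O1 D U (projT2 Q).1.1.1.1 (projT2 Q).1.1.1.2 (projT2 Q).1.1.2 (projT2 Q).1.2
      (projT2 Q).2].
  have [U' [_ [_ [U [oU UU [F1 [F2 [h1 [g1 [h2 [g2 [Phi fc]]]]]]]]]]] AU] := hC i.
  exists (existT _ (F1, F2) (h1, g1, h2, g2, Phi)), U; split => //; exact: subset_trans UU.
have [Q QP] := choice data; have [U UP] := choice QP.
exists I, h, U, (fun i => (projT1 (Q i)).1), (fun i => (projT1 (Q i)).2).
exists (fun i => (projT2 (Q i)).1.1.1.1), (fun i => (projT2 (Q i)).1.1.1.2).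
exists (fun i => (projT2 (Q i)).1.1.2), (fun i => (projT2 (Q i)).1.2), (fun i => (projT2 (Q i)).2).
split => //; try by move=> i; have [] := UP i.
move=> i; split; first by have [] := UP i.
have [U' [_ [[B cB UB] _]] AU] := hC i; apply: (subclosed_compact _ cB); first exact: closed_closure.
exact: subset_trans UB.
Qed.

(** Nearness must be shown in the sense of boxes. The linear estimate of [psmooth_estimate] on each
    compact support turns summable bounds on the variations of base section and directions into a
    summable bound on the variation of the result. *)
Lemma push_cvg k (vs0 : nat -> V1) m0 (Z : Type) (Q : set_system Z) (FQ : Filter Q)
    (m : Z -> M1) (vs : Z -> nat -> V1) : W m0 -> m @ Q --> m0 ->
  (forall l, (fun z => vs z l) @ Q --> vs0 l) ->
  (fun z => push (rho (m z)) (mkseq (vs z) k)) @ Q --> push (rho m0) (mkseq vs0 k).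
Proof.
move=> Wm0 cm cvs.
have [I [h [U [F1 [F2 [h1 [g1 [h2 [g2 [Phi [hP oUcA AU fc]]]]]]]]]]] := push_covering.
have oU i := (oUcA i).1; have cA i := (oUcA i).2.
have tt1 i : trivialization (U i) (h1 i) (g1 i) by have [] := fc i.
have tt2 i : trivialization (U i) (h2 i) (g2 i) by have [] := fc i.
have [_ cproj1 _] := bE1.
have hc (v : V1) i x : U i x -> {for x, continuous (fun x => h1 i x (v x))}.
  move=> Ux; have [_ ] := (tot_cvg _ _ cproj1 (oU i) Ux (tt1 i)).1 (@sec_continuous _ _ _ v x).
  exact.
apply: (@csections_cvg R X E2 hX pX bE2 I h U F2 h2 g2 hP oU cA AU tt2 Z Q FQ) => q sq.
have est i : exists2 p, seminorm p & forall x w b,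
    closure [set x | h i x != 0] x -> p w <= 1 -> (forall n, p (b n) <= 1) ->
    q i (iter_dirderiv (Phi i x) (mkseq (fun n => h1 i x (vs0 n x) + b n) k) (h1 i x (rho m0 x) + w) -
     iter_dirderiv (Phi i x) (mkseq (fun n => h1 i x (vs0 n x)) k) (h1 i x (rho m0 x))) <=
    p w + \sum_(l < k) p (b l).
  have [hF2 _ _ sPhi _] := fc i.
  have [|||p sp pH] := @psmooth_estimate R X (F1 i) (F2 i) _ (Phi i) hF2
    (fibrewise_chart_open oO1 (oU i) (fc i)) sPhi _ (fun x => h1 i x (rho m0 x))
    (fun n x => h1 i x (vs0 n x)) (cA i) _ _ _ k (q i) (sq i).
  - move=> x Ax; apply: (fibrewise_chart_domain (fc i) (AU i x Ax)); exact: rhoO.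
  - by move=> x Ax; apply: hc; exact: AU.
  - by move=> n x Ax; apply: hc; exact: AU.
  by exists p => // x w b Ax pw pb; have [] := pH x w b Ax pw pb.
pose p i := s2val (cid2 (est i)).
have sp i : seminorm (p i) := s2valP (cid2 (est i)).
have pE i := s2valP' (cid2 (est i)).
(* One base section and [k] directions vary; enlarging the seminorms by [k + 1] makes the averages
   of their bounds admissible for a box. *)
pose n1 : R := k.+1%:R; have n0 : 0 < n1 by rewrite ltr0n.
pose p' i v := n1 * p i v.
have sp' i : seminorm (p' i) by apply: seminormZ_scale => //; exact: ltW.
have QW : Q [set z | W (m z)] by exact: (cm _ (open_nbhs_nbhs (conj oW Wm0))).
have crm : (fun z => rho (m z)) @ Q --> rho m0 by exact: (cvg_comp _ _ cm (@crho m0)).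
have bn (s : V1) := @box_nbhs R X E1 hX pX bE1 I h U F1 h1 g1 hP oU cA AU tt1 p' s sp'.
have Qm : Q [set z | box h h1 p' (rho (m z) - rho m0 : V1)] by exact: (crm _ (bn _)).
have Qv : Q [set z | forall l, l \in iota 0 k -> box h h1 p' (vs z l - vs0 l : V1)].
  by apply: near_seq => l _; exact: (cvs l _ (bn _)).
have QQ := @filterI _ _ FQ _ _ Qm Qv.
apply: (filter_imp2 FQ QW QQ) => z Wz [bm bv].
pose b l : V1 := if (l < k)%N then vs z l - vs0 l else 0.
pose w (l : 'I_k.+1) : V1 := if (l : nat) is l'.+1 then b l' else rho (m z) - rho m0.
have bw l : box h h1 p' (w l).
  case: l => -[|l] lk //=; rewrite /w /= /b; move: lk; rewrite ltnS => lk; rewrite lk.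
  by apply: bv; rewrite mem_iota.
have [T [c [uT c0 cT Tz Tc]]] := box_common AU tt1 sp' bw.
have w0 : w ord0 = rho (m z) - rho m0 by [].
have wS (l : 'I_k) : w (lift ord0 l) = b l by [].
exists T, (fun i => n1^-1 * \sum_(l < k.+1) c l i); split => //.
- by move=> i; rewrite mulr_ge0 ?invr_ge0 ?(ltW n0)//; exact: sumr_ge0.
- rewrite -mulr_sumr exchange_big/= mulrC ler_pdivrMr// mul1r.
  apply: (@le_trans _ _ (\sum_(l < k.+1) 1)); first by apply: ler_sum => l _.
  by rewrite big_const_ord iter_addr_0.
- move=> i x iT Ax; rewrite csectionsDE csectionsNE.
  rewrite (pushP (mkseq (vs z) k) Wz x) (pushP (mkseq vs0 k) Wm0 x).
  have -> : rho (m z) x = rho m0 x.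
    have := Tz ord0 i x iT Ax; rewrite w0 csectionsDE csectionsNE.
    by move/eqP; rewrite subr_eq0 => /eqP.
  have -> : [seq (v : V1) x | v <- mkseq (vs z) k] = [seq (v : V1) x | v <- mkseq vs0 k].
    rewrite /mkseq -!map_comp; apply/eq_in_map => l; rewrite mem_iota add0n => /= lk.
    have := Tz (lift ord0 (Ordinal lk)) i x iT Ax; rewrite wS /b /= lk csectionsDE csectionsNE.
    by move/eqP; rewrite subr_eq0 => /eqP.
  by rewrite subrr.
- move=> i x Ax; have Ux := AU i x Ax; have [_ _ _ _ DPhi] := fc i.
  have hB2 (v v' : fib E2 x) : h2 i x (v - v') = h2 i x v - h2 i x v'.
    by have := trivialization_comb 1 (-1) v v' (tt2 i) Ux; rewrite !scale1r !scaleN1r.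
  have hB1 (v v' : fib E1 x) : h1 i x (v - v') = h1 i x v - h1 i x v'.
    by have := trivialization_comb 1 (-1) v v' (tt1 i) Ux; rewrite !scale1r !scaleN1r.
  rewrite csectionsDE csectionsNE.
  rewrite (pushP (mkseq (vs z) k) Wz x) (pushP (mkseq vs0 k) Wm0 x) hB2.
  rewrite !DPhi//; try exact: rhoO.
  pose wx := h1 i x (w ord0 x); pose bx l := h1 i x (b l x).
  have -> : h1 i x (rho (m z) x) = h1 i x (rho m0 x) + wx.
    by rewrite /wx w0 csectionsDE csectionsNE hB1 subrKC.
  have -> : [seq h1 i x v | v <- [seq (v : V1) x | v <- mkseq (vs z) k]] =
      mkseq (fun n => h1 i x (vs0 n x) + bx n) k.
    rewrite /mkseq -!map_comp; apply/eq_in_map => l; rewrite mem_iota add0n => /= lk.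
    by rewrite /bx /b lk csectionsDE csectionsNE hB1 subrKC.
  have -> : [seq h1 i x v | v <- [seq (v : V1) x | v <- mkseq vs0 k]] =
      mkseq (fun n => h1 i x (vs0 n x)) k by rewrite /mkseq -!map_comp.
  have pc l : p i (h1 i x (w l x)) <= n1^-1 * c l i.
    by rewrite mulrC ler_pdivlMr// mulrC; exact: Tc.
  have p1 l : p i (h1 i x (w l x)) <= 1.
    have [iT|iT] := boolP (i \in T); last first.
      by rewrite (Tz l i x iT Ax) (trivialization0 (tt1 i) Ux) seminorm0// ler01.
    apply: le_trans (pc l) _; rewrite mulrC ler_pdivrMr// mul1r.
    apply: (@le_trans _ _ 1); last by rewrite /n1 ler1n.
    by apply: le_trans (cT l); rewrite (big_rem i)//= lerDl; exact: sumr_ge0.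
  apply: le_trans (pE i x wx bx Ax (p1 ord0) _) _.
    move=> l; rewrite /bx; have [lk|lk] := boolP (l < k)%N.
      by have := p1 (lift ord0 (Ordinal lk)); rewrite wS.
    by rewrite /b (negbTE lk) csections0E (trivialization0 (tt1 i) Ux) seminorm0// ler01.
  rewrite big_ord_recl mulrDr; apply: lerD; first exact: pc.
  by rewrite mulr_sumr; apply: ler_sum => l _; rewrite /bx -wS; exact: pc.
Qed.

(* [G] is [m |-> i2 (phi o rho m)], where [phi = D _ [::]] acts fibrewise. *)
Lemma pushforward_smooth : smooth_on W G.
Proof.
split.
  move=> ws m w Wm; exists (i2 (push (rho m) (rho w :: [seq rho w | w <- ws]))).
  apply: (is_dirderiv_near (@push_deriv m w [seq rho w | w <- ws] Wm)).
  have nW : nbhs m W by exact: open_nbhs_nbhs.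
  by apply: filterS nW => y Wy; rewrite push_iter_dirderiv.
move=> k.
have oWT : open (W `*` [set: {ptws 'I_k -> M1}]).
  rewrite openE => -[y w] [/= Wy _]; exists (W, setT) => //=.
  by split; [exact: open_nbhs_nbhs|exact: filterT].
rewrite continuous_open_subspace// => -[m0 w0]; rewrite inE => -[/= Wm0 _].
pose ext (w : {ptws 'I_k -> M1}) (l : nat) : V1 := if insub l is Some i then rho (w i) else 0.
have extE (w : {ptws 'I_k -> M1}) : [seq rho v | v <- [seq w i | i <- enum 'I_k]] = mkseq (ext w) k.
  rewrite /mkseq -val_enum_ord -!map_comp; apply: eq_map => i /=.
  by rewrite /ext valK.
have H : (fun p : M1 * {ptws 'I_k -> M1} => push (rho p.1) (mkseq (ext p.2) k)) @ (m0, w0) -->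
    push (rho m0) (mkseq (ext w0) k).
  apply: push_cvg => //; first exact: cvg_fst.
  move=> l; rewrite /ext; case: insubP => [i _ _|_]; last exact: cvg_cst.
  have ci : (fun w : {ptws 'I_k -> M1} => w i) @ w0 --> w0 i.
    exact: (@proj_continuous 'I_k (fun=> M1) i w0).
  have c2 : (fun p : M1 * {ptws 'I_k -> M1} => p.2) @ (m0, w0) --> w0 by exact: cvg_snd.
  by apply: (cvg_comp _ _ (cvg_comp _ _ c2 ci)); exact: crho.
have H2 := cvg_comp _ _ H (@ci2 _).
rewrite /continuous_at /= push_iter_dirderiv// extE; apply: (cvg_congr H2).
have nW : nbhs (m0, w0) (W `*` [set: {ptws 'I_k -> M1}]) by exact: open_nbhs_nbhs.
by apply: (filter_imp _ nW) => -[y w] [/= Wy _]; rewrite push_iter_dirderiv// extE.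
Qed.

End Pushforward.

(** * The tangent bundle and local additions *)

Section ChainRule.
Context {R : realType}.

(** The increment of [f] is [t] times its difference quotient, so this is [psmooth_quot] for [g]
    with a convergent family of directions. *)
Lemma dirderiv_comp (E F G : tvsType R) (W : set F) (f : E -> F) (g : F -> G) (u v : E) (l : F) :
  hausdorff_space G -> open W -> smooth_on W g -> W (f u) -> is_dirderiv f u v l ->
  is_dirderiv (g \o f) u v (dirderiv g (f u) l).
Proof.
move=> hG oW sg Wfu fl.
have FD : Filter ((0 : R)^') by exact: within_filter.
have oU : open [set p : E * F | W p.2] by apply: open_comp => // p _; exact: cvg_snd.
have sg' := smooth_on_psmooth E hG oW sg.
have c1 : (fun=> u) @ (0 : R)^' --> u by exact: cvg_cst.
have c2 : (fun=> f u) @ (0 : R)^' --> f u by exact: cvg_cst.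
have U0 : [set p : E * F | W p.2] (u, f u) by [].
have H := @psmooth_quot R _ F G _ (fun=> g) oU sg' R _ (fun=> u) (fun=> f u)
  (fun t => t^-1 *: (f (u + t *: v) - f u)) id u (f u) l [::] FD U0 c1 c2 fl cvg_dnbhs0 dnbhs0_neq0 I.
apply: (cvg_congr H); apply: (filter_imp FD dnbhs0_neq0) => t t0 /=.
by rewrite scalerA divff// scale1r subrKC.
Qed.

End ChainRule.

Section Charts.
Context {R : realType} {M : topologicalType} (c : chart R M).
Hypothesis Ac : is_chart c.

Lemma chart_cancel p : cdom c p -> cbwd c (cfwd c p) = p.
Proof. by have [_ [H _ _]] := Ac; exact: H. Qed.

Lemma chart_fwd_cvg p : cdom c p -> cfwd c @ p --> cfwd c p.
Proof.
have [[_ oc _] [_ + _]] := Ac; rewrite continuous_open_subspace// => + cp; apply.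
by rewrite inE.
Qed.

Lemma chart_bwd_cvg x : crange c x -> cbwd c @ x --> cbwd c x.
Proof.
have [[_ _ oc] [_ _]] := Ac; rewrite continuous_open_subspace// => + cp; apply.
by rewrite inE.
Qed.

Lemma chart_image_open (P : set M) : open P -> open (cfwd c @` (cdom c `&` P)).
Proof.
move=> oP; have [[_ od oc] _] := Ac; rewrite openE => _ [p [cp Pp] <-].
have rp : crange c (cfwd c p) by exists p.
have H := chart_bwd_cvg rp; rewrite chart_cancel// in H.
have n1 : nbhs (cfwd c p) [set x | P (cbwd c x)] by exact: (H _ (open_nbhs_nbhs (conj oP Pp))).
have n2 : nbhs (cfwd c p) (crange c) by exact: open_nbhs_nbhs.
apply: (filter_imp2 _ n1 n2) => x /= Px [q cq qE]; move: Px; rewrite -qE chart_cancel// => Pq.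
by exists q.
Qed.

End Charts.

Section TangentBundle.
Context {R : realType} (N : manifold R).
Local Notation A := (@atlas R N).
Local Notation TN := (tangent_bundle N).

Lemma atlas_chart (c : chart R N) : A c -> is_chart c.
Proof. by move=> Ac; have [_ H _ _] := @atlas_smooth R N; exact: H. Qed.

Lemma atlas_transition (c d : chart R N) : A c -> A d -> smooth_transition c d.
Proof. by move=> Ac Ad; have [_ _ _ H] := @atlas_smooth R N; exact: H. Qed.

Lemma manifold_hausdorff : hausdorff_space N.
Proof. by have [] := @atlas_smooth R N. Qed.

Lemma chart_aroundP (p : N) : A (chart_around p) /\ cdom (chart_around p) p.
Proof. exact: (svalP (cid (chart_around_ex p))). Qed.

(** The differential at [p] of the change of charts. For [c = chart_around p] it is the coordinate
    map on the tangent space at [p]. *)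
Definition tchange (c d : chart R N) (p : N) : model c -> model d :=
  dirderiv (cfwd d \o cbwd c) (cfwd c p).

Section Change.
Context (c d : chart R N).
Hypotheses (Ac : A c) (Ad : A d).

Lemma transition_open : open (cfwd c @` (cdom c `&` cdom d)).
Proof. by apply: chart_image_open; [exact: atlas_chart|have [[]] := atlas_chart Ad]. Qed.

Lemma tchange_deriv p : cdom c p -> cdom d p -> forall v,
  is_dirderiv (cfwd d \o cbwd c) (cfwd c p) v (tchange d p v).
Proof.
move=> cp dp v; apply: dirderivP; have [s1 _] := atlas_transition Ac Ad.
by apply: (s1 [::]); exists p.
Qed.

Lemma tchange_cvg (Z : Type) (F : set_system Z) (FF : Filter F) (ps : Z -> N) (p : N)
    (v : Z -> model c) (v0 : model c) : cdom c p -> cdom d p ->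
  ps @ F --> p -> v @ F --> v0 ->
  (fun z => tchange d (ps z) (v z)) @ F --> tchange d p v0.
Proof.
move=> cp dp cps cv.
have Wp : (cfwd c @` (cdom c `&` cdom d)) (cfwd c p) by exists p.
have c1 : (fun z => cfwd c (ps z)) @ F --> cfwd c p.
  exact: (cvg_comp _ _ cps (chart_fwd_cvg (atlas_chart Ac) cp)).
exact: (smooth_on_cvg (ps := [:: (v, v0)]) transition_open (atlas_transition Ac Ad) FF Wp c1 (conj cv I)).
Qed.

Lemma tchange_linear p : cdom c p -> cdom d p -> linear (tchange d p : model c -> model d).
Proof.
move=> cp dp a v w.
have [[hd _ _] _] := atlas_chart Ad.
have sm := smooth_on_psmooth N hd transition_open (atlas_transition Ac Ad).
have oU : open [set q : N * model c | (cfwd c @` (cdom c `&` cdom d)) q.2].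
  by apply: open_comp; [move=> q _; exact: cvg_snd|exact: transition_open].
have Wp : [set q : N * model c | (cfwd c @` (cdom c `&` cdom d)) q.2] (p, cfwd c p) by exists p.
have := psmooth_slot_add hd oU sm [::] [::] (a *: v) w Wp.
by rewrite (psmooth_slot_scale hd oU sm [::] [::] v a Wp).
Qed.

End Change.

Lemma tchange_id c p (v : model c) : A c -> cdom c p -> tchange c p v = v.
Proof.
move=> Ac cp; have [[hc _ oc] _] := atlas_chart Ac; apply: dirderiv_unique => //.
have H : is_dirderiv (fun x : model c => x) (cfwd c p) v v.
  apply: (cvg_congr (@cvg_cst _ v _ ((0 : R)^') _)).
  apply: (filter_imp _ dnbhs0_neq0) => t t0 /=.
  by rewrite addrC addKr scalerA mulVf// scale1r.
apply: (is_dirderiv_near H); have nc : nbhs (cfwd c p) (crange c).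
  by apply: open_nbhs_nbhs; split => //; exists p.
by apply: filterS nc => _ [q cq <-] /=; rewrite chart_cancel//; exact: atlas_chart.
Qed.

Lemma tchange_comp c d e p (v : model c) : A c -> A d -> A e ->
  cdom c p -> cdom d p -> cdom e p ->
  tchange e p (tchange d p v) = tchange e p v.
Proof.
move=> Ac Ad Ae cp dp ep.
have [[he oe _] _] := atlas_chart Ae; have [[_ od _] _] := atlas_chart Ad.
apply/esym; apply: dirderiv_unique => //.
have Wp : (cfwd d @` (cdom d `&` cdom e)) ((cfwd d \o cbwd c) (cfwd c p)).
  by exists p => //=; rewrite chart_cancel//; exact: atlas_chart.
have D1 : is_dirderiv (cfwd d \o cbwd c) (cfwd c p) v (tchange d p v) by exact: tchange_deriv.
have := dirderiv_comp he (transition_open Ad Ae) (atlas_transition Ad Ae) Wp D1.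
rewrite /= (chart_cancel (atlas_chart Ac) cp) => H.
apply: (is_dirderiv_near H).
have nW : nbhs (cfwd c p) (cfwd c @` (cdom c `&` (cdom d `&` cdom e))).
  apply: open_nbhs_nbhs; split; last by exists p.
  by apply: chart_image_open; [exact: atlas_chart|exact: openI].
apply: filterS nW => _ [q [cq [dq eq]] <-] /=.
by rewrite (chart_cancel (atlas_chart Ac) cq) (chart_cancel (atlas_chart Ad) dq).
Qed.

Lemma nbhs_set_val (T : topologicalType) (B : set T) (z : set_type B) (P : set T) :
  nbhs (set_val z) P -> nbhs z (set_val @^-1` P).
Proof. by move=> nP; exact: (@initial_continuous _ _ (set_val : B -> T) z). Qed.

Lemma tangent_bwdE c p (w : model c) : A c -> cdom c p ->
  @tangent_bwd R N c (cfwd c p, w) =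
    (existT (fun q => tangent_space q : Type) p (tchange (chart_around p) p w)).
Proof. by move=> Ac cp; rewrite /tangent_bwd /= (chart_cancel (atlas_chart Ac) cp). Qed.

Lemma tangent_fwdE c p (v : tangent_space p) :
  tangent_fwd c (existT (fun q => tangent_space q : Type) p v) = (cfwd c p, tchange c p v).
Proof. by []. Qed.

Lemma tangent_openP (O' : set (total TN)) :
  (forall c, A c -> forall p (w : model c), cdom c p -> O' (@tangent_bwd R N c (cfwd c p, w)) ->
     nbhs (cfwd c p, w) [set xw | crange c xw.1 -> O' (@tangent_bwd R N c xw)]) ->
  open O'.
Proof.
move=> H; suff : @final_open _ _ _ (@tangent_param R N) O' by [].
move=> [c Ac]; rewrite openE => z Oz.
have [/= [p cp pE] _] := set_valP z.
have zE : (cfwd c p, (sval z).2) = sval z by rewrite pE -surjective_pairing.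
move: (H c Ac p (sval z).2 cp); rewrite zE => /(_ Oz) /nbhs_set_val.
by apply: filterS => y /=; apply; have [] := set_valP y.
Qed.

Lemma tangent_bwd_cvg c (Z : Type) (F : set_system Z) (FF : Filter F) (ps : Z -> N) (p : N)
    (v : Z -> model c) (v0 : model c) : A c -> cdom c p ->
  ps @ F --> p -> v @ F --> v0 ->
  (fun z => @tangent_bwd R N c (cfwd c (ps z), v z) : total TN) @ F --> (@tangent_bwd R N c (cfwd c p, v0) : total TN).
Proof.
move=> Ac cp cps cv V; rewrite {1}nbhsE => -[B [oB Bp] BV].
have pT : (crange c `*` [set: model c]) (cfwd c p, v0) by split => //; exists p.
pose z0 : crange c `*` [set: model c] := exist _ (cfwd c p, v0) (mem_set pT).
have oB' := oB (exist _ c Ac).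
have nB : nbhs z0 [set z | B (tangent_param (c := exist _ c Ac) z)] by exact: open_nbhs_nbhs.
have [_ [[P oP <-] /= Pz] PB] := nB.
have c1 : (fun z => (cfwd c (ps z), v z)) @ F --> (cfwd c p, v0).
  apply: cvg_pair => //; exact: (cvg_comp _ _ cps (chart_fwd_cvg (atlas_chart Ac) cp)).
have FP : F [set z | P (cfwd c (ps z), v z)] by exact: (c1 _ (open_nbhs_nbhs (conj oP Pz))).
have [[_ oc _] _] := atlas_chart Ac.
have Fc : F [set z | cdom c (ps z)] by exact: (cps _ (open_nbhs_nbhs (conj oc cp))).
suff : F [set z | V (@tangent_bwd R N c (cfwd c (ps z), v z))] by [].
apply: (filter_imp2 _ FP Fc) => z Pz' cz; apply: BV.
have zT : (crange c `*` [set: model c]) (cfwd c (ps z), v z) by split => //; exists (ps z).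
exact: (PB (exist _ (cfwd c (ps z), v z) (mem_set zT))).
Qed.

Lemma tangent_proj_continuous : continuous (@proj R N TN).
Proof.
apply/continuousP => P oP; apply: tangent_openP => c Ac p w cp.
rewrite /preimage/= /tangent_bwd/= (chart_cancel (atlas_chart Ac) cp) => Pp.
have c1 : (fun xw : model c * model c => cbwd c xw.1) @ (cfwd c p, w) --> p.
  rewrite -[X in _ --> X](chart_cancel (atlas_chart Ac) cp).
  apply: (cvg_comp _ _ (@cvg_fst _ _ _ _ _)); apply: chart_bwd_cvg; first exact: atlas_chart.
  by exists p.
have n1 : nbhs (cfwd c p, w) [set xw | P (cbwd c xw.1)] by exact: (c1 _ (open_nbhs_nbhs (conj oP Pp))).
by apply: filterS n1 => xw Pxw _.
Qed.

Lemma tangent_coord_continuous c : A c ->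
  {within @proj R N TN @^-1` cdom c, continuous (fun e : total TN => tchange c (tag e) (tagged e))}.
Proof.
move=> Ac; have [[_ oc _] _] := atlas_chart Ac.
have oV : open (@proj R N TN @^-1` cdom c).
  by apply: open_comp => // e _; exact: tangent_proj_continuous.
rewrite continuous_open_subspace// => e0; rewrite inE => ce0 V; rewrite {1}nbhsE => -[B [oB Be] BV].
pose O' : set (total TN) := [set e | cdom c (tag e) /\ B (tchange c (tag e) (tagged e))].
suff oO : open O'.
  suff : nbhs e0 [set e : total TN | V (tchange c (tag e) (tagged e))] by [].
  have nO : nbhs e0 O' by exact: open_nbhs_nbhs.
  by apply: filterS nO => e [_ /BV].
apply: tangent_openP => d Ad p w dp.
rewrite (tangent_bwdE _ Ad dp) => -[/= cp]; have [Ak kp] := chart_aroundP p.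
(* By the cocycle identity the reference chart [chart_around p], which is chosen without continuity
   in [p], cancels; what remains is the change from [d] to [c]. *)
rewrite (tchange_comp _ Ad Ak Ac)// => Bp.
have c1 : (fun xw : model d * model d => cbwd d xw.1) @ (cfwd d p, w) --> p.
  rewrite -[X in _ --> X](chart_cancel (atlas_chart Ad) dp).
  apply: (cvg_comp _ _ (@cvg_fst _ _ _ _ _)); apply: chart_bwd_cvg; first exact: atlas_chart.
  by exists p.
have c2 : (fun xw : model d * model d => xw.2) @ (cfwd d p, w) --> w by exact: cvg_snd.
have H := tchange_cvg Ad Ac (nbhs_filter (cfwd d p, w)) dp cp c1 c2.
have n1 : nbhs (cfwd d p, w) [set xw | B (tchange c (cbwd d xw.1) xw.2)].
  exact: (H _ (open_nbhs_nbhs (conj oB Bp))).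
have n2 : nbhs (cfwd d p, w) [set xw | cdom c (cbwd d xw.1)].
  exact: (c1 _ (open_nbhs_nbhs (conj oc cp))).
apply: (filter_imp2 _ n1 n2) => -[x v] /= Bx cx [q dq qE]; move: Bx cx.
rewrite -qE (chart_cancel (atlas_chart Ad) dq) (tangent_bwdE _ Ad dq) => Bq cq; split => //=.
by have [Ak' kq] := chart_aroundP q; rewrite (tchange_comp _ Ad Ak' Ac).
Qed.

Lemma tangent_trivialization c : A c ->
  @trivialization R N TN (cdom c) (model c) (fun p v => tchange c p v)
    (fun p w => tchange (chart_around p) p w).
Proof.
move=> Ac; have [[_ oc _] _] := atlas_chart Ac; split.
- move=> p cp; have [Ak kp] := chart_aroundP p; split.
  + exact: tchange_linear.
  + by move=> v; rewrite (tchange_comp _ Ak Ac Ak)// tchange_id.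
  + by move=> v; rewrite (tchange_comp _ Ac Ak Ac)// tchange_id.
- exact: tangent_coord_continuous.
- have oV : open (cdom c `*` [set: model c]).
    rewrite openE => -[y w] [/= Uy _]; exists (cdom c, setT) => //=.
    by split; [exact: open_nbhs_nbhs|exact: filterT].
  rewrite continuous_open_subspace// => -[p w]; rewrite inE => -[/= cp _].
  have c1 : (fun pw : N * model c => pw.1) @ (p, w) --> p by exact: cvg_fst.
  have c2 : (fun pw : N * model c => pw.2) @ (p, w) --> w by exact: cvg_snd.
  have H := tangent_bwd_cvg (nbhs_filter (p, w)) Ac cp c1 c2; rewrite (tangent_bwdE _ Ac cp) in H.
  have n1 : nbhs (p, w) [set pw : N * model c | cdom c pw.1].
    exact: (c1 _ (open_nbhs_nbhs (conj oc cp))).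
  apply: (cvg_congr H); apply: (filter_imp _ n1) => -[q v] /= cq.
  by rewrite (tangent_bwdE _ Ac cq).
Qed.

Lemma tangent_vector_bundle : is_vector_bundle TN.
Proof.
have triv p : exists U : set N, [/\ open U, U p & exists F : tvsType R, hausdorff_space F /\
    exists h g, @trivialization R N TN U F h g].
  have [Ak kp] := chart_aroundP p; have [[hk ok _] _] := atlas_chart Ak.
  exists (cdom (chart_around p)); split => //; exists (model (chart_around p)); split => //.
  by eexists; eexists; exact: (tangent_trivialization Ak).
split => //; last exact: tangent_proj_continuous.
move=> [p v] [q w] vw.
have ? : p = q.
  apply: manifold_hausdorff => P Q nP nQ.
  have [e [Pe Qe]] := vw _ _ (tangent_proj_continuous (x := existT _ p v) nP)
    (tangent_proj_continuous (x := existT _ q w) nQ).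
  by exists (tag e).
subst q; congr existT.
have [U [oU Up [F [hF [h [g tt]]]]]] := triv p.
have [t1 t2 _] := tt; have [_ hK _] := t1 p Up; apply: (can_inj hK); apply: hF => P Q nP nQ.
have oV : open (@proj R N TN @^-1` U) by apply: open_comp => // e _; exact: tangent_proj_continuous.
have H u : (fun e : total TN => h (tag e) (tagged e)) @ (existT _ p u : total TN) --> h p u.
  exact: (within_open_cvg oV t2 (Up : (@proj R N TN @^-1` U) (existT _ p u)) cvg_id).
by have [e [Pe Qe]] := vw _ _ (H v _ nP) (H w _ nQ); exists (h (tag e) (tagged e)).
Qed.

End TangentBundle.

Lemma iter_dirderiv_conj (R : realType) (E E' F F' : tvsType R) (V : set E') (f : E' -> F)
    (L : E -> E') (L' : F -> F') : hausdorff_space F' -> open V ->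
  (forall vs y v, V y -> exists l, is_dirderiv (iter_dirderiv f vs) y v l) ->
  linear L -> continuous L -> linear L' -> continuous L' ->
  forall vs u, V (L u) ->
  iter_dirderiv (fun u => L' (f (L u))) vs u = L' (iter_dirderiv f [seq L v | v <- vs] (L u)).
Proof.
move=> hF' oV sf lL cL lL' cL'; elim=> [//|v vs IH] u VLu.
rewrite iter_dirderiv_cons; apply: (dirderiv_unique hF').
have H0 : is_dirderiv (iter_dirderiv f [seq L v | v <- vs]) (0 + L u) (L v)
    (iter_dirderiv f [seq L w | w <- v :: vs] (L u)).
  by rewrite add0r; apply: dirderivP; exact: sf.
have H := is_dirderiv_linear lL' cL' (is_dirderiv_comp_affine lL H0).
apply: (is_dirderiv_near H).
have nV : nbhs u (L @^-1` V) by apply: cL; exact: open_nbhs_nbhs.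
by apply: filterS nV => y Vy; rewrite /= add0r IH.
Qed.

Lemma hausdorff_prod (S T : topologicalType) :
  hausdorff_space S -> hausdorff_space T -> hausdorff_space (S * T)%type.
Proof.
move=> hS hT [s t] [s' t'] st; congr pair.
  apply: hS => A B nA nB.
  have [[x y] [/= Ax Bx]] := st [set p | A p.1] [set p | B p.1] (@cvg_fst _ _ _ _ _ _ nA) (@cvg_fst _ _ _ _ _ _ nB).
  by exists x.
apply: hT => A B nA nB.
have [[x y] [/= Ax Bx]] := st [set p | A p.2] [set p | B p.2] (@cvg_snd _ _ _ _ _ _ nA) (@cvg_snd _ _ _ _ _ _ nB).
by exists y.
Qed.

Lemma openX (S T : topologicalType) (A : set S) (B : set T) :
  open A -> open B -> open (A `*` B).
Proof.
move=> oA oB; rewrite openE => -[x y] [/= Ax By]; exists (A, B) => //=.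
by split; exact: open_nbhs_nbhs.
Qed.

Lemma within_open_intro (S T : topologicalType) (A : set S) (f : S -> T) : open A ->
  (forall x, A x -> f @ x --> f x) -> {within A, continuous f}.
Proof. by move=> oA H; rewrite continuous_open_subspace// => x; rewrite inE; exact: H. Qed.

Lemma prod_is_chart (R : realType) (M M' : topologicalType) (c : chart R M) (d : chart R M') :
  is_chart c -> is_chart d -> is_chart (prod_chart c d).
Proof.
move=> Hc Hd; have [[hc oc rc] _] := Hc; have [[hd od rd] _] := Hd.
have rE : crange (prod_chart c d) = crange c `*` crange d.
  apply/seteqP; split=> [_ [[x y] [/= cx dy] <-]|[_ _] [/= [x cx <-] [y dy <-]]].
    by split; [exists x|exists y].
  by exists (x, y).
have oR : open (crange (prod_chart c d)) by rewrite rE; exact: openX.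
split; split => //; [exact: hausdorff_prod|exact: openX| | | ].
- by move=> [x y] [/= cx dy] /=; rewrite !chart_cancel.
- apply: within_open_intro; first exact: openX.
  move=> [x y] [/= cx dy]; apply: cvg_pair.
    by apply: (cvg_comp _ _ (@cvg_fst _ _ _ _ _)); exact: chart_fwd_cvg.
  by apply: (cvg_comp _ _ (@cvg_snd _ _ _ _ _)); exact: chart_fwd_cvg.
- apply: within_open_intro => //; rewrite rE => -[x y] [/= cx dy]; apply: cvg_pair.
    by apply: (cvg_comp _ _ (@cvg_fst _ _ _ _ _)); exact: chart_bwd_cvg.
  by apply: (cvg_comp _ _ (@cvg_snd _ _ _ _ _)); exact: chart_bwd_cvg.
Qed.

(** * Fibre maps defined by a local addition *)

Section LocalAddition.
Context {R : realType} {N : manifold R}.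
Local Notation A := (@atlas R N).
Local Notation TN := (tangent_bundle N).

Lemma tangent_is_chart (c : chart R N) : A c -> is_chart (tangent_chart c).
Proof.
move=> Ac; have [[hc oc rc] _] := atlas_chart Ac.
have rE : crange (tangent_chart c) = crange c `*` [set: model c].
  apply/seteqP; split=> [_ [[p v] /= cp <-]|[_ w] [/= [p cp <-] _]]; first by split => //; exists p.
  have [Ak kp] := chart_aroundP p.
  exists (existT _ p (tchange (chart_around p) p w)) => //=.
  by rewrite -/(tchange c p _) (tchange_comp w Ac Ak Ac)// tchange_id.
have oR : open (crange (tangent_chart c)) by rewrite rE; apply: openX => //; exact: openT.
have oV : open (@proj R N TN @^-1` cdom c).
  by apply: open_comp => // e _; exact: tangent_proj_continuous.
split; split => //; first exact: hausdorff_prod.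
- move=> [p v] /= cp; have [Ak kp] := chart_aroundP p.
  rewrite -[LHS]/(@tangent_bwd R N c (cfwd c p, tchange c p v)) tangent_bwdE//; congr existT.
  by rewrite (tchange_comp v Ak Ac Ak)// tchange_id.
- apply: within_open_intro => // e0 ce0.
  have -> : cfwd (tangent_chart c) =
      (fun e : total TN => (cfwd c (proj e), tchange c (tag e) (tagged e))).
    by apply/funext => -[].
  move: e0 ce0 => [p v] /= cp.
  have H1 : (fun e : total TN => cfwd c (proj e)) @ (existT _ p v : total TN) --> cfwd c p.
    by apply: (cvg_comp _ _ (@tangent_proj_continuous _ _ (existT _ p v)));
      exact: (chart_fwd_cvg (atlas_chart Ac) cp).
  have H := within_open_cvg oV (tangent_coord_continuous Ac)
    (cp : (@proj R N TN @^-1` cdom c) (existT _ p v)) cvg_id.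
  exact: (cvg_pair H1 H).
- apply: within_open_intro => //; rewrite rE => -[y w] [/= [p cp yE] _].
  have c1 : (fun z : model c * model c => cbwd c z.1) @ (y, w) --> p.
    rewrite -(chart_cancel (atlas_chart Ac) cp) yE.
    apply: (cvg_comp _ _ (@cvg_fst _ _ _ _ _)); apply: chart_bwd_cvg; first exact: atlas_chart.
    by exists p.
  have c2 : (fun z : model c * model c => z.2) @ (y, w) --> w by exact: cvg_snd.
  have H := tangent_bwd_cvg (nbhs_filter (y, w)) Ac cp c1 c2.
  rewrite yE in H; apply: (cvg_congr H).
  have nR : nbhs (y, w) (crange c `*` [set: model c]).
    by apply: open_nbhs_nbhs; split; [rewrite -rE|split => //; exists p].
  apply: (filter_imp _ nR) => -[_ z] [/= [q cq <-] _].
  by rewrite (chart_cancel (atlas_chart Ac) cq).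
Qed.

Context (S : local_addition N).

Definition la_inv : N * N -> total TN := s2val (cid2 (la_diffeo S).2).

Definition la_graph : set (N * N) := la_pair S @` la_dom S.

Lemma la_invK e : la_dom S e -> la_inv (proj e, la_map S e) = e.
Proof. exact: (s2valP (cid2 (la_diffeo S).2)). Qed.

Lemma la_inv_smooth :
  smooth_map_on (prod_atlas A A) (@tangent_atlas R N) la_graph la_inv.
Proof. exact: (s2valP' (cid2 (la_diffeo S).2)). Qed.

Lemma la_graph_open : open la_graph. Proof. exact: la_image_open. Qed.

Lemma la_invP pq : la_graph pq ->
  [/\ la_dom S (la_inv pq), proj (la_inv pq) = pq.1 & la_map S (la_inv pq) = pq.2].
Proof. by move=> [e de <-]; rewrite [la_pair S e]/la_pair la_invK. Qed.

Lemma la_inv_cvg pq : la_graph pq -> la_inv @ pq --> la_inv pq.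
Proof.
move=> gpq; have [ci _] := la_inv_smooth.
exact: (within_open_cvg la_graph_open ci gpq cvg_id).
Qed.

Lemma la_map_cvg e : la_dom S e -> la_map S @ e --> la_map S e.
Proof.
move=> de; have [ci _] := la_smooth S.
exact: (within_open_cvg (la_dom_open S) ci de cvg_id).
Qed.

Lemma la_graph_diag p : la_graph (p, p) /\ la_inv (p, p) = tot (0 : fib TN p).
Proof.
have H := la_invK (la_dom0 S p); rewrite la_map0 in H; split => //.
by exists (tot (0 : fib TN p)); [exact: la_dom0|rewrite /la_pair la_map0].
Qed.

(** Reads the fibre component in the model space belonging to a given [q], which avoids casts along
    [proj e = q]. *)
Definition vec (q : N) (e : total TN) : model (chart_around q) :=
  (tangent_fwd (chart_around q) e).2.

Lemma vec_tot p (v : fib TN p) : vec p (tot v) = v.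
Proof. by have [Ak kp] := chart_aroundP p; rewrite /vec /tot tangent_fwdE /= tchange_id. Qed.

Lemma tot_vec p (e : total TN) : proj e = p -> @tot R N TN p (vec p e) = e.
Proof. by case: e => q v /= <-; congr existT; exact: vec_tot. Qed.

Section FibreMap.
Context {X : topologicalType} (f g : X -> N).
Hypotheses (cf : continuous f) (cg : continuous g).

(** The change of charts from [g] to [f], seen in one fibre: the vector at [f x] that the local
    addition sends to the same point as [u]. *)
Definition fibre_map (x : X) (u : model (chart_around (g x))) : model (chart_around (f x)) :=
  vec (f x) (la_inv (f x, la_map S (@tot R N TN (g x) u))).

Definition fibre_dom : set (total (pullback g TN)) :=
  [set e | la_dom S (@tot R N TN (g (tag e)) (tagged e)) /\
     la_graph (f (tag e), la_map S (@tot R N TN (g (tag e)) (tagged e)))].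

Definition fibre_deriv (x : X) (vs : seq (fib (pullback g TN) x)) (u : fib (pullback g TN) x) :
    fib (pullback f TN) x :=
  iter_dirderiv (@fibre_map x) vs u.

Lemma la_tot_cvg (e : total (pullback g TN)) : la_dom S (@tot R N TN (g (tag e)) (tagged e)) ->
  (fun z : total (pullback g TN) => la_map S (@tot R N TN (g (tag z)) (tagged z))) @ e -->
    la_map S (@tot R N TN (g (tag e)) (tagged e)).
Proof. by move=> de; apply: (cvg_comp _ _ (@pullback_tot_continuous _ _ _ g TN e)); exact: la_map_cvg. Qed.

Lemma fibre_dom_open : open fibre_dom.
Proof.
rewrite openE => e [de ge].
have n1 : nbhs e [set z : total (pullback g TN) | la_dom S (@tot R N TN (g (tag z)) (tagged z))].
  exact: (@pullback_tot_continuous _ _ _ g TN e _ (open_nbhs_nbhs (conj (la_dom_open S) de))).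
have c1 : (fun z : total (pullback g TN) => f (tag z)) @ e --> f (tag e).
  by apply: (cvg_comp _ _ (@pullback_proj_continuous _ _ _ g TN e)); exact: cf.
have c2 : (fun z : total (pullback g TN) =>
    (f (tag z), la_map S (@tot R N TN (g (tag z)) (tagged z)))) @ e -->
    (f (tag e), la_map S (@tot R N TN (g (tag e)) (tagged e))).
  exact: (cvg_pair c1 (la_tot_cvg de)).
have n2 : nbhs e [set z : total (pullback g TN) |
    la_graph (f (tag z), la_map S (@tot R N TN (g (tag z)) (tagged z)))].
  exact: (c2 _ (open_nbhs_nbhs (conj la_graph_open ge))).
by apply: (filter_imp2 _ n1 n2) => z.
Qed.

Lemma snd_linear (E F : tvsType R) : linear (snd : E * F -> F).
Proof. by []. Qed.

Lemma snd_continuous (E F : tvsType R) : continuous (snd : E * F -> F).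
Proof. by move=> p; exact: cvg_snd. Qed.

Lemma inr_linear (E F : tvsType R) : linear (fun w : F => (0 : E, w)).
Proof. by move=> a v w; congr pair; rewrite /= scaler0 addr0. Qed.

Lemma inr_continuous (E F : tvsType R) : continuous (fun w : F => (0 : E, w)).
Proof. by move=> w; apply: cvg_pair; [exact: cvg_cst|exact: cvg_id]. Qed.

Section LocalForm.
Context (c1 c2 : chart R N).
Hypotheses (Ac1 : A c1) (Ac2 : A c2).
Let U := [set x | cdom c1 (g x) /\ cdom c2 (f x)].
Let g1 x (w : model c1) : fib TN (g x) := tchange (chart_around (g x)) (g x) w.
Let UU := [set p : X * model c1 | U p.1 /\ fibre_dom (@tot R X (pullback g TN) p.1 (@g1 p.1 p.2))].

Definition local_form (x : X) (w : model c1) : model c2 :=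
  tchange c2 (f x) (@fibre_map x (@g1 x w)).

Lemma local_open : open U.
Proof.
have [[_ o1 _] _] := atlas_chart Ac1; have [[_ o2 _] _] := atlas_chart Ac2.
have oA : open (g @^-1` cdom c1) by apply: open_comp => // x _; exact: cg.
have oB : open (f @^-1` cdom c2) by apply: open_comp => // x _; exact: cf.
exact: (openI oA oB).
Qed.

Let t1 : @trivialization R X (pullback g TN) U (model c1) (fun x v => tchange c1 (g x) v) g1.
Proof.
have [[_ o1 _] _] := atlas_chart Ac1.
have := pullback_trivialization cg (@tangent_proj_continuous R N) o1 (tangent_trivialization Ac1).
by apply: trivialization_sub => x [].
Qed.

Let t2 : @trivialization R X (pullback f TN) U (model c2) (fun x v => tchange c2 (f x) v)
  (fun x w => tchange (chart_around (f x)) (f x) w).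
Proof.
have [[_ o2 _] _] := atlas_chart Ac2.
have := pullback_trivialization cf (@tangent_proj_continuous R N) o2 (tangent_trivialization Ac2).
by apply: trivialization_sub => x [].
Qed.

(** Near a given point the fibre map is composed of two coordinate expressions: that of the local
    addition, from [c1] to a chart [c3] around the image, and that of the inverse of [la_pair], in
    [c2] and [c3]. The base coordinates enter as continuous parameters. Since [c3] depends on the
    point, the argument is local. *)
Lemma local_form_smooth : psmooth UU local_form.
Proof.
have [[h1 o1 r1] _] := atlas_chart Ac1; have [[h2 o2 r2] _] := atlas_chart Ac2.
have cfx x : cdom c1 (g x) -> {for x, continuous (fun x => cfwd c1 (g x))}.
  by move=> cx; apply: (cvg_comp _ _ (@cg x)); apply: chart_fwd_cvg => //; exact: atlas_chart.
have cfx2 x : cdom c2 (f x) -> {for x, continuous (fun x => cfwd c2 (f x))}.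
  by move=> cx; apply: (cvg_comp _ _ (@cf x)); apply: chart_fwd_cvg => //; exact: atlas_chart.
apply: psmooth_local => x0 w0 [/= [cx1 cx2] [/= de ge]].
pose n x w := la_map S (@tot R N TN (g x) (@g1 x w)).
have [Ac3 c3n] := chart_aroundP (n x0 w0); set c3 := chart_around (n x0 w0) in Ac3 c3n.
have [[h3 o3 r3] _] := atlas_chart Ac3.
have [_ /(_ (tangent_chart c1) c3)] := la_smooth S.
set sigma := cfwd c3 \o _ \o _; set W1 := cfwd _ @` _ => s1.
have sW1 : smooth_on W1 sigma by apply: s1 => //; exists c1.
have oP1 : open [set e | la_dom S e /\ cdom c3 (la_map S e)].
  rewrite openE => e [le ce]; have nd := open_nbhs_nbhs (conj (la_dom_open S) le).
  have nc := la_map_cvg le (open_nbhs_nbhs (conj o3 ce)).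
  by apply: (filter_imp2 _ nd nc).
have oW1 : open W1.
  by rewrite /W1 -setIA; exact: (chart_image_open (tangent_is_chart Ac1) oP1).
have [_ /(_ (prod_chart c2 c3) (tangent_chart c2))] := la_inv_smooth.
set tau := cfwd (tangent_chart c2) \o _ \o _; set W2 := cfwd _ @` _ => s2.
have sW2 : smooth_on W2 tau by apply: s2; [exists c2, c3|exists c2].
have oP2 : open [set pq | la_graph pq /\ cdom c2 pq.1].
  apply: openI; first exact: la_graph_open.
  by apply: open_comp => // pq _; exact: cvg_fst.
have oW2 : open W2.
  have := chart_image_open (prod_is_chart (atlas_chart Ac2) (atlas_chart Ac3)) oP2.
  congr open; apply/seteqP; split => z [pq].
    move=> [cpq [gpq cp]] <-; exists pq => //; split => //=.
    by have [_ pE _] := la_invP gpq; rewrite pE.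
  by move=> [[[/= cp cq] gpq] _] <-; exists pq.
pose V := [set p : X * model c1 | UU p /\ cdom c3 (n p.1 p.2)].
have oV : open V.
  pose B : set (total (pullback g TN)) := [set e | fibre_dom e /\
     cdom c3 (la_map S (@tot R N TN (g (tag e)) (tagged e)))].
  have oB : open B.
    rewrite openE => e [fe ce]; have nd := open_nbhs_nbhs (conj fibre_dom_open fe).
    have nc := la_tot_cvg fe.1 (open_nbhs_nbhs (conj o3 ce)).
    by apply: (filter_imp2 _ nd nc).
  have := trivialization_preimage_open local_open t1 oB.
  by congr open; apply/seteqP; split => [p [? []]|p [[]]].
have tg1 x w : U x -> tangent_fwd c1 (@tot R N TN (g x) (@g1 x w)) = (cfwd c1 (g x), w).
  move=> Ux; rewrite /tot tangent_fwdE; congr pair.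
  by have [t11 _ _] := t1; have [_ _ gK] := t11 x Ux; exact: gK.
have sE x w : V (x, w) -> sigma ((cfwd c1 (g x), 0) + (0, w)) = cfwd c3 (n x w) /\
    W1 ((cfwd c1 (g x), 0) + (0, w)).
  move=> [[/= [cx cx'] [/= dw gw]] c3w].
  have -> : (cfwd c1 (g x), 0) + (0, w) = tangent_fwd c1 (@tot R N TN (g x) (@g1 x w)).
    by rewrite tg1//; congr pair; rewrite ?addr0 ?add0r.
  split; last by exists (@tot R N TN (g x) (@g1 x w)).
  rewrite /sigma /=; congr (cfwd c3 (la_map S _)).
  have [_ [H _ _]] := tangent_is_chart Ac1.
  exact: (H (@tot R N TN (g x) (@g1 x w))).
have s1' : psmooth V (fun x w => sigma ((cfwd c1 (g x), 0) + (0, w))).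
  apply: (psmooth_of_smooth h3 oW1 sW1 (@inr_linear _ _) (@inr_continuous _ _) oV).
    by move=> x w /sE[].
  move=> x w [[/= [cx _] _] _]; apply: cvg_pair; [exact: cfx|exact: cvg_cst].
pose V2 := [set p : X * model c3 | cdom c2 (f p.1) /\ W2 (cfwd c2 (f p.1), p.2)].
have oV2 : open V2.
  rewrite openE => -[x z] [/= cx Wx].
  have q1 : (fun p : X * model c3 => p.1) @ (x, z) --> x by exact: cvg_fst.
  have q2 : (fun p : X * model c3 => p.2) @ (x, z) --> z by exact: cvg_snd.
  have q3 : (fun p : X * model c3 => (cfwd c2 (f p.1), p.2)) @ (x, z) --> (cfwd c2 (f x), z).
    have q4 : (fun p : X * model c3 => cfwd c2 (f p.1)) @ (x, z) --> cfwd c2 (f x).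
      exact: (cvg_comp _ _ q1 (cfx2 x cx)).
    exact: (cvg_pair q4 q2).
  have n2 : nbhs (x, z) [set p : X * model c3 | W2 (cfwd c2 (f p.1), p.2)].
    exact: (q3 _ (open_nbhs_nbhs (conj oW2 Wx))).
  have n1 : nbhs (x, z) [set p : X * model c3 | cdom c2 (f p.1)].
    by apply: (q1 [set x | cdom c2 (f x)]); apply: cf; exact: open_nbhs_nbhs.
  by apply: (filter_imp2 _ n1 n2).
have s2' : psmooth V2 (fun x z => tau ((cfwd c2 (f x), 0) + (0, z))).
  apply: (psmooth_of_smooth _ oW2 sW2 (@inr_linear _ _) (@inr_continuous _ _) oV2).
  - exact: hausdorff_prod.
  - move=> x z [_ /=]; have -> // : (cfwd c2 (f x), 0) + (0, z) = (cfwd c2 (f x), z).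
    by congr pair; rewrite ?addr0 ?add0r.
  - move=> x z [/= cx _]; apply: cvg_pair; [exact: cfx2|exact: cvg_cst].
have s2'' := psmooth_linear h2 oV2 s2' (@snd_linear _ _) (@snd_continuous _ _).
pose psi x : model c3 -> model c2 := snd \o (fun z => tau ((cfwd c2 (f x), 0) + (0, z))).
pose phi x (w : model c1) : model c3 := sigma ((cfwd c1 (g x), 0) + (0, w)).
exists V, (fun x => psi x \o phi x); split => //.
- have PC := @psmooth_comp R X _ _ _ V V2 phi psi h2 oV oV2 s1' s2''.
  apply: PC => x w Vxw; rewrite /phi.
  have [-> _] := sE x w Vxw; have [[/= [cx cx'] [/= dw gw]] c3w] := Vxw.
  split => //=; exists (f x, n x w) => //; split => //=.
  by have [_ pE _] := la_invP gw; rewrite pE.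
- move=> x w Vxw; rewrite /psi /phi /=; have [/= E1 _] := sE x w Vxw; have [[/= [cx cx'] [/= dw gw]] c3w] := Vxw.
  have -> : (cfwd c2 (f x), 0) + (0, sigma ((cfwd c1 (g x), 0) + (0, w))) =
      (cfwd c2 (f x), cfwd c3 (n x w)) :> model c2 * model c3.
    by rewrite E1; congr pair; rewrite ?addr0 ?add0r.
  rewrite /tau /= (chart_cancel (atlas_chart Ac2) cx') (chart_cancel (atlas_chart Ac3) c3w).
  have [_ pE _] := la_invP gw.
  by rewrite -[in RHS](tot_vec pE) /tot tangent_fwdE.
Qed.

(** [fibre_deriv] is formed in the reference charts of the fibres; the linear coordinate changes on
    both sides carry it to the derivatives of [local_form]. *)
Lemma local_fibrewise_chart : fibrewise_chart fibre_dom fibre_deriv U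
  (fun x v => tchange c1 (g x) v) g1 (fun x v => tchange c2 (f x) v)
  (fun x w => tchange (chart_around (f x)) (f x) w) local_form.
Proof.
have [[h2 o2 r2] _] := atlas_chart Ac2.
split => //; first exact: local_form_smooth.
move=> x u vs Ux fu; have [cx1 cx2] := Ux; have [Ak kx] := chart_aroundP (g x).
have [Ak2 kx2] := chart_aroundP (f x); have [[hk2 _ _] _] := atlas_chart Ak2.
have [t11 _ _] := t1; have [_ hK _] := t11 x Ux.
have [t21 _ _] := t2; have [l2 hK2 gK2] := t21 x Ux.
have oUU : open UU := trivialization_preimage_open local_open t1 fibre_dom_open.
have tc (c d : chart R N) p : A c -> A d -> cdom c p -> cdom d p -> continuous (tchange d p : model c -> model d).
  move=> Ac Ad cp dp v; apply: (tchange_cvg Ac Ad (nbhs_filter v) cp dp); [exact: cvg_cst|exact: cvg_id].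
pose L : model (chart_around (g x)) -> model c1 := tchange c1 (g x).
pose L' : model c2 -> model (chart_around (f x)) := tchange (chart_around (f x)) (f x).
pose V := [set w | UU (x, w)].
have oV : open V := open_slice oUU x.
have VL v : V (L v) <-> fibre_dom (@tot R X (pullback g TN) x v).
  have E0 : @g1 x (L v) = v by exact: hK.
  by rewrite /V /UU /= E0; split => [[]|].
have E1 : fibre_deriv vs u = iter_dirderiv (fun v => L' (local_form x (L v))) vs u.
  apply: (@iter_dirderiv_open _ _ _ _ _ (L @^-1` V)).
  - by apply: open_comp => // v _; exact: tc.
  - move=> v /= Vv; rewrite /local_form; have -> : @g1 x (L v) = v by exact: hK.
    by rewrite /L' hK2.
  - exact/VL.
have E2 : iter_dirderiv (fun v => L' (local_form x (L v))) vs u =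
    L' (iter_dirderiv (local_form x) [seq L v | v <- vs] (L u)).
  apply: (@iter_dirderiv_conj R _ _ _ _ V) => //.
  - by move=> ws y v Vy; have [s1 _] := local_form_smooth; exact: s1.
  - exact: tchange_linear.
  - exact: tc.
  - exact: tchange_linear.
  - exact: tc.
  - exact/VL.
by rewrite E1 E2; exact: gK2.
Qed.

End LocalForm.

Lemma fibre_map_smooth : fibrewise_smooth fibre_dom fibre_deriv.
Proof.
move=> x; have [A1 k1] := chart_aroundP (g x); have [A2 k2] := chart_aroundP (f x).
exists [set y | cdom (chart_around (g x)) (g y) /\ cdom (chart_around (f x)) (f y)]; split => //.
  exact: local_open.
do 7 eexists; exact: (local_fibrewise_chart A1 A2).
Qed.

End FibreMap.
End LocalAddition.

(** * Manifolds of mappings *)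

Lemma open_sections (R : realType) (X : topologicalType) (E : vfamily R X)
    (hX : hausdorff_space X) (pX : paracompact X) (bE : is_vector_bundle E)
    (O' : set (total E)) : locally_compact [set: X] -> open O' ->
  open [set s : csections hX pX bE | forall x, O' (tot (s x))].
Proof.
move=> lX oO; have [_ _ triv] := bE.
pose C := [set U' : set X | open U' /\ ((exists2 B, compact B & U' `<=` B) /\
  exists U, [/\ open U, U' `<=` U & exists F h g, @trivialization R X E U F h g])].
have [||I [h [hP hC]]] := @partition_of_unity R X hX pX C.
- by move=> U' [].
- apply/seteqP; split => // x _; have [U [oU Ux [F [_ [k [g tt]]]]]] := triv x.
  have [U' [oU' U'x [B cB UB]]] := compact_open_nbhs lX x.
  exists (U `&` U') => //; split; first exact: openI.
  split; first by exists B => // y [_ /UB].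
  by exists U; split; [exact: oU|move=> y []|exists F, k, g].
have data i : exists Q : {F : tvsType R & ((forall x, fib E x -> F) * (forall x, F -> fib E x))%type},
    exists U, [/\ open U, closure [set x | h i x != 0] `<=` U &
    trivialization U (projT2 Q).1 (projT2 Q).2].
  have [U' [_ [_ [U [oU UU [F [k [g tt]]]]]]] AU] := hC i.
  by exists (existT _ F (k, g)), U; split => //; exact: subset_trans UU.
have [Q QP] := choice data; have [U UP] := choice QP.
have cA i : compact (closure [set x | h i x != 0]).
  have [U' [_ [[B cB UB] _]] AU] := hC i; apply: (subclosed_compact _ cB); first exact: closed_closure.
  exact: subset_trans UB.
apply: (@open_range_sections R X E hX pX bE I h U (fun i => projT1 (Q i))
  (fun i => (projT2 (Q i)).1) (fun i => (projT2 (Q i)).2) hP _ cA _ _ O' oO).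
- by move=> i; have [] := UP i.
- by move=> i; have [] := UP i.
- by move=> i; have [] := UP i.
Qed.

Section MappingSpaces.
Context {R : realType} {N : manifold R} (S : local_addition N).
Local Notation A := (@atlas R N).
Local Notation TN := (tangent_bundle N).

Section OneSpace.
Context {X : topologicalType}.
Implicit Types f h : continuousType X N.

Lemma lift_map_proj f (s : lifts f) x : proj (lift_map s x) = f x.
Proof. by []. Qed.

Lemma lift_inj f (s t : lifts f) : small_lifts S s -> small_lifts S t ->
  (forall x, la_map S (lift_map s x) = la_map S (lift_map t x)) -> s = t.
Proof.
move=> ss st E1; apply: csection_eq => x.
apply: (@existT_inj N (fun p => tangent_space p : Type) (f x)).
have := la_invK (ss x); rewrite (E1 x) -[proj (lift_map s x)]/(proj (lift_map t x)) la_invK//.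
Qed.

Lemma lift_graph f (s : lifts f) x : small_lifts S s -> la_graph S (f x, la_map S (lift_map s x)).
Proof. by move=> ss; exists (lift_map s x) => //; exact: ss. Qed.

Lemma lift_support f (s : lifts f) : exists2 K : set X, compact K &
  forall x, ~ K x -> la_map S (lift_map s x) = f x.
Proof.
have [K cK Ks] := csec_supported s; exists K => // x nK.
by rewrite /lift_map (Ks x nK) la_map0.
Qed.

(** The lift is the inverse of [la_pair] applied to [(f x, h x)]. On the diagonal this inverse gives
    zero vectors, so the lift vanishes where [h] agrees with [f]. *)
Lemma lift_exists f (h : X -> N) : continuous h ->
  (exists2 K : set X, compact K & forall x, ~ K x -> h x = f x) ->
  (forall x, la_graph S (f x, h x)) ->
  exists2 s : lifts f, small_lifts S s & forall x, la_map S (lift_map s x) = h x.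
Proof.
move=> ch [K cK hK] gfh.
pose s x : fib (pullback f TN) x := vec (f x) (la_inv S (f x, h x)).
have sE x : @tot R N TN (f x) (s x) = la_inv S (f x, h x).
  by apply: tot_vec; have [_ ->] := la_invP (gfh x).
have cs : continuous (fun x => tot (s x)).
  move=> x; apply/(@pullback_cvg R X N f TN X (nbhs x) _ id s x (s x)); split; first exact: cvg_id.
  rewrite sE; under eq_fun do rewrite sE.
  have c1 : (fun x => (f x, h x)) @ x --> (f x, h x).
    by apply: cvg_pair; [exact: cts_fun|exact: ch].
  exact: (cvg_comp _ _ c1 (la_inv_cvg (gfh x))).
have sup : exists2 K : set X, compact K & supported K (MkSection cs).
  exists K => // x nK /=; rewrite /s (hK x nK); have [_ ->] := la_graph_diag S (f x).
  exact: vec_tot.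
exists (MkCSection sup).
  by move=> x; rewrite /lift_map/= sE; have [] := la_invP (gfh x).
by move=> x; rewrite /lift_map/= sE; have [] := la_invP (gfh x).
Qed.

Lemma mapping_paramE f (s : @small_lifts R N S X f) x :
  (mapping_param s : continuousType X N) x = la_map S (lift_map (set_val s) x).
Proof. by []. Qed.

Lemma mapping_param_inj f (s t : @small_lifts R N S X f) : mapping_param s = mapping_param t -> s = t.
Proof.
move=> st; apply: val_inj; apply: lift_inj; [exact: set_valP|exact: set_valP|].
by move=> x; rewrite -!mapping_paramE st.
Qed.

Lemma mapping_rangeP f h : range (@mapping_param R N S X f) h <->
  exists2 s : lifts f, small_lifts S s & forall x, la_map S (lift_map s x) = h x.
Proof.
split=> [[s _ <-]|[s ss sE]]; first by exists (set_val s) => //; exact: set_valP.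
exists (exist _ s (mem_set ss)) => //; apply/continuousEP => x.
by rewrite mapping_paramE.
Qed.

End OneSpace.

(** * Coordinate expressions of composition with a map of base spaces *)

Section Transition.
Context {X1 X2 : topologicalType}.
Context (hX1 : hausdorff_space X1) (pX1 : paracompact X1) (lX1 : locally_compact [set: X1]).
Context (hX2 : hausdorff_space X2) (pX2 : paracompact X2) (lX2 : locally_compact [set: X2]).
(** With [j] the identity this setting describes changes of charts, with [j] the inclusion of [Y]
    the restriction map. [rho0] is composition of lifts with [j], so that [g2] stands for
    [f1 \o j]. *)
Context (f1 : continuousType X1 N) (f2 g2 : continuousType X2 N) (j : X2 -> X1).

Lemma lifts_bundle (X : topologicalType) (f : continuousType X N) : hausdorff_space X ->
  is_vector_bundle (pullback f TN).
Proof.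
move=> hX; apply: pullback_vector_bundle => //; first exact: cts_fun.
exact: tangent_vector_bundle.
Qed.

Local Notation V1 := (csections hX1 pX1 (lifts_bundle f1 hX1)).
Local Notation V2 := (csections hX2 pX2 (lifts_bundle f2 hX2)).
Local Notation W2 := (csections hX2 pX2 (lifts_bundle g2 hX2)).
Context (rho0 : V1 -> W2).
Hypotheses (lrho0 : linear rho0) (crho0 : continuous rho0).
Hypothesis rho0E : forall (s : V1) y, lift_map (rho0 s : lifts g2) y = lift_map (s : lifts f1) (j y).
Hypothesis jK : forall K, compact K -> compact (j @^-1` K).
Context (M1 M2 : tvsType R) (i1 : V1 -> M1) (i2 : V2 -> M2).
Hypotheses (bi1 : bijective i1) (li1 : linear i1) (oi1 : forall B, open B -> open (i1 @` B)).
Hypotheses (hM2 : hausdorff_space M2) (li2 : linear i2) (ci2 : continuous i2).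

Lemma small_lifts_open : open (@small_lifts R N S X1 f1 : set V1).
Proof.
have oB : open [set e : total (pullback f1 TN) | la_dom S (@tot R N TN (f1 (tag e)) (tagged e))].
  by apply: open_comp; [move=> e _; exact: pullback_tot_continuous|exact: la_dom_open].
exact: (@open_sections R X1 (pullback f1 TN) hX1 pX1 (lifts_bundle f1 hX1) _ lX1 oB).
Qed.

Definition transition_dom : set V1 := [set s | small_lifts S (s : lifts f1) /\
  exists2 t : V2, small_lifts S (t : lifts f2) &
    forall y, la_map S (lift_map (t : lifts f2) y) = la_map S (lift_map (s : lifts f1) (j y))].

Lemma transition_domP (s : V1) : transition_dom s -> forall y,
  fibre_dom S f2 (@tot R X2 (pullback g2 TN) y (rho0 s y)).
Proof.
move=> [ss [t st tE]] y; split => /=.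
  by rewrite -[tot _]/(lift_map (rho0 s : lifts g2) y) rho0E; exact: ss.
rewrite -[tot _]/(lift_map (rho0 s : lifts g2) y) rho0E -tE; exact: lift_graph.
Qed.

(** If the domain is non-empty, [f1 \o j] and [f2] agree off a compact set; the lifts given by
    [lift_exists] then have compact support, and membership reduces to pointwise open conditions. *)
Lemma transition_dom_open : open transition_dom.
Proof.
have [->|/set0P[s0 [ss0 [t0 st0 tE0]]]] := eqVneq transition_dom set0; first exact: open0.
have offK : exists2 K : set X2, compact K & forall y, ~ K y -> f1 (j y) = f2 y.
  have [K cK KE] := lift_support (s0 : lifts f1).
  have [L cL LE] := lift_support (t0 : lifts f2).
  exists (j @^-1` K `|` L); first by apply: compactU => //; exact: jK.
  move=> y nKL; rewrite -KE; last by move=> Ky; apply: nKL; left.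
  by rewrite -tE0 LE// => Ly; apply: nKL; right.
have cg2 := @cts_fun _ _ g2; have cf2 := @cts_fun _ _ f2.
have oB := @fibre_dom_open R N S X2 f2 g2 cf2.
have oV := @open_sections R X2 (pullback g2 TN) hX2 pX2 (lifts_bundle g2 hX2) _ lX2 oB.
have oV' : open (rho0 @^-1` [set s : W2 | forall y, fibre_dom S f2 (@tot R X2 (pullback g2 TN) y (s y))]).
  by apply: open_comp => // s _; exact: crho0.
have -> : transition_dom = @small_lifts R N S X1 f1 `&`
    rho0 @^-1` [set s : W2 | forall y, fibre_dom S f2 (@tot R X2 (pullback g2 TN) y (s y))].
  apply/seteqP; split=> s; first by move=> ds; split; [case: ds|exact: transition_domP].
  move=> [ss gs]; split => //.
  pose h y := la_map S (lift_map (s : lifts f1) (j y)).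
  have hE y : h y = la_map S (lift_map (rho0 s : lifts g2) y) by rewrite rho0E.
  have ch : continuous h.
    rewrite (_ : h = fun y => la_map S (lift_map (rho0 s : lifts g2) y)); last exact/funext.
    move=> y; have c1 : lift_map (rho0 s : lifts g2) @ y --> lift_map (rho0 s : lifts g2) y.
      exact: lift_map_continuous.
    by apply: (cvg_comp _ _ c1); apply: la_map_cvg; have [] := gs y.
  have [||t st tE] := lift_exists (f := f2) ch; last by exists t.
    have [K cK KE] := offK; have [L cL LE] := lift_support (s : lifts f1).
    exists (K `|` j @^-1` L); first by apply: compactU => //; exact: jK.
    move=> y nKL; rewrite /h LE; last by move=> Ly; apply: nKL; right.
    by apply: KE => Ky; apply: nKL; left.
  by move=> y; rewrite hE; have [_] := gs y.
exact: openI small_lifts_open oV'.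
Qed.

(** In coordinates the map is the push-forward by the fibre maps from [g2] to [f2], preceded by the
    continuous linear map [rho0]. *)
Lemma transition_smooth (G : M1 -> M2) :
  (forall (s : V1) (t : V2), small_lifts S (s : lifts f1) -> small_lifts S (t : lifts f2) ->
    (forall y, la_map S (lift_map (t : lifts f2) y) = la_map S (lift_map (s : lifts f1) (j y))) ->
    G (i1 s) = i2 t) ->
  smooth_on (i1 @` transition_dom) G.
Proof.
move=> GE; have [k1 ik ki] := bi1.
have ck1 : continuous k1.
  apply/continuousP => B oB; have -> : k1 @^-1` B = i1 @` B; last exact: oi1.
  by apply/seteqP; split => [m /= Bm|_ [s Bs <-] /=]; [exists (k1 m)|rewrite ik].
have lk1 : linear k1 by move=> a m m'; apply: (can_inj ik); rewrite ki li1 !ki.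
have oO1 := @fibre_dom_open R N S X2 f2 g2 (@cts_fun _ _ f2).
have fsm := @fibre_map_smooth R N S X2 f2 g2 (@cts_fun _ _ f2) (@cts_fun _ _ g2).
have PS := (@pushforward_smooth R X2 (pullback g2 TN) (pullback f2 TN) hX2 pX2 lX2 (lifts_bundle g2 hX2)
  (lifts_bundle f2 hX2) (@fibre_dom R N S X2 f2 g2) (@fibre_deriv R N S X2 f2 g2) oO1 fsm M1 M2 (rho0 \o k1) i2 (i1 @` transition_dom) G).
apply: PS => //.
- by move=> a m m' /=; rewrite lk1 lrho0.
- by move=> m; apply: (cvg_comp _ _ (@ck1 m)); exact: crho0.
- by apply: oi1; exact: transition_dom_open.
- by move=> _ [s ds <-] y /=; rewrite ik; exact: transition_domP.
- move=> _ [s [ss [t st tE]] <-]; exists t; last exact: GE.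
  move=> y; rewrite /= ik /fibre_deriv /= /fibre_map.
  have E1 : @tot R N TN (g2 y) (rho0 s y) = lift_map (s : lifts f1) (j y) by exact: (rho0E s y).
  rewrite E1 -tE; have /(congr1 (vec (f2 y))) := la_invK (st y).
  by rewrite lift_map_proj [X in _ = X -> _]vec_tot.
Qed.

End Transition.
End MappingSpaces.

Lemma hausdorff_inj (S T : topologicalType) (k : S -> T) :
  continuous k -> injective k -> hausdorff_space T -> hausdorff_space S.
Proof.
move=> ck ik hT p q pq; apply/ik/hT => A B nA nB.
have [z [Az Bz]] := pq (k @^-1` A) (k @^-1` B) (ck _ _ nA) (ck _ _ nB).
by exists (k z).
Qed.

Lemma smooth_on_continuous (R : realType) (E F : tvsType R) (W : set E) (f : E -> F) x :
  open W -> smooth_on W f -> W x -> f @ x --> f x.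
Proof.
move=> oW sW Wx.
exact: (@smooth_on_cvg _ _ _ W f E (nbhs x) id x [::] oW sW (nbhs_filter x) Wx cvg_id).
Qed.

Section MappingCharts.
Context {R : realType} {N : manifold R} (S : local_addition N).
Local Notation TN := (tangent_bundle N).

Section Atlas.
Context {X : topologicalType}.
Context (hX : hausdorff_space X) (pX : paracompact X) (lX : locally_compact [set: X]).
Local Notation V f := (csections hX pX (@lifts_bundle R N X f hX)).

Lemma mapping_atlasP (c : chart R (mapping_space S X)) : mapping_atlas S X c ->
  exists f (i : V f -> model c),
    [/\ bijective i, linear i, continuous i & forall B, open B -> open (i @` B)] /\
    [/\ cdom c = range (@mapping_param R N S X f),
        crange c = i @` (@small_lifts R N S X f : set (V f)) &
        forall s : @small_lifts R N S X f,
          cfwd c (mapping_param s) = i (set_val s) /\ cbwd c (i (set_val s)) = mapping_param s].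
Proof.
move=> [f [i [[bi ci oi li] [dE cE]]]]; exists f, i; split; split => //.
- by move=> a s t; apply: li => x; rewrite csectionsDE csectionsZE.
- rewrite /crange dE; apply/seteqP; split => m.
    by move=> [_ [s _ <-] <-]; exists (set_val s); [exact: set_valP|have [->] := cE s].
  move=> [s ss <-]; exists (mapping_param (exist _ s (mem_set ss))); first by eexists.
  by have [->] := cE (exist _ s (mem_set ss)).
Qed.

Lemma mapping_model_hausdorff (c : chart R (mapping_space S X)) :
  mapping_atlas S X c -> hausdorff_space (model c).
Proof.
move=> /mapping_atlasP[f [i [[[k ik ki] li ci oi] _]]].
apply: (@hausdorff_inj _ (V f) k).
- apply/continuousP => B oB; have -> : k @^-1` B = i @` B; last exact: oi.
  by apply/seteqP; split => [m /= Bm|_ [s Bs <-] /=]; [exists (k m)|rewrite ik].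
- exact: can_inj ki.
- exact: csections_hausdorff.
Qed.

(** A member of the atlas whose model is the space of lifts itself; [f] is a dummy value off the
    small lifts. *)
Definition mapping_chart (f : continuousType X N) : chart R (mapping_space S X) :=
  @Chart R (mapping_space S X) (V f) (range (@mapping_param R N S X f))
    (fun h => xget (0 : V f) [set v | exists2 s : @small_lifts R N S X f, mapping_param s = h & v = set_val s])
    (fun v => if pselect (@small_lifts R N S X f v) is left p then mapping_param (exist _ v (mem_set p))
      else (f : mapping_space S X)).

Lemma mapping_chartE f (s : @small_lifts R N S X f) :
  cfwd (mapping_chart f) (mapping_param s) = set_val s /\
  cbwd (mapping_chart f) (set_val s) = mapping_param s.
Proof.
split => /=.
  case: xgetP => [v _ [t /mapping_param_inj -> ->] //|].
  by move=> /(_ (set_val s)) []; exists s.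
case: pselect => [p|]; last by have := set_valP s.
by congr mapping_param; exact: val_inj.
Qed.

Lemma mapping_chart_atlas f : mapping_atlas S X (mapping_chart f).
Proof.
exists f, (id : lifts f -> V f); split; split => //.
- by exists id.
- by move=> s; exact: cvg_id.
- by move=> O' oO; rewrite image_id.
- by move=> a s t u uE; apply: csection_eq => x; rewrite csectionsDE csectionsZE.
- exact: mapping_chartE.
Qed.

Lemma mapping_chart_self f : cdom (mapping_chart f) f.
Proof.
apply/mapping_rangeP; apply: lift_exists; first exact: cts_fun.
- by exists set0 => //; exact: compact0.
- by move=> x; have [] := la_graph_diag S (f x).
Qed.

Lemma mapping_eval_continuous (x : X) :
  continuous (fun h : mapping_space S X => (h : continuousType X N) x).
Proof.
apply/continuousP => O' oO.
suff : @final_open _ _ _ (@mapping_param R N S X)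
    ((fun h : mapping_space S X => (h : continuousType X N) x) @^-1` O') by [].
move=> f.
(* A condition at the single point [x] becomes an open subset of the total space by imposing nothing
   over the other points, which form an open set. *)
pose B : set (total (pullback f TN)) := [set e | la_dom S (@tot R N TN (f (tag e)) (tagged e)) /\
  (tag e <> x \/ O' (la_map S (@tot R N TN (f (tag e)) (tagged e))))].
have oB : open B.
  rewrite openE => e [de oe].
  have nd : nbhs e [set z : total (pullback f TN) | la_dom S (@tot R N TN (f (tag z)) (tagged z))].
    exact: (@pullback_tot_continuous _ _ _ f TN e _ (open_nbhs_nbhs (conj (la_dom_open S) de))).
  case: oe => oe; last first.
    have nO := la_tot_cvg de (open_nbhs_nbhs (conj oO oe)).
    by apply: (filter_imp2 _ nd nO) => z dz Oz; split => //; right.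
  have nx : nbhs e [set z : total (pullback f TN) | tag z <> x].
    apply: (@pullback_proj_continuous _ _ _ f TN e [set y | y <> x]).
    apply: open_nbhs_nbhs; split => //.
    have : closed [set x] := accessible_closed_set1 (hausdorff_accessible hX) (x := x).
    by move=> /closed_openC; congr open.
  by apply: (filter_imp2 _ nd nx) => z dz xz; split => //; left.
have oS := @open_sections R X (pullback f TN) hX pX (lifts_bundle f hX) _ lX oB.
exists ([set s : V f | forall y, B (tot (s y))]) => //.
apply/seteqP; split=> s /=.
  by move=> /(_ x)[_ [//|]].
move=> Os y; split; first by have := set_valP s; exact.
have [->|] := pselect (y = x); first by right.
by left.
Qed.

Lemma mapping_space_hausdorff : hausdorff_space (mapping_space S X).
Proof.
move=> h h' hh; apply/(@continuousEP _ _ h h') => x; apply: (@manifold_hausdorff R N) => P Q nP nQ.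
have [z [Pz Qz]] := hh _ _ (@mapping_eval_continuous x h _ nP) (@mapping_eval_continuous x h' _ nQ).
by exists ((z : continuousType X N) x).
Qed.

End Atlas.

Section Change.
Context {X1 X2 : topologicalType}.
Context (hX1 : hausdorff_space X1) (pX1 : paracompact X1) (lX1 : locally_compact [set: X1]).
Context (hX2 : hausdorff_space X2) (pX2 : paracompact X2) (lX2 : locally_compact [set: X2]).
Context (j : X2 -> X1) (res : mapping_space S X1 -> mapping_space S X2).
Hypothesis resE : forall (h : mapping_space S X1) y,
  (res h : continuousType X2 N) y = (h : continuousType X1 N) (j y).
Hypothesis jK : forall K, compact K -> compact (j @^-1` K).
Local Notation V1 f := (csections hX1 pX1 (@lifts_bundle R N X1 f hX1)).
Local Notation V2 f := (csections hX2 pX2 (@lifts_bundle R N X2 f hX2)).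
Context (g2 : continuousType X1 N -> continuousType X2 N).
Context (rho0 : forall f : continuousType X1 N, V1 f -> V2 (g2 f)).
Arguments rho0 : clear implicits.
Hypotheses (lrho0 : forall f, linear (rho0 f)) (crho0 : forall f, continuous (rho0 f)).
Hypothesis rho0E : forall f (s : V1 f) y,
  lift_map (rho0 f s : lifts (g2 f)) y = lift_map (s : lifts f) (j y).

Lemma res_param f (s : @small_lifts R N S X1 f) : exists t : @small_lifts R N S X2 (g2 f),
  set_val t = rho0 f (set_val s) /\ res (mapping_param s) = mapping_param t.
Proof.
have st : @small_lifts R N S X2 (g2 f) (rho0 f (set_val s)).
  by move=> y; rewrite rho0E; have := set_valP s; exact.
exists (exist (fun t => t \in @small_lifts R N S X2 (g2 f)) _ (mem_set st)); split => //.
apply/continuousEP => y; rewrite resE !mapping_paramE; congr la_map; apply/esym; exact: rho0E.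
Qed.

Lemma res_continuous : continuous res.
Proof.
apply/continuousP => O' oO.
suff : @final_open _ _ _ (@mapping_param R N S X1) (res @^-1` O') by [].
move=> f; have [B oB BE] := oO (g2 f).
exists (rho0 f @^-1` B); first by apply: open_comp => // s _; exact: crho0.
apply/seteqP; split=> s /=; have [t [tE ->]] := res_param s; rewrite -tE.
  by move=> Bt; have : (set_val @^-1` B) t by []; rewrite BE.
by move=> Ot; have : (@mapping_param R N S X2 (g2 f) @^-1` O') t by []; rewrite -BE.
Qed.

Lemma res_dom_open (f1 : continuousType X1 N) (f2 : continuousType X2 N) :
  open [set s : @small_lifts R N S X1 f1 | range (@mapping_param R N S X2 f2) (res (mapping_param s))].
Proof.
exists (@transition_dom R N S X1 X2 hX1 pX1 hX2 pX2 f1 f2 j).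
  exact: (transition_dom_open lX1 lX2 (@crho0 f1) (@rho0E f1) jK).
apply/seteqP; split=> s /=.
  move=> [_ [t st tE]]; apply/mapping_rangeP; exists t => // y.
  by rewrite tE resE.
move=> /mapping_rangeP[t st tE]; split; first exact: set_valP.
by exists t => // y; rewrite tE resE.
Qed.

Lemma res_smooth (c : chart R (mapping_space S X1)) (d : chart R (mapping_space S X2)) :
  mapping_atlas S X1 c -> mapping_atlas S X2 d ->
  let W := cfwd c @` (cdom c `&` res @^-1` cdom d) in
  open W /\ smooth_on W (cfwd d \o res \o cbwd c).
Proof.
move=> Ac Ad /=; have hd := mapping_model_hausdorff hX2 pX2 Ad.
have [f1 [i1 [[bi1 li1 ci1 oi1] [dc _ cE]]]] := mapping_atlasP hX1 pX1 Ac.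
have [f2 [i2 [[bi2 li2 ci2 oi2] [dd _ dE]]]] := mapping_atlasP hX2 pX2 Ad.
have -> : cfwd c @` (cdom c `&` res @^-1` cdom d) =
    i1 @` (@transition_dom R N S X1 X2 hX1 pX1 hX2 pX2 f1 f2 j).
  rewrite dc dd; apply/seteqP; split => m.
    move=> [_ [[s _ <-] /mapping_rangeP[t st tE]] <-]; exists (set_val s); last by have [->] := cE s.
    by split; [exact: set_valP|exists t => // y; rewrite tE resE].
  move=> [s [ss [t st tE]] <-]; exists (mapping_param (exist _ s (mem_set ss))).
    split; first by eexists.
    by apply/mapping_rangeP; exists t => // y; rewrite tE resE.
  by have [->] := cE (exist _ s (mem_set ss)).
split.
  by apply: oi1; exact: (transition_dom_open lX1 lX2 (@crho0 f1) (@rho0E f1) jK).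
apply: (transition_smooth lX1 lX2 (@lrho0 f1) (@crho0 f1) (@rho0E f1) jK bi1 li1 oi1 hd li2 ci2).
move=> s t ss st tE /=; have [_ ->] := cE (exist _ s (mem_set ss)).
have -> : res (mapping_param (exist _ s (mem_set ss))) = mapping_param (exist _ t (mem_set st)).
  by apply/continuousEP => y; rewrite resE !mapping_paramE /= tE.
by have [->] := dE (exist _ t (mem_set st)).
Qed.

End Change.
End MappingCharts.

(** * The smooth structure on the space of mappings *)

Section MappingManifold.
Context {R : realType} {N : manifold R} (S : local_addition N).
Context {X : topologicalType}.
Context (hX : hausdorff_space X) (pX : paracompact X) (lX : locally_compact [set: X]).
Local Notation V f := (csections hX pX (@lifts_bundle R N X f hX)).
Implicit Types c d : chart R (mapping_space S X).

Let idV f : V f -> V f := id.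
Arguments idV : clear implicits.

Let idV_linear f : linear (idV f). Proof. by []. Qed.

Let idV_continuous f : continuous (idV f).
Proof. by move=> s; exact: cvg_id. Qed.

Lemma mapping_transition c d : mapping_atlas S X c -> mapping_atlas S X d ->
  open (cfwd c @` (cdom c `&` cdom d)) /\ smooth_transition c d.
Proof.
move=> Ac Ad.
by have [] := @res_smooth R N S X X hX pX lX hX pX lX id id (fun _ _ => erefl) (fun _ cK => cK) id idV
  idV_linear idV_continuous (fun _ _ _ => erefl) c d Ac Ad.
Qed.

Lemma mapping_dom_open c : mapping_atlas S X c -> open (cdom c).
Proof.
move=> /(mapping_atlasP hX pX)[f2 [i [_ [-> _ _]]]].
suff : @final_open _ _ _ (@mapping_param R N S X) (range (@mapping_param R N S X f2)) by [].
move=> f; exact: (@res_dom_open R N S X X hX pX lX hX pX lX id id (fun _ _ => erefl) (fun _ cK => cK) id idV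
  idV_continuous (fun _ _ _ => erefl) f f2).
Qed.

Lemma mapping_is_chart c : mapping_atlas S X c -> is_chart c.
Proof.
move=> Ac; have [f [i [[bi li ci oi] [dE rE cE]]]] := mapping_atlasP hX pX Ac.
have od := mapping_dom_open Ac.
have oR : open (crange c) by rewrite rE; apply: oi; exact: small_lifts_open.
split; split => //; first exact: (mapping_model_hausdorff hX pX Ac).
- by rewrite dE => _ [s _ <-]; have [-> ->] := cE s.
- apply: within_open_intro => // h ch.
  move=> B; rewrite {1}nbhsE => -[B0 [oB0 B0h] B0B].
  (* Openness in the final topology is tested against the parametrization at every [f'], where it
     follows from continuity of the change of charts. *)
  have oP : open (cdom c `&` cfwd c @^-1` B0).
    suff : @final_open _ _ _ (@mapping_param R N S X) (cdom c `&` cfwd c @^-1` B0) by [].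
    move=> f'; have Ac' := mapping_chart_atlas S hX pX f'.
    have [oW sW] := mapping_transition Ac' Ac.
    set W := cfwd _ @` _ in oW sW.
    exists (W `&` (cfwd c \o cbwd (mapping_chart S hX pX f')) @^-1` B0).
      rewrite openE => m [Wm Bm].
      have n1 := open_nbhs_nbhs (conj oW Wm).
      have n2 := smooth_on_continuous oW sW Wm (open_nbhs_nbhs (conj oB0 Bm)).
      by apply: (filter_imp2 _ n1 n2).
    have gE (t : @small_lifts R N S X f') :
        (cfwd c \o cbwd (mapping_chart S hX pX f')) (set_val t) = cfwd c (mapping_param t).
      by have [_ E] := mapping_chartE hX pX t; congr (cfwd c _).
    apply/seteqP; split=> t.
      move=> [[g [[t' _ <-] ct'] t'E] Bt].
      have Bt' : B0 (cfwd c (mapping_param t)) by rewrite -gE; exact: Bt.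
      have tt' : t = t' by have [E _] := mapping_chartE hX pX t'; apply: val_inj; exact: etrans (esym t'E) E.
      by rewrite tt' in Bt' *.
    move=> [ct Bt]; split; last first.
      suff : B0 ((cfwd c \o cbwd (mapping_chart S hX pX f')) (set_val t)) by [].
      by rewrite gE; exact: Bt.
    exists (mapping_param t); last by have [] := mapping_chartE hX pX t.
    by split => //; exists t.
  have nP : nbhs h (cdom c `&` cfwd c @^-1` B0) by exact: open_nbhs_nbhs.
  suff : nbhs h [set z | B (cfwd c z)] by [].
  by apply: (filter_imp _ nP) => z [_ /B0B].
- apply: within_open_intro => //; rewrite rE => _ [s ss <-] B; rewrite {1}nbhsE => -[B0 [oB0 B0h] B0B].
  have [P oP PE] := oB0 f.
  have oQ : open (i @` (@small_lifts R N S X f `&` P)).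
    by apply: oi; apply: (openI _ oP); exact: small_lifts_open.
  have nQ : nbhs (i s) (i @` (@small_lifts R N S X f `&` P)).
    apply: open_nbhs_nbhs; split => //; exists s => //; split => //.
    suff : (set_val @^-1` P) (exist _ s (mem_set ss) : @small_lifts R N S X f) by [].
    by rewrite PE /=; have [_ <-] := cE (exist _ s (mem_set ss)).
  suff : nbhs (i s) [set z | B (cbwd c z)] by [].
  apply: (filter_imp _ nQ) => _ [t [st Pt] <-]; apply: B0B.
  have [_ ->] := cE (exist _ t (mem_set st)).
  have : (set_val @^-1` P) (exist _ t (mem_set st) : @small_lifts R N S X f) by [].
  by rewrite PE.
Qed.

Lemma mapping_atlas_smooth : smooth_atlas (mapping_atlas S X).
Proof.
split.
- exact: mapping_space_hausdorff.
- exact: mapping_is_chart.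
- move=> h; exists (mapping_chart S hX pX h); last exact: mapping_chart_self.
  exact: mapping_chart_atlas.
- by move=> c d Ac Ad; have [] := mapping_transition Ac Ad.
Qed.

End MappingManifold.

Lemma smooth_atlas_maximal (R : realType) (M : topologicalType) (A : atlas_on R M) :
  smooth_atlas A -> forall c, A c -> maximal_atlas A c.
Proof. by move=> [_ Ac _ At] c cA; split; [exact: Ac|move=> d dA; split; exact: At]. Qed.

(** Sections are moved along the base map [b] by fibre maps [T]. A compact [K] is tested through its
    compact image under [b], where [section_eval] applies. *)
Lemma section_map_continuous (R : realType) (X1 X2 : topologicalType) (E1 : vfamily R X1)
    (E2 : vfamily R X2) (b : X2 -> X1) (T : forall x, fib E1 (b x) -> fib E2 x)
    (phi : section E1 -> section E2) :
  hausdorff_space X1 -> paracompact X1 -> continuous b ->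
  (forall (Z : Type) (D : set_system Z) (FD : Filter D) (xs : Z -> X2)
     (e : forall z, fib E1 (b (xs z))) (x0 : X2) (e0 : fib E1 (b x0)),
     xs @ D --> x0 -> (fun z => tot (e z)) @ D --> (tot e0 : total E1) ->
     (fun z => tot (T (xs z) (e z))) @ D --> (tot (T x0 e0) : total E2)) ->
  (forall s x, phi s x = T x (s (b x))) -> continuous phi.
Proof.
move=> hX1 pX1 cb HT phiE s0; 
apply: (@section_cvg R X2 E2 (section E1) (nbhs s0) (nbhs_filter s0) phi (phi s0)) => K x0 cK Kx0.
rewrite phiE (_ : (fun p : section E1 * X2 => tot (phi p.1 p.2)) =
  fun p => tot (T p.2 (p.1 (b p.2)))); last by apply/funext => p; rewrite phiE.
have c2 : (fun p : section E1 * X2 => p.2) @ filter_prod (nbhs s0) (within K (nbhs x0)) --> x0.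
  by apply: (cvg_trans _ (@cvg_within _ (nbhs x0) _ K)); exact: cvg_snd.
apply: (HT _ _ _ (fun p : section E1 * X2 => p.2) (fun p => p.1 (b p.2))) => //.
have cbK : compact (b @` K) by apply: continuous_compact => //; exact: continuous_subspaceT.
have bKx : (b @` K) (b x0) by exists x0.
have H := @section_eval R X1 E1 (b @` K) (b x0) s0 hX1 pX1 cbK bKx.
have G : (fun p : section E1 * X2 => (p.1, b p.2)) @ filter_prod (nbhs s0) (within K (nbhs x0))
    --> filter_prod (nbhs s0) (within (b @` K) (nbhs (b x0))).
  move=> B [[P Q] /= [nP nQ] PQ].
  exists (P, [set x | Q (b x)]) => /=; last by move=> [s x] [/= Ps Qx]; exact: PQ.
  split => //; have n1 : nbhs x0 [set x | (b @` K) (b x) -> Q (b x)] by exact: (cb x0 _ nQ).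
  suff : nbhs x0 [set x | K x -> Q (b x)] by [].
  by apply: (filter_imp _ n1) => x Qx Kx; apply: Qx; exists x.
exact: (cvg_comp _ _ G H).
Qed.

(** * The restriction map in charts *)

Section RestrictionSubmersion.
Context {R : realType} {N : manifold R} (S : local_addition N).
Local Notation TN := (tangent_bundle N).
Context {X : topologicalType} {Y : set X}.
Context (hX : hausdorff_space X) (pX : paracompact X) (lX : locally_compact [set: X]) (cY : closed Y).
Local Notation hY := (@subtype_hausdorff X Y hX).
Local Notation pY := (closed_paracompact cY pX).
Local Notation lY := (closed_locally_compact cY hX lX).
Local Notation VX f := (csections hX pX (@lifts_bundle R N X f hX)).
Local Notation VY g := (csections hY pY (@lifts_bundle R N Y g hY)).

Lemma compact_preimage_set_val (K : set X) : compact K -> compact (set_val @^-1` K : set Y).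
Proof.
move=> cK; have -> : set_val @^-1` K = set_val @^-1` (K `&` Y) :> set Y.
  by apply/seteqP; split=> y /= => [Ky|[]//]; split => //; exact: set_valP.
apply: compact_subtype; first by move=> x [].
exact: compact_closedI.
Qed.

Definition restrict_cts (f : continuousType X N) : continuousType Y N :=
  mkcts (@restrict_continuous R N X Y f).

Section Lifts.
Context (f : continuousType X N).

Lemma restrict_lift_cvg (Z : Type) (D : set_system Z) (FD : Filter D) (ys : Z -> Y)
    (e : forall z, fib (pullback f TN) (set_val (ys z))) (y0 : Y) (e0 : fib (pullback f TN) (set_val y0)) :
  ys @ D --> y0 -> (fun z => tot (e z)) @ D --> (tot e0 : total (pullback f TN)) ->
  (fun z => @tot R Y (pullback (restrict_cts f) TN) (ys z) (e z)) @ D -->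
    (@tot R Y (pullback (restrict_cts f) TN) y0 e0 : total (pullback (restrict_cts f) TN)).
Proof.
move=> cy ce; apply/(@pullback_cvg R Y N (restrict_cts f) TN); split => //.
by move: ce => /(@pullback_cvg R X N f TN)[].
Qed.

Lemma unrestrict_lift_cvg (Z : Type) (D : set_system Z) (FD : Filter D) (ys : Z -> Y)
    (e : forall z, fib (pullback (restrict_cts f) TN) (ys z)) (y0 : Y)
    (e0 : fib (pullback (restrict_cts f) TN) y0) :
  ys @ D --> y0 -> (fun z => tot (e z)) @ D --> (tot e0 : total (pullback (restrict_cts f) TN)) ->
  (fun z => @tot R Y (restrict_bundle Y (pullback f TN)) (ys z) (e z)) @ D -->
    (@tot R Y (restrict_bundle Y (pullback f TN)) y0 e0 : total (restrict_bundle Y (pullback f TN))).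
Proof.
move=> cy ce; apply/(@pullback_cvg R Y X set_val (pullback f TN)); split => //.
apply/(@pullback_cvg R X N f TN); split.
  by apply: (cvg_comp _ _ cy); exact: initial_continuous.
by move: ce => /(@pullback_cvg R Y N (restrict_cts f) TN)[].
Qed.

Lemma restrict_lift_continuous (s : section (pullback f TN)) :
  continuous (fun y : Y => @tot R Y (pullback (restrict_cts f) TN) y (s (set_val y))).
Proof.
move=> y; apply: (@restrict_lift_cvg Y (nbhs y) _ id (fun y => s (set_val y))) => //.
have cv : (set_val : Y -> X) @ y --> set_val y by exact: initial_continuous.
exact: (cvg_comp _ _ cv (@sec_continuous _ _ _ s (set_val y))).
Qed.

Lemma unrestrict_lift_continuous (s : section (pullback (restrict_cts f) TN)) :
  continuous (fun y : Y => @tot R Y (restrict_bundle Y (pullback f TN)) y (s y)).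
Proof.
move=> y; apply: (@unrestrict_lift_cvg Y (nbhs y) _ id s y (s y)) => //.
exact: (@sec_continuous _ _ _ s y).
Qed.

Lemma restrict_lift_supported (s : csection (pullback f TN)) :
  exists2 K : set Y, compact K & supported K (MkSection (@restrict_lift_continuous s)).
Proof.
have [K cK Ks] := csec_supported s; exists (set_val @^-1` K); first exact: compact_preimage_set_val.
by move=> y nK; exact: Ks.
Qed.

Lemma unrestrict_lift_supported (s : csection (pullback (restrict_cts f) TN)) :
  exists2 K : set Y, compact K & supported K (MkSection (@unrestrict_lift_continuous s)).
Proof. by have [K cK Ks] := csec_supported s; exists K. Qed.

Definition restrict_lift (s : VX f) : VY (restrict_cts f) :=
  MkCSection (restrict_lift_supported s).

(** The restriction to [Y] of the pullback along [f], and the pullback along the restriction of [f],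
    have the same fibres, but their total spaces are topologised through different maps. This
    identity on fibres passes to the bundle for which the extension operator is available. *)
Definition unrestrict_lift (s : csection (pullback (restrict_cts f) TN)) :
    csection (restrict_bundle Y (pullback f TN)) :=
  MkCSection (unrestrict_lift_supported s).

Lemma restrict_lift_linear : linear restrict_lift.
Proof. by apply: csections_linear => a s t u uE y; exact: uE. Qed.

Lemma csections_restrict_continuous : continuous restrict_lift.
Proof.
apply: (@csections_continuous _ _ _ _ _ _ _ _ _ _ _ _ (fun s => MkSection (@restrict_lift_continuous s))).
- exact: restrict_lift_linear.
- apply: (@section_map_continuous R X Y (pullback f TN) (pullback (restrict_cts f) TN) set_val (fun y v => v)) => //.
    exact: initial_continuous.
  by move=> Z D FD ys e y0 e0; exact: restrict_lift_cvg.
- by [].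
- move=> K cK; exists (set_val @^-1` K); first exact: compact_preimage_set_val.
  by move=> s Ks y nK; exact: Ks.
Qed.

Lemma csections_unrestrict_continuous : continuous unrestrict_lift.
Proof.
have bE := restrict_vector_bundle Y hX (lifts_bundle f hX).
apply: (@csections_continuous R Y Y _ _ hY pY (lifts_bundle _ hY) hY pY bE _
  (fun s => MkSection (@unrestrict_lift_continuous s))).
- by apply: csections_linear => a s t u uE y; exact: uE.
- apply: (@section_map_continuous R Y Y (pullback (restrict_cts f) TN) (restrict_bundle Y (pullback f TN)) id (fun y v => v)) => //.
  + exact: hY.
  + exact: pY.
  + by move=> y; exact: cvg_id.
  + by move=> Z D FD ys e y0 e0; exact: unrestrict_lift_cvg.
- by [].
- by move=> K cK; exists K.
Qed.

Lemma lift_extension : metrizable R Y -> exists r : VY (restrict_cts f) -> VX f,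
  [/\ linear r, continuous r & cancel r restrict_lift].
Proof.
move=> mY; have [ext [cext lext extE]] :=
  csection_extension_metrizable hX pX cY lX (lifts_bundle f hX) mY.
exists (ext \o unrestrict_lift); split.
- by apply: csections_linear => a s t u uE x; apply: lext => y; exact: uE.
- by move=> s; apply: (cvg_comp _ _ (@csections_unrestrict_continuous s)); exact: cext.
- by move=> s; apply: csection_eq => y; exact: extE.
Qed.

End Lifts.

Let resE (h : mapping_space S X) y :
  (restrict_mapping S Y h : continuousType Y N) y = (h : continuousType X N) (set_val y).
Proof. by []. Qed.

Let liftE f (s : VX f) y :
  lift_map (restrict_lift s : lifts (restrict_cts f)) y = lift_map (s : lifts f) (set_val y).
Proof. by []. Qed.

Lemma restrict_mapping_submersion : metrizable R Y ->
  is_submersion (mapping_atlas S X) (mapping_atlas S Y) (restrict_mapping S Y).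
Proof.
move=> mY; have SX := mapping_atlas_smooth S hX pX lX.
have SY := mapping_atlas_smooth S hY pY lY.
split => //.
  split.
    apply: continuous_subspaceT.
    exact: (@res_continuous R N S X Y hX pX hY pY set_val _ resE restrict_cts restrict_lift
      csections_restrict_continuous liftE).
  move=> c d Ac Ad; rewrite setIT.
  by have [] := @res_smooth R N S X Y hX pX lX hY pY lY set_val _ resE compact_preimage_set_val
    restrict_cts restrict_lift restrict_lift_linear csections_restrict_continuous liftE c d Ac Ad.
move=> h; pose c := mapping_chart S hX pX h; pose d := mapping_chart S hY pY (restrict_cts h).
have pfwd g : cdom c g -> cdom d (restrict_mapping S Y g) /\
    cfwd d (restrict_mapping S Y g) = restrict_lift (cfwd c g).
  move=> [s _ <-].
  have [t [tE ->]] := @res_param R N S X Y hX pX hY pY set_val _ resE restrict_cts restrict_lift liftE h s.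
  split; first by exists t.
  have [-> _] := mapping_chartE hY pY t; have [-> _] := mapping_chartE hX pX s; exact: tE.
have [r [lr cr rK]] := lift_extension h mY.
pose P : {linear model c -> model d} := HB.pack (@restrict_lift h : model c -> model d)
  (GRing.isLinear.Build _ _ _ _ _ (@restrict_lift_linear h)).
pose Q : {linear model d -> model c} := HB.pack (r : model d -> model c)
  (GRing.isLinear.Build _ _ _ _ _ lr).
exists c, d; split.
- by apply: (smooth_atlas_maximal SX); exact: mapping_chart_atlas.
- by apply: (smooth_atlas_maximal SY); exact: mapping_chart_atlas.
- exact: mapping_chart_self.
- by move=> _ [g cg <-]; have [] := pfwd g cg.
- exists P, Q; split => //.
  + exact: csections_restrict_continuous.
  + move=> _ [_ [g cg <-] <-]; have [dg gE] := pfwd g cg.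
    by exists (restrict_mapping S Y g).
  + by move=> g cg; have [_ gE] := pfwd g cg.
Qed.

End RestrictionSubmersion.

Theorem proposition7p19 (R : realType) (X : topologicalType) (Y : set X)
    (hX : hausdorff_space X) (hY : closed Y) :
  [/\ (* (a) *)
      paracompact X -> locally_compact [set: Y] -> metrizable R Y ->
      forall E : vfamily R X, is_vector_bundle E -> section_extension Y E,
      (* (b) *)
      metrizable R X ->
      (exists d : X -> X -> R, defines_topology d /\
         forall x, Y x -> exists Z : set X,
           [/\ Z `<=` Y, within Y (nbhs x) Z & complete_on d Z]) ->
      forall E : vfamily R X, is_vector_bundle E -> section_extension Y E,
      (* (c) *)
      paracompact X -> locally_compact [set: X] -> metrizable R Y ->
      forall E : vfamily R X, is_vector_bundle E -> csection_extension Y E &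
      (* (d) *)
      paracompact X -> locally_compact [set: X] -> metrizable R Y ->
      forall (N : manifold R) (S : local_addition N),
        is_submersion (mapping_atlas S X) (mapping_atlas S Y)
                      (restrict_mapping S Y)].
Proof.
split.
- move=> pX lY mY E bE.
  exact: section_extension_locally_compact hX pX hY bE lY mY.
- move=> mX _ E bE; exact: section_extension_metrizable mX hY bE.
- move=> pX lX mY E bE; exact: csection_extension_metrizable hX pX hY lX bE mY.
- move=> pX lX mY N S; exact: restrict_mapping_submersion.
Qed.
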